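(* Let $N\ge 2$ and let $V\subset\mathbb{R}^{N-1}$ be the Sierpiński gasket with intrinsic boundary $V_0$ and measure $\mu$. Let $\alpha\in C(V)$ satisfy $\alpha(x)\le 0$ for a.e. $x\in V$. Let $f:V\times\mathbb{R}\to\mathbb{R}$ be a continuous function such that: (i) $f(x,0)\ne0$ for any $x\in V$; (ii) there are $\nu>2$ and $r_0>0$ such that $t f(x,t)\le\nu F(x,t)<0$ for any $|t|\ge r_0$, $x\in V$, where $F(x,t):=\int_0^t f(x,s)\,ds$ for any $(x,t)\in V\times\mathbb{R}$; (iii) there are positive constants $M_0$ and $\beta$ such that $$\max_{(x,s)\in V\times[-M_0,M_0]}|f(x,s)|\le\frac{M_0}{2(\beta+1)(2N+3)^2}.$$ Then the problem $$\Delta u(x)+\alpha(x)u(x)=f(x,u(x))\quad (x\in V\setminus V_0),\qquad u|_{V_0}=0,$$ admits at least two strong non-trivial solutions, one of which lies in $$\mathbb{B}_{M_0^2/(2N+3)^2}=\left\{u\in H_0^1(V):\ \|u\|_\alpha<\frac{M_0}{2N+3}\right\}.$$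
   Context: **Sierpiński gasket.** Let $N\ge2$ be a natural number and let $p_1,\dots,p_N\in\mathbb{R}^{N-1}$ satisfy $|p_i-p_j|=1$ for $i\ne j$. Let $S_i(x)=\frac12x+\frac12p_i$ for $i=1,\dots,N$, and for $A\subset\mathbb{R}^{N-1}$ let $L(A)=\bigcup_{i=1}^N S_i(A)$. The Sierpiński gasket $V$ is the unique non-empty compact set with $L(V)=V$; its intrinsic boundary is $V_0=\{p_1,\dots,p_N\}$. The measure $\mu$ is the restriction to $V$ of the $d$-dimensional Hausdorff measure, $d=\log N/\log 2$, normalized so that $\mu(V)=1$. **Energy and function space.** Let $V_m:=L(V_{m-1})$ for $m\ge1$ and $V_*:=\bigcup_{m\ge0}V_m$. Distinct points $x,y\in V_m$ are called $m$-neighbours, written $x\sim_m y$, if both belong to the same set $S_{i_1}\circ\dots\circ S_{i_m}(V_0)$ for some $i_1,\dots,i_m\in\{1,\dots,N\}$ (then $|x-y|=2^{-m}$). For $u:V_*\to\mathbb{R}$ let $$W_m(u):=\left(\frac{N+2}{N}\right)^m\sum_{x,y\in V_m,\ x\sim_m y}(u(x)-u(y))^2 ,$$ the sum being over ordered pairs $(x,y)$. The sequence $W_m(u)$ is nondecreasing in $m$; let $W(u):=\lim_{m\to\infty}W_m(u)\in[0,\infty]$. A function on $V$ is restricted to $V_*$ when these are applied. Let $C_0(V)=\{u\in C(V):u|_{V_0}=0\}$ and $$H_0^1(V):=\{u\in C_0(V):W(u)<\infty\},\qquad \|u\|:=\sqrt{W(u)},$$ a Hilbert space with inner product $$\mathcal{W}(u,v):=\lim_{m\to\infty}\left(\frac{N+2}{N}\right)^m\sum_{x,y\in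 V_m,\ x\sim_m y}(u(x)-u(y))(v(x)-v(y)).$$ For $\alpha$ as in the claim, a norm on $H_0^1(V)$ equivalent to $\|\cdot\|$ is $$\|u\|_\alpha:=\sqrt{W(u)-\int_V\alpha(x)|u(x)|^2\,d\mu}.$$ **Laplacians and solutions.** The weak Laplacian $\Delta u$ of $u\in H_0^1(V)$ is defined by $\langle\Delta u,v\rangle=-\mathcal{W}(u,v)$ for all $v\in H_0^1(V)$. The standard (pointwise) Laplacian of $u\in C(V)$ exists and equals $g\in C(V)$ if $$\lim_{m\to\infty}\ \max_{x\in V_m\setminus V_0}\left|N(N+2)^m\sum_{y\in V_m,\ y\sim_m x}(u(y)-u(x))-g(x)\right|=0$$ (the constant $N$ is the one making this consistent with the weak Laplacian, i.e. with $-\mathcal{W}(u,v)=\int_V g\,v\,d\mu$ for all $v\in H_0^1(V)$). A function $u\in H_0^1(V)$ is a strong solution of the problem in the claim if its standard Laplacian exists and the equation holds pointwise on $V\setminus V_0$ with $\Delta u$ the standard Laplacian. Non-trivial means not identically zero. *)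

(* Defs.v *)
From HB Require Import structures.
From mathcomp Require Import all_boot all_order all_algebra.
From mathcomp Require Import all_classical all_reals all_analysis.
Set Implicit Arguments.
Unset Strict Implicit.
Unset Printing Implicit Defensive.
Import Order.TTheory GRing.Theory Num.Theory.
Import numFieldNormedType.Exports.
Local Open Scope classical_set_scope.
Local Open Scope ring_scope.

(* Functions on the gasket V are represented by functions on the ambient space
   R^n of which only the values on V matter; u \in C(V) is
   {within V, continuous u}. *)

(* The norm MathComp-Analysis puts on 'rV[R]_n is the sup norm. *)
Definition enorm (R : realType) (n : nat) (x : 'rV[R]_n) : R :=
  Num.sqrt (\sum_(i < n) x 0 i ^+ 2).

Definition borel (R : realType) (n : nat) := g_sigma_algebraType (@open 'rV[R]_n).

Section Hausdorff.
Variables (R : realType) (n : nat).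
Implicit Types A U : set 'rV[R]_n.

(* For an empty or unbounded set, diam is 0; unbounded sets never occur in the
   covers below. *)
Definition diam A : R := sup [set enorm (x - y) | x in A & y in A].

Definition delta_cover (delta : R) A (U : nat -> set 'rV[R]_n) : Prop :=
  A `<=` \bigcup_k U k /\
  forall k x y, U k x -> U k y -> enorm (x - y) <= delta.

(* The conventions are those of a dimension d > 0: an empty set of a cover
   contributes 0 `^ d = 0. *)
Definition hausdorff_delta (d delta : R) A : \bar R :=
  ereal_inf [set (\sum_(k <oo) (diam (U k) `^ d)%:E)%E
            | U in delta_cover delta A].

Definition hausdorff (d : R) A : \bar R :=
  ereal_sup [set hausdorff_delta d delta A | delta in [set e : R | 0 < e]].

End Hausdorff.

Section Gasket.
Variables (R : realType) (n N : nat) (p : 'I_N -> 'rV[R]_n).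
Implicit Types (V A : set 'rV[R]_n) (u g alpha : 'rV[R]_n -> R).

Definition simil (i : 'I_N) (x : 'rV[R]_n) : 'rV[R]_n :=
  2^-1 *: x + 2^-1 *: p i.

Definition gasket_op A : set 'rV[R]_n := \bigcup_(i in [set: 'I_N]) (simil i @` A).

Definition is_gasket V : Prop :=
  [/\ V !=set0, compact V & gasket_op V = V].

Definition boundary : set 'rV[R]_n := range p.

Definition gasket_dim : R := ln N%:R / ln 2.

(* mu is a Borel measure on R^n carried by V. *)
Definition is_gasket_measure V (mu : {measure set (borel R n) -> \bar R}) : Prop :=
  (exists c : R, forall A : set (borel R n), measurable A ->
     mu A = (c%:E * hausdorff gasket_dim (A `&` V))%E) /\
  mu V = 1%E.

Definition vertices (m : nat) : set 'rV[R]_n := iter m gasket_op boundary.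

Definition simil_word (w : seq 'I_N) (x : 'rV[R]_n) : 'rV[R]_n := foldr simil x w.

Definition neighbours (m : nat) (x y : 'rV[R]_n) : Prop :=
  [/\ vertices m x, vertices m y, x <> y &
      exists w : m.-tuple 'I_N,
        (simil_word w @` boundary) x /\ (simil_word w @` boundary) y].

(* The set of ordered pairs being summed over is finite. *)
Definition energy_at (m : nat) u : R :=
  ((N%:R + 2) / N%:R) ^+ m *
  \sum_(z \in [set z | neighbours m z.1 z.2]) (u z.1 - u z.2) ^+ 2.

Definition energy u : \bar R := limn (fun m => (energy_at m u)%:E).

Definition H01 V u : Prop :=
  [/\ {within V, continuous u},
      forall x, boundary x -> u x = 0 &
      (energy u < +oo)%E].

Definition norm_alpha V (mu : {measure set (borel R n) -> \bar R}) alpha u : R :=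
  Num.sqrt (fine (energy u) - \int[mu]_(x in V) (alpha x * `|u x| ^+ 2)).

Definition laplacian_at (m : nat) u (x : 'rV[R]_n) : R :=
  N%:R * (N%:R + 2) ^+ m * \sum_(y \in [set y | neighbours m y x]) (u y - u x).

(* vertices m is finite, so the supremum is a maximum (and is 0 for m = 0, where
   the index set is empty). *)
Definition is_laplacian V u g : Prop :=
  [/\ {within V, continuous u}, {within V, continuous g} &
      (fun m => sup [set `|laplacian_at m u x - g x|
                    | x in vertices m `\` boundary]) @ \oo --> (0 : R)].

Definition strong_solution V alpha (f : 'rV[R]_n -> R -> R) u : Prop :=
  H01 V u /\
  exists g, is_laplacian V u g /\
    forall x, (V `\` boundary) x -> g x + alpha x * u x = f x (u x).

End Gasket.

Definition nontrivial_on (R : realType) (n : nat) (V : set 'rV[R]_n)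
    (u : 'rV[R]_n -> R) : Prop := exists2 x, V x & u x <> 0.

(* The oriented integral of h from 0 to t. *)
Definition primitive0 (R : realType) (h : R -> R) (t : R) : R :=
  if 0 <= t then \int[@lebesgue_measure R]_(s in `[0, t]) h s
  else - \int[@lebesgue_measure R]_(s in `[t, 0]) h s.

(* Main.v *)
Require Import Defs.
From HB Require Import structures.
From mathcomp Require Import all_boot all_order all_algebra.
From mathcomp Require Import all_classical all_reals all_analysis.
From mathcomp Require Import measurable_realfun ring lra zify.

(** On functions vanishing on the boundary the problem is the Euler equation of the functional
    J u = 1/2 * (W u - int alpha u^2) + int F (x, u), whose quadratic part is the square of a norm since
    alpha <= 0.  The norm controls the sup norm with the constant N + 2 (sobolev), so on the ball of radius
    M0 / (2N + 3) only values of f with argument at most M0 matter; there the smallness of f makes J positive on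
    the sphere while J 0 = 0.  A minimum of J over the ball is a first solution.  Since F tends to - oo faster
    than quadratically (primitive_growth), J becomes negative far away, and a mountain pass over the sphere
    gives a second solution at a positive level.  Neither is trivial because f x 0 <> 0.

    The variational argument is carried out on the finite vertex sets of level m, where only calculus in finite
    dimension is needed: an interior minimum (constrained_min, first_discrete_solution) and a mountain pass
    (mountain_pass, second_discrete_solution).  The energies of the solutions are bounded uniformly in m.
    Functions of bounded energy are uniformly Hoelder continuous (osc_le), so along an ultrafilter the discrete
    solutions converge uniformly (limit_uniform) to continuous functions of finite energy.

    The equation survives in the pointwise sense because of one identity: the Laplacian at a vertex of level k
    is a convex combination of the Laplacians of level k + 1 at the same vertex and at the midpoints of the
    cells around it (laplacian_refine, laplacian_average).  Discrete Laplacians that are uniformly close to a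
    continuous function at level m therefore stay so at every coarser level (limit_laplacian).  The two limits
    differ because the value of J at a discrete solution is the average of F - f * u / 2, which is continuous
    under uniform convergence (limit_action).

    The measure enters twice.  Scaling of the Hausdorff measure shows that every cell of level m has mass
    N^-m (cell_measure_le, cell_mass_gt0); hence alpha <= 0 everywhere on V (ae_le0_le0), and the
    integral of a nonnegative continuous function is at most the limit of its averages over vertices
    (integral_le_avg), which is the direction needed to bound the norm of the first solution (limit_norm_alpha).

    The combinatorics rests on barycentric coordinates: scaled by 2^m, those of a vertex of level m are integers
    read off from its addresses (lam_simil_word).  They tell which addresses give the same point (vtx_eq), that
    an interior vertex has exactly two (count_interior), and that cells of one level that meet have a common
    vertex (cells_meet). *)

Import Order.TTheory GRing.Theory Num.Theory.
Import numFieldNormedType.Exports.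
Local Open Scope classical_set_scope.
Local Open Scope ring_scope.
Set Implicit Arguments.
Unset Strict Implicit.
Unset Printing Implicit Defensive.

(** * Words and their binary codes *)

Section Words.
Variable N : nat.

Fixpoint words (m : nat) : seq (seq 'I_N) :=
  if m is m'.+1 then [seq rcons w l | w <- words m', l <- enum 'I_N]
  else [:: [::]].

Lemma wordsP m (w : seq 'I_N) : (w \in words m) = (size w == m).
Proof.
elim: m w => [|m IH] w /=; first by rewrite inE; case: w.
apply/allpairsP/idP => [[[v l] /= [hv _ ->]]|].
  by rewrite size_rcons eqSS -IH.
case/lastP: w => // v l; rewrite size_rcons eqSS => hv.
by exists (v, l); rewrite /= IH hv mem_enum.
Qed.

Lemma uniq_words m : uniq (words m).
Proof.
elim: m => //= m IH; apply: allpairs_uniq => //; first exact: enum_uniq.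
by move=> [v l] [v' l'] _ _ /= /rcons_inj [-> ->].
Qed.

Lemma big_wordsS (R : zmodType) m (F : seq 'I_N -> R) :
  \sum_(w <- words m.+1) F w = \sum_(w <- words m) \sum_(l < N) F (rcons w l).
Proof.
rewrite /= big_allpairs_dep; apply: eq_bigr => w _.
by rewrite big_enum.
Qed.

(** The place values of the letter j in w, read in binary with the first letter of highest weight:
    the map of the cell w is x |-> 2 ^- size w *: (x + \sum_j code w j *: p j), see simil_wordE. *)
Definition code (w : seq 'I_N) (j : 'I_N) : nat :=
  foldl (fun a l => a.*2 + (l == j))%N 0%N w.

Lemma code_rcons w l j : code (rcons w l) j = ((code w j).*2 + (l == j))%N.
Proof. by rewrite /code foldl_rcons. Qed.

Lemma half_code (a b : nat) (e e' : bool) : (a.*2 + e = b.*2 + e')%N -> e = e' /\ a = b.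
Proof. by case: e; case: e' => /= h; split => //; lia. Qed.

Lemma code_inj w w' : size w = size w' -> code w =1 code w' -> w = w'.
Proof.
elim/last_ind: w w' => [|w l IH] w'; first by case: w'.
case/lastP: w' => [|w' l']; first by rewrite size_rcons.
rewrite !size_rcons => -[hs] h.
have e j : (l == j) = (l' == j) /\ code w j = code w' j.
  by have := h j; rewrite !code_rcons => /half_code.
have -> : l = l' by have [+ _] := e l; rewrite eqxx => /esym/eqP ->.
by rewrite (IH w') // => j; case: (e j).
Qed.

(** The two addresses (w, i) and (w', i') of equal length lead to the same point: both have the
    same integer barycentric coordinates after scaling (same_vertexP and vtx_eq). *)
Definition same_vertex (w w' : seq 'I_N) (i i' : 'I_N) : Prop :=
  forall j, (code w j + (i == j) = code w' j + (i' == j))%N.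

(** On the left every coordinate is even, and on the right the coordinate l' is even only if j' = l'. *)
Lemma same_vertex_diag (w w' : seq 'I_N) l l' j' :
  same_vertex (rcons w l) (rcons w' l') l j' ->
  l' = j' /\ same_vertex w w' l l'.
Proof.
rewrite /same_vertex => h.
have e : l' = j'.
  apply/eqP/negPn/negP => ne.
  have := h l'; rewrite !code_rcons eqxx eq_sym [j' == l']eq_sym (negbTE ne).
  by case: (l' == l) => /=; lia.
by split=> // j; subst j'; have := h j; rewrite !code_rcons; case: (l == j); case: (l' == j); lia.
Qed.

(** Exactly the coordinates l and j are odd on the left, so l' and j' are these two letters, and halving
    gives equal codes.  Hence a vertex created by a subdivision has two addresses at that level. *)
Lemma same_vertex_mid (w w' : seq 'I_N) l j l' j' : l != j ->
  size w = size w' ->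
  same_vertex (rcons w l) (rcons w' l') j j' ->
  w' = w /\ ((l' = l /\ j' = j) \/ (l' = j /\ j' = l)).
Proof.
move=> ne hs h.
(* at the coordinate l the left-hand side is odd *)
have ne' : l' != j'.
  apply/eqP => e; have := h l; rewrite !code_rcons e eqxx eq_sym (negbTE ne).
  by case: (j' == l); lia.
have e k : ((l == k) || (j == k)) = ((l' == k) || (j' == k)) /\ code w k = code w' k.
  have := h k; rewrite !code_rcons.
  have : ~~ ((l == k) && (j == k)).
    by apply/negP => /andP[/eqP a /eqP b]; rewrite a b eqxx in ne.
  have : ~~ ((l' == k) && (j' == k)).
    by apply/negP => /andP[/eqP a /eqP b]; rewrite a b eqxx in ne'.
  by case: (l == k); case: (j == k); case: (l' == k); case: (j' == k) => //= _ _; lia.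
split; first by apply/esym/code_inj => // k; case: (e k).
have [+ _] := e l; rewrite eqxx /= => /esym/orP a.
have [+ _] := e j; rewrite eqxx orbT /= => /esym/orP b.
case: a => /eqP a; case: b => /eqP b; subst => //; try by rewrite eqxx in ne.
- by left.
- by right.
Qed.

(** Two distinct corners determine their cell, so an edge has only one address: sums over
    neighbours can be computed on addresses without multiplicities. *)
Lemma same_vertex_cell (w w' : seq 'I_N) (i j i' j' : 'I_N) : size w = size w' ->
  i != j -> same_vertex w w' i i' -> same_vertex w w' j j' ->
  [/\ w = w', i = i' & j = j'].
Proof.
move=> hs ne h1 h2.
have ei : i = i'.
  apply/eqP/negPn/negP => ni.
  have := h1 i; have := h2 i; rewrite eqxx [i' == i]eq_sym [j == i]eq_sym (negbTE ne) (negbTE ni).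
  by case: (j' == i); lia.
have ew : w = w'.
  by apply: code_inj => // k; have := h1 k; rewrite ei; lia.
split => //; have := h2 j; rewrite ew eqxx.
by case: eqP => [->//|_]; lia.
Qed.

End Words.

(** * Vertices and barycentric coordinates *)

Section Points.
Variables (R : realType) (n N : nat) (p : 'I_N -> 'rV[R]_n).

Definition vtx (w : seq 'I_N) (i : 'I_N) : 'rV[R]_n := simil_word p w (p i).

Lemma simil_word_rcons w l x :
  simil_word p (rcons w l) x = simil_word p w (simil p l x).
Proof. by rewrite /simil_word foldr_rcons. Qed.

Lemma simil_word_cat w w' x :
  simil_word p (w ++ w') x = simil_word p w (simil_word p w' x).
Proof. by rewrite /simil_word foldr_cat. Qed.

Lemma simil_fix i : simil p i (p i) = p i.
Proof. by rewrite /simil -scalerDl (_ : 2^-1 + 2^-1 = 1) ?scale1r //; lra. Qed.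

Lemma simil_sym i j : simil p i (p j) = simil p j (p i).
Proof. by rewrite /simil addrC. Qed.

Lemma vtx_rcons_diag w i : vtx (rcons w i) i = vtx w i.
Proof. by rewrite /vtx simil_word_rcons simil_fix. Qed.

Lemma vtx_rcons_sym w i j : vtx (rcons w i) j = vtx (rcons w j) i.
Proof. by rewrite /vtx !simil_word_rcons simil_sym. Qed.

Lemma sum_delta k : \sum_(j < N) (k == j)%:R *: p j = p k.
Proof.
rewrite (bigD1 k) //= eqxx scale1r big1 ?addr0 // => j /negbTE.
by rewrite eq_sym => ->; rewrite scale0r.
Qed.

Lemma simil_wordE w x : simil_word p w x =
  2^-1 ^+ size w *: (x + \sum_(j < N) (code w j)%:R *: p j).
Proof.
elim/last_ind: w x => [|w l IH] x.
  by rewrite /= expr0 scale1r big1 ?addr0 // => j _; rewrite scale0r.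
rewrite simil_word_rcons IH size_rcons exprSr -scalerA; congr (_ *: _).
rewrite /simil [RHS]scalerDr -addrA; congr (_ + _).
under [in RHS]eq_bigr => j _ do rewrite code_rcons natrD -muln2 natrM scalerDl.
rewrite big_split /= scalerDr sum_delta addrC; congr (_ + _).
rewrite scaler_sumr; apply: eq_bigr => j _; rewrite scalerA; congr (_ *: _).
by field.
Qed.

Lemma same_vertexP w w' i i' : size w = size w' ->
  same_vertex w w' i i' -> vtx w i = vtx w' i'.
Proof.
move=> hs h; rewrite /vtx !simil_wordE hs; congr (_ *: _).
rewrite -[p i]sum_delta -[p i']sum_delta -!big_split; apply: eq_bigr => j _ /=.
by rewrite -!scalerDl -!natrD addnC h addnC.
Qed.

Definition centroid : 'rV[R]_n := N%:R^-1 *: \sum_(j < N) p j.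
Definition dotp (x y : 'rV[R]_n) : R := \sum_(k < n) x 0 k * y 0 k.
(** Barycentric coordinates with respect to the p j.  The simplex is regular with unit edges, so
    2 * (p j - centroid) is, up to a constant, the dual basis (dotp_centered). *)
Definition lam (j : 'I_N) (x : 'rV[R]_n) : R :=
  N%:R^-1 + 2 * dotp (x - centroid) (p j - centroid).

Lemma dotpC x y : dotp x y = dotp y x.
Proof. by apply: eq_bigr => k _; rewrite mulrC. Qed.
Lemma dotpDl x y z : dotp (x + y) z = dotp x z + dotp y z.
Proof. by rewrite -big_split; apply: eq_bigr => k _; rewrite mxE mulrDl. Qed.
Lemma dotpZl a x z : dotp (a *: x) z = a * dotp x z.
Proof. by rewrite mulr_sumr; apply: eq_bigr => k _; rewrite mxE mulrA. Qed.
Lemma dotpNl x z : dotp (- x) z = - dotp x z.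
Proof. by rewrite -scaleN1r dotpZl mulN1r. Qed.
Lemma dotpDr x y z : dotp x (y + z) = dotp x y + dotp x z.
Proof. by rewrite dotpC dotpDl !(dotpC x). Qed.
Lemma dotpZr a x z : dotp x (a *: z) = a * dotp x z.
Proof. by rewrite dotpC dotpZl dotpC. Qed.
Lemma dotpNr x z : dotp x (- z) = - dotp x z.
Proof. by rewrite dotpC dotpNl dotpC. Qed.
Lemma dotp_suml (I : Type) (r : seq I) (F : I -> 'rV[R]_n) z :
  dotp (\sum_(i <- r) F i) z = \sum_(i <- r) dotp (F i) z.
Proof.
elim: r => [|a r IH]; last by rewrite !big_cons dotpDl IH.
by rewrite !big_nil -(scale0r 0) dotpZl mul0r.
Qed.

Lemma enorm_sqr x : enorm x ^+ 2 = dotp x x.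
Proof.
rewrite /enorm sqr_sqrtr; first by apply: eq_bigr => k _; rewrite expr2.
by apply: sumr_ge0 => k _; exact: sqr_ge0.
Qed.

Hypothesis hN : (2 <= N)%N.
Hypothesis hp : forall i j : 'I_N, i <> j -> enorm (p i - p j) = 1.

Lemma dist_pp i j : dotp (p i - p j) (p i - p j) = (i != j)%:R.
Proof.
case: eqVneq => [->|/eqP/hp ne]; last by rewrite -enorm_sqr ne expr1n.
by rewrite subrr -(scale0r 0) dotpZl mul0r.
Qed.

Let N0 : N%:R != 0 :> R. Proof. by rewrite pnatr_eq0; lia. Qed.

Lemma dotp_centroidr x : dotp x centroid = N%:R^-1 * \sum_(j < N) dotp x (p j).
Proof.
by rewrite dotpC dotpZl dotp_suml; congr (_ * _); apply: eq_bigr => i _; rewrite dotpC.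
Qed.

Lemma dotp_centered i j :
  dotp (p i - centroid) (p j - centroid) = (i == j)%:R / 2 - (2 * N%:R)^-1.
Proof.
(* every inner product follows from the squared distances by polarization *)
have pol k l : dotp (p k) (p l) =
    (dotp (p k) (p k) + dotp (p l) (p l) - (k != l)%:R) / 2.
  have := dist_pp k l; rewrite dotpDl !dotpDr !dotpNr !dotpNl (dotpC (p l) (p k)).
  by move=> <-; field.
set S := \sum_(k < N) dotp (p k) (p k).
have cnt k : \sum_(l < N) (k != l)%:R = N%:R - 1 :> R.
  have -> : N%:R = \sum_(l < N) (1 : R) by rewrite sumr_const card_ord.
  rewrite (bigD1 k) //= eqxx add0r [in RHS](bigD1 k) //= addrAC subrr add0r.
  by apply: eq_bigr => l; rewrite eq_sym => ->.
have row k : \sum_(l < N) dotp (p k) (p l) =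
    (N%:R * dotp (p k) (p k) + S - (N%:R - 1)) / 2.
  under eq_bigr => l _ do rewrite pol.
  rewrite -mulr_suml !big_split /= sumrN cnt sumr_const card_ord -/S.
  by rewrite mulr_natl.
have cc : dotp centroid centroid = S / N%:R - (N%:R - 1) / (2 * N%:R).
  rewrite dotp_centroidr.
  have e k : dotp centroid (p k) = (dotp (p k) (p k) + S / N%:R - (N%:R - 1) / N%:R) / 2.
    by rewrite dotpC dotp_centroidr row; field.
  under eq_bigr => k _ do rewrite e.
  rewrite -mulr_suml !big_split /= sumrN !sumr_const card_ord -/S.
  by rewrite -[in X in _ + X - _]mulr_natl -[in X in _ - X]mulr_natl; field.
have cr k : dotp (p k) centroid = (dotp (p k) (p k) + S / N%:R - (N%:R - 1) / N%:R) / 2.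
  by rewrite dotp_centroidr row; field.
rewrite dotpDl !dotpDr !dotpNr !dotpNl (dotpC centroid) !cr cc (pol i j).
by case: (i == j) => /=; field.
Qed.

Lemma lam_p i j : lam j (p i) = (i == j)%:R.
Proof. by rewrite /lam dotp_centered; case: (i == j); field. Qed.

Lemma lam_affine j a b (x y : 'rV[R]_n) : a + b = 1 -> lam j (a *: x + b *: y) = a * lam j x + b * lam j y.
Proof.
move=> h; rewrite /lam.
have -> : a *: x + b *: y - centroid = a *: (x - centroid) + b *: (y - centroid).
  apply/rowP => k; rewrite !mxE (_ : b = 1 - a); last by rewrite -h; ring.
  by ring.
rewrite [dotp (a *: _ + _) _]dotpDl !dotpZl (_ : b = 1 - a); last by rewrite -h; ring.
by ring.
Qed.

Lemma lam_simil j l x : lam j (simil p l x) = (lam j x + (l == j)%:R) / 2.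
Proof. by rewrite /simil lam_affine ?lam_p; [field | field]. Qed.

Lemma sum_lam x : \sum_(j < N) lam j x = 1.
Proof.
rewrite /lam big_split /= sumr_const card_ord -[_ *+ N]mulr_natl mulfV //.
rewrite -mulr_sumr; under eq_bigr => j _ do rewrite dotpC.
rewrite -dotp_suml big_split /= sumrN sumr_const card_ord.
rewrite /centroid -[in X in _ - X]scaler_nat scalerA mulfV // scale1r subrr.
by rewrite -(scale0r 0) dotpZl mul0r mulr0 addr0.
Qed.

(** The integer part code w j and the remainder lam j x are what the address arithmetic sees of a point. *)
Lemma lam_simil_word j w x :
  lam j (simil_word p w x) = 2^-1 ^+ size w * ((code w j)%:R + lam j x).
Proof.
elim/last_ind: w x => [|w l IH] x; first by rewrite /= mul1r add0r.
rewrite simil_word_rcons IH size_rcons exprSr -mulrA; congr (_ * _).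
by rewrite lam_simil code_rcons natrD -muln2 natrM; field.
Qed.

Lemma vtx_eq w w' i i' : size w = size w' ->
  vtx w i = vtx w' i' -> same_vertex w w' i i'.
Proof.
move=> hs e j; have /(congr1 (lam j)) := e.
rewrite /vtx !lam_simil_word !lam_p hs -!natrD => /mulfI h.
by apply/eqP; rewrite -(eqr_nat R) h // expf_neq0 // invr_eq0 pnatr_eq0.
Qed.

End Points.

(** * Vertices and edges as families indexed by addresses *)

Section Vertices.
Variables (R : realType) (n N : nat) (p : 'I_N -> 'rV[R]_n).
Implicit Types (u v : 'rV[R]_n -> R) (x y : 'rV[R]_n).

Definition edge_form (m : nat) u v : R :=
  \sum_(w <- words N m) \sum_(i < N) \sum_(j < N)
    (u (vtx p w i) - u (vtx p w j)) * (v (vtx p w i) - v (vtx p w j)).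

Definition cell_lap u (w : seq 'I_N) (i : 'I_N) : R :=
  \sum_(j < N) (u (vtx p w j) - u (vtx p w i)).

(** The pairs (w, i) with vtx p w i = x are the addresses of x; a vertex shared by two cells has two. *)
Definition sum_at (m : nat) x (Phi : seq 'I_N -> 'I_N -> R) : R :=
  \sum_(w <- words N m) \sum_(i < N | vtx p w i == x) Phi w i.

Lemma verticesP m x :
  vertices p m x <-> exists w i, size w = m /\ x = vtx p w i.
Proof.
rewrite /vertices; elim: m x => [|m IH] x /=.
  split; first by case=> i _ <-; exists [::], i.
  by case=> w [i] [/size0nil -> ->]; exists i.
split.
  case=> l _ [y /IH [w [i [hw ->]]] <-]; exists (l :: w), i.
  by rewrite /= hw.
case=> -[|l w] [i] [] //= [hw] ->; exists l => //; exists (vtx p w i) => //.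
by apply/IH; exists w, i.
Qed.

Lemma vertices_vtx w i : vertices p (size w) (vtx p w i).
Proof. by apply/verticesP; exists w, i. Qed.

Lemma verticesS m x : vertices p m x -> vertices p m.+1 x.
Proof.
move=> /verticesP [w [i [hw ->]]]; apply/verticesP; exists (rcons w i), i.
by rewrite size_rcons hw vtx_rcons_diag.
Qed.

Lemma vertices_leq m k x : (k <= m)%N -> vertices p k x -> vertices p m x.
Proof.
by move/subnK <-; elim: (m - k)%N => // j IH /IH; exact: verticesS.
Qed.

Hypothesis hN : (2 <= N)%N.
Hypothesis hp : forall i j : 'I_N, i <> j -> enorm (p i - p j) = 1.

Lemma vtx_inj w : injective (vtx p w).
Proof.
move=> i j /(vtx_eq hN hp erefl)/(_ i); rewrite eqxx.
by case: eqP => // _; lia.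
Qed.

Lemma edge_inj w w' i j i' j' : size w = size w' -> i != j ->
  vtx p w i = vtx p w' i' -> vtx p w j = vtx p w' j' ->
  [/\ w = w', i = i' & j = j'].
Proof.
move=> hs ne h1 h2.
by apply: (same_vertex_cell hs ne); apply: (vtx_eq hN hp).
Qed.

Lemma neighboursP m x y : neighbours p m x y <->
  exists w i j, [/\ size w = m, i != j, x = vtx p w i & y = vtx p w j].
Proof.
split.
  case=> _ _ ne [w [[_ [i _ <-] hx] [_ [j _ <-] hy]]]; exists w, i, j.
  split; rewrite ?size_tuple //; apply/eqP => ij.
  by apply: ne; rewrite -hx -hy ij.
case=> w [i [j [hw ne -> ->]]]; split.
- by rewrite -hw; exact: vertices_vtx.
- by rewrite -hw; exact: vertices_vtx.
- by move/vtx_inj/eqP; rewrite (negbTE ne).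
- exists (tcast hw (in_tuple w)); rewrite val_tcast /=.
  by split; [exists (p i) | exists (p j)] => //; [exists i | exists j].
Qed.

Definition ord_pairs : seq ('I_N * 'I_N) :=
  [seq z <- enum (('I_N * 'I_N)%type : finType) | z.1 != z.2].
Definition edges (m : nat) : seq ('rV[R]_n * 'rV[R]_n) :=
  [seq (vtx p w z.1, vtx p w z.2) | w <- words N m, z <- ord_pairs].

Lemma uniq_edges m : uniq (edges m).
Proof.
apply: allpairs_uniq; first exact: uniq_words.
  by apply: filter_uniq; exact: enum_uniq.
move=> _ _ /allpairsP [[w [i j]] /= [hw + ->]] /allpairsP [[w' [i' j']] /= [hw' _ ->]] /=.
rewrite mem_filter /= => /andP [ne _] [h1 h2].
have hs : size w = size w'.
  by move: hw hw'; rewrite !wordsP => /eqP -> /eqP ->.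
by have [-> -> ->] := edge_inj hs ne h1 h2.
Qed.

Lemma mem_edges m z : z \in edges m <-> neighbours p m z.1 z.2.
Proof.
case: z => x y; split.
  move=> /allpairsP [[w [i j]] /= [hw + [-> ->]]].
  rewrite mem_filter => /andP[/= ne _]; apply/neighboursP; exists w, i, j; split => //.
  by move: hw; rewrite wordsP => /eqP.
case/neighboursP => w [i [j [hw ne /= -> ->]]].
apply/allpairsP; exists (w, (i, j)); split => //=; first by rewrite wordsP hw.
by rewrite mem_filter /= ne mem_enum.
Qed.

(** Diagonal terms contribute 0, so the pairs of distinct corners may be replaced by all pairs. *)
Lemma sum_edges m (Q : pred ('rV[R]_n * 'rV[R]_n)) (F : 'rV[R]_n * 'rV[R]_n -> R) :
  (forall x, F (x, x) = 0) ->
  \sum_(z <- edges m | Q z) F z =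
  \sum_(w <- words N m) \sum_(j < N) \sum_(i < N | Q (vtx p w i, vtx p w j))
     F (vtx p w i, vtx p w j).
Proof.
move=> F0; rewrite big_mkcond big_allpairs_dep; apply: eq_bigr => w _.
rewrite big_filter big_enum_cond /= big_mkcond /=.
under [RHS]eq_bigr => j _ do rewrite big_mkcond.
rewrite exchange_big pair_bigA /=; apply: eq_bigr => -[i j] _ /=.
by case: eqVneq => //= ->; rewrite F0 if_same.
Qed.

(** The finitely supported sum over pairs of neighbours becomes a sum over cells, because each edge
    lies in one cell (edge_inj). *)
Lemma energy_atE m u :
  energy_at p m u = ((N%:R + 2) / N%:R) ^+ m * edge_form m u u.
Proof.
rewrite /energy_at; congr (_ * _).
have -> : [set z : 'rV[R]_n * 'rV[R]_n | neighbours p m z.1 z.2] = [set` edges m].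
  by apply/seteqP; split => z /mem_edges.
rewrite -fsbig_seq ?uniq_edges // sum_edges => [|x]; last by rewrite /= subrr expr0n.
apply: eq_bigr => w _; rewrite exchange_big /=; apply: eq_bigr => i _.
by apply: eq_bigr => j _; rewrite expr2.
Qed.

Lemma laplacian_atE m u x :
  laplacian_at p m u x = N%:R * (N%:R + 2) ^+ m * sum_at m x (cell_lap u).
Proof.
rewrite /laplacian_at; congr (_ * _).
pose r := [seq z.1 | z <- edges m & z.2 == x].
have -> : [set y | neighbours p m y x] = [set` r].
  apply/seteqP; split => y /=.
    by move=> /(mem_edges m (y, x)) h; apply/mapP; exists (y, x); rewrite ?mem_filter //= eqxx h.
  by case/mapP => -[a b]; rewrite mem_filter /= => /andP [/eqP -> /mem_edges h] ->.
have ur : uniq r.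
  rewrite map_inj_in_uniq ?filter_uniq ?uniq_edges // => -[a b] [a' b'].
  by rewrite !mem_filter /= => /andP[/eqP -> _] /andP[/eqP -> _] ->.
rewrite -fsbig_seq // big_map big_filter.
rewrite (eq_bigr (fun z => u z.1 - u z.2)); last by move=> z /eqP ->.
rewrite sum_edges; last by move=> y /=; rewrite subrr.
apply: eq_bigr => w _ /=.
rewrite [RHS]big_mkcond; apply: eq_bigr => j _ /=.
by case: eqP => _ //; rewrite big_pred0_eq.
Qed.

End Vertices.

(** * The algebra of one cell *)

Section Cell.
Variables (R : realType) (N : nat).
Hypothesis hN : (2 <= N)%N.
Implicit Types (x y h : 'I_N -> R) (b : 'I_N -> 'I_N -> R).

Definition cform x y : R := \sum_(i < N) \sum_(j < N) (x i - x j) * (y i - y j).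

Lemma sum_ord_const (c : R) : \sum_(i < N) c = N%:R * c.
Proof. by rewrite sumr_const card_ord mulr_natl. Qed.

Lemma cformE x y :
  cform x y = 2 * (N%:R * \sum_(i < N) x i * y i - (\sum_(i < N) x i) * \sum_(i < N) y i).
Proof.
have e i : \sum_(j < N) (x i - x j) * (y i - y j) =
    N%:R * (x i * y i) - x i * \sum_(j < N) y j - y i * \sum_(j < N) x j
    + \sum_(j < N) x j * y j.
  rewrite -sum_ord_const.
  rewrite !mulr_sumr -!sumrN -!big_split /=.
  by apply: eq_bigr => j _; ring.
rewrite /cform (eq_bigr _ (fun i _ => e i)) !big_split /= !sumrN -!mulr_suml -mulr_sumr.
by rewrite sum_ord_const; ring.
Qed.

(** Summation by parts in one cell. *)
Lemma cform_lap x y : cform x y = - 2 * \sum_(i < N) x i * \sum_(j < N) (y j - y i).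
Proof.
rewrite cformE; have e i : x i * \sum_(j < N) (y j - y i) =
    x i * \sum_(j < N) y j - N%:R * (x i * y i).
  by rewrite big_split /= sum_ord_const; ring.
by rewrite (eq_bigr _ (fun i _ => e i)) big_split /= sumrN -mulr_sumr -mulr_suml; ring.
Qed.

Lemma cform_ge0 x : 0 <= cform x x.
Proof.
by apply: sumr_ge0 => i _; apply: sumr_ge0 => j _; rewrite -expr2 sqr_ge0.
Qed.

(** The harmonic extension of the corner values h to the subdivided cell: hext h l i is its value at the
    corner i of the subcell l, that is h l if i = l, and (h i + h l + \sum_k h k) / (N + 2) at the
    midpoint of the corners i and l. *)
Definition hext h (l i : 'I_N) : R :=
  (h i + h l + \sum_(k < N) h k + (l == i)%:R * (N%:R * h l - \sum_(k < N) h k))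
  / (N%:R + 2).

Lemma hext_sym h l i : hext h l i = hext h i l.
Proof. by rewrite /hext eq_sym; case: eqP => [->//|_]; rewrite !mul0r (addrC (h i)). Qed.

Lemma N2_neq0 : N%:R + 2 != 0 :> R.
Proof. by rewrite -natrD pnatr_eq0; lia. Qed.
Lemma N_neq0 : N%:R != 0 :> R.
Proof. by rewrite pnatr_eq0; lia. Qed.

Lemma hext_diag h l : hext h l l = h l.
Proof. by have := N2_neq0; rewrite /hext eqxx /= => ?; field. Qed.

Lemma sum_hext h l : \sum_(i < N) hext h l i =
  N%:R * (2 * h l + \sum_(k < N) h k) / (N%:R + 2).
Proof.
have := N2_neq0; rewrite /hext -mulr_suml => ?; congr (_ / _).
rewrite !big_split /= !sum_ord_const -mulr_suml.
have -> : \sum_(i < N) (l == i)%:R = 1 :> R.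
  by rewrite (bigD1 l) //= eqxx big1 ?addr0 // => i /negbTE; rewrite eq_sym => ->.
by ring.
Qed.

(** The harmonic extension is orthogonal, in the energy of the subdivided cell, to all functions that
    vanish at the old corners, so b enters only through its values there.  The ratio N / (N + 2) is the
    reason for the renormalization in the energy. *)
Lemma cform_hext h b : (forall l i, b l i = b i l) ->
  \sum_(l < N) cform (hext h l) (b l) =
  N%:R / (N%:R + 2) * cform h (fun i => b i i).
Proof.
move=> bs; have N2 := N2_neq0.
have e l : cform (hext h l) (b l) = 2 * N%:R / (N%:R + 2) *
    \sum_(i < N) ((h i - h l) * b l i
       + (l == i)%:R * ((N%:R * h l - \sum_(k < N) h k) * b l i)).
  rewrite cformE sum_hext [X in 2 * (X - _)]mulr_sumr.
  rewrite [X in 2 * (_ - X)]mulr_sumr -sumrB !mulr_sumr; apply: eq_bigr => i _.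
  by rewrite /hext; field.
rewrite (eq_bigr _ (fun l _ => e l)) -mulr_sumr.
under eq_bigr => l _ do rewrite big_split /=.
rewrite big_split /=.
have -> : \sum_(l < N) \sum_(i < N) (h i - h l) * b l i = 0.
  have e1 : \sum_(l < N) \sum_(i < N) (h i - h l) * b l i =
      - \sum_(l < N) \sum_(i < N) (h i - h l) * b l i.
    rewrite {1}exchange_big -sumrN; apply: eq_bigr => l _ /=.
    by rewrite -sumrN; apply: eq_bigr => i _; rewrite bs -mulNr opprB.
  by lra.
rewrite cformE add0r.
have -> : \sum_(l < N) \sum_(i < N) (l == i)%:R * ((N%:R * h l - \sum_(k < N) h k) * b l i)
   = N%:R * (\sum_(i < N) h i * b i i) - (\sum_(i < N) h i) * (\sum_(i < N) b i i).
  rewrite !mulr_sumr -sumrB; apply: eq_bigr => l _.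
  rewrite [LHS](bigD1 l) //= eqxx [X in _ + X]big1 ?addr0 /=; first by ring.
  by move=> i /negbTE; rewrite eq_sym => ->; rewrite mul0r.
by field.
Qed.

(** By orthogonality the harmonic extension has the least energy among the functions with given
    corner values. *)
Lemma cform_refine b : (forall l i, b l i = b i l) ->
  N%:R / (N%:R + 2) * cform (fun i => b i i) (fun i => b i i)
  <= \sum_(l < N) cform (b l) (b l).
Proof.
move=> bs; pose h i := b i i; set c := N%:R / (N%:R + 2).
have h1 := cform_hext h bs.
have h2 : \sum_(l < N) cform (hext h l) (hext h l) = c * cform h h.
  rewrite (@cform_hext h (hext h)); last by move=> *; exact: hext_sym.
  by congr (_ * cform _ _); apply/funext => i; rewrite hext_diag.
have : 0 <= \sum_(l < N) cform (fun i => b l i - hext h l i) (fun i => b l i - hext h l i).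
  by apply: sumr_ge0 => l _; exact: cform_ge0.
have e l : cform (fun i => b l i - hext h l i) (fun i => b l i - hext h l i) =
    cform (b l) (b l) - 2 * cform (hext h l) (b l) + cform (hext h l) (hext h l).
  rewrite /cform mulr_sumr -sumrN -!big_split; apply: eq_bigr => i _ /=.
  rewrite mulr_sumr -sumrN -!big_split; apply: eq_bigr => j _ /=.
  by ring.
rewrite (eq_bigr _ (fun l _ => e l)) !big_split /= sumrN -mulr_sumr h1 h2 -/c /h.
by lra.
Qed.

(** This is cform_hext with both energies summed by parts: the Laplacian of the coarse cell is a
    combination of those of the subcells, with the values of a harmonic function as weights. *)
Lemma lap_hext h b : (forall l i, b l i = b i l) ->
  \sum_(i < N) h i * \sum_(j < N) (b j j - b i i) =
  (N%:R + 2) / N%:R * \sum_(l < N) \sum_(j < N) hext h l j * \sum_(k < N) (b l k - b l j).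
Proof.
move=> bs; have := cform_hext h bs; rewrite cform_lap.
under eq_bigr => l _ do rewrite cform_lap.
rewrite -mulr_sumr; have := N2_neq0; have := N_neq0.
set A := (X in _ * X = _); set B := (X in _ = _ * (_ * X)) => N0 N2 e.
have {}e : A = N%:R / (N%:R + 2) * B by lra.
by rewrite -/A -/B e; field; rewrite N0 N2.
Qed.

Lemma hext_ge0 h l i : (forall k, 0 <= h k) -> 0 <= hext h l i.
Proof.
move=> h0; have N0 : 0 < N%:R + 2 :> R by rewrite ltr_wpDl.
have H0 : 0 <= \sum_(k < N) h k by apply: sumr_ge0.
case: (eqVneq l i) => [->|ne]; first by rewrite hext_diag.
rewrite /hext (negbTE ne) mul0r addr0 divr_ge0 ?(ltW N0) //.
by rewrite !addr_ge0.
Qed.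

Lemma hext_le1 h l i : (forall k, h k <= 1) -> hext h l i <= 1.
Proof.
move=> h1; have N0 : 0 < N%:R + 2 :> R by rewrite ltr_wpDl.
have H1 : \sum_(k < N) h k <= N%:R.
  by rewrite -[X in X%:R]card_ord -sumr_const; apply: ler_sum.
case: (eqVneq l i) => [->|ne]; first by rewrite hext_diag.
rewrite /hext (negbTE ne) mul0r addr0 ler_pdivrMr // mul1r.
by have := h1 i; have := h1 l; lra.
Qed.

End Cell.

(** * Refinement of energies and Laplacians *)

Section Refinement.
Variables (R : realType) (n N : nat) (p : 'I_N -> 'rV[R]_n).
Implicit Types (u v : 'rV[R]_n -> R) (x y : 'rV[R]_n).
Hypothesis hN : (2 <= N)%N.
Hypothesis hp : forall i j : 'I_N, i <> j -> enorm (p i - p j) = 1.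

Lemma edge_formE m u v :
  edge_form p m u v =
  \sum_(w <- words N m) cform (fun i => u (vtx p w i)) (fun i => v (vtx p w i)).
Proof. by []. Qed.

Lemma edge_form_lap m u v :
  edge_form p m u v = - 2 * \sum_(w <- words N m) \sum_(i < N) u (vtx p w i) * cell_lap p v w i.
Proof.
rewrite edge_formE mulr_sumr; apply: eq_bigr => w _; rewrite cform_lap //.
Qed.

Let N0 : N%:R != 0 :> R. Proof. exact: N_neq0. Qed.
Let N2 : N%:R + 2 != 0 :> R. Proof. exact: N2_neq0. Qed.

Lemma energy_at_ge0 m u : 0 <= energy_at p m u.
Proof.
rewrite energy_atE //; apply: mulr_ge0; first by apply: exprn_ge0; apply: divr_ge0; rewrite ?addr_ge0.
by rewrite edge_formE; apply: sumr_ge0 => w _; exact: cform_ge0.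
Qed.

Lemma energy_atS m u : energy_at p m u <= energy_at p m.+1 u.
Proof.
rewrite !energy_atE // exprSr -mulrA ler_wpM2l //.
have c0 : 0 < N%:R / (N%:R + 2) :> R.
  by rewrite divr_gt0 ?ltr_wpDl // ltr0n; lia.
rewrite -(ler_pM2l c0) mulrA (_ : _ / _ * (_ / _) = 1) ?mul1r; last by field; rewrite N0 N2.
rewrite !edge_formE big_wordsS mulr_sumr; apply: ler_sum => w _.
have := @cform_refine R N hN (fun l i => u (vtx p (rcons w l) i)).
by move=> /(_ (fun l i => congr1 u (vtx_rcons_sym _ _ _ _))); under eq_fun do rewrite vtx_rcons_diag.
Qed.

Lemma energy_at_leq k m u : (k <= m)%N -> energy_at p k u <= energy_at p m u.
Proof.
by move/subnK <-; elim: (m - k)%N => // d IH; apply: le_trans IH _; exact: energy_atS.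
Qed.

Lemma vtx_mid (w w' : seq 'I_N) l j l' j' : l != j -> size w = size w' ->
  vtx p (rcons w l) j = vtx p (rcons w' l') j' ->
  w' = w /\ ((l' = l /\ j' = j) \/ (l' = j /\ j' = l)).
Proof.
move=> ne hs e; apply: same_vertex_mid => //.
by apply: (vtx_eq hN hp) e; rewrite !size_rcons hs.
Qed.

(** A midpoint has the two addresses (rcons w l, j) and (rcons w j, l) and no other (vtx_mid). *)
Lemma sum_at_mid m (w : seq 'I_N) l j (Phi : seq 'I_N -> 'I_N -> R) :
  l != j -> size w = m ->
  sum_at p m.+1 (vtx p (rcons w l) j) Phi = Phi (rcons w l) j + Phi (rcons w j) l.
Proof.
move=> ne hw; rewrite /sum_at big_wordsS.
rewrite (bigD1_seq w) ?uniq_words ?wordsP ?hw //= [X in _ + X]big_seq_cond [X in _ + X]big1 ?addr0.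
  rewrite (bigD1 l) //= [X in _ + X = _](bigD1 j) /=; last by rewrite eq_sym.
  rewrite [X in _ + (_ + X)]big1 ?addr0; last first.
    move=> k /andP[kl kj]; apply: big_pred0 => i; apply/eqP => /esym e.
    have [_ [[e1 _]|[e1 _]]] := vtx_mid ne erefl e.
      by rewrite e1 eqxx in kl.
    by rewrite e1 eqxx in kj.
  congr (_ + _).
    rewrite (big_pred1 j) // => i /=; apply/eqP/eqP => [|->//].
    exact: (vtx_inj hN hp).
  rewrite vtx_rcons_sym (big_pred1 l) // => i /=; apply/eqP/eqP => [|->//].
  exact: (vtx_inj hN hp).
move=> w' /andP[]; rewrite wordsP => /eqP hw' ne'.
apply: big1 => l' _; apply: big_pred0 => i; apply/eqP => /esym e.
have hs : size w = size w' by rewrite hw hw'.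
have [e1 _] := vtx_mid ne hs e.
by rewrite e1 eqxx in ne'.
Qed.

(** The addresses of an old vertex at the next level repeat the letter of its corner. *)
Lemma sum_at_old m (w : seq 'I_N) i (Phi : seq 'I_N -> 'I_N -> R) :
  size w = m ->
  sum_at p m.+1 (vtx p w i) Phi = sum_at p m (vtx p w i) (fun w' i' => Phi (rcons w' i') i').
Proof.
move=> hw; rewrite /sum_at big_wordsS.
rewrite big_seq [RHS]big_seq; apply: eq_bigr => w' ; rewrite wordsP => /eqP hw'.
rewrite [RHS]big_mkcond; apply: eq_bigr => l _.
rewrite -(vtx_rcons_diag p w i).
have hs : size (rcons w i) = size (rcons w' l) by rewrite !size_rcons hw hw'.
case: eqP => [e|ne].
  rewrite (big_pred1 l) // => j /=; apply/eqP/eqP => [|->].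
    by move=> /esym /(vtx_eq hN hp hs)/same_vertex_diag [].
  by rewrite vtx_rcons_diag.
apply: big_pred0 => j; apply/eqP => e; apply: ne; move: (e) => /esym /(vtx_eq hN hp hs)/same_vertex_diag [e1 _].
by rewrite -e -e1 vtx_rcons_diag.
Qed.

Lemma boundaryE m i : p i = vtx p (nseq m i) i.
Proof.
elim: m => // m IH; rewrite {1}IH -(vtx_rcons_diag p) -cats1 -(nseqD m 1) addn1 //.
Qed.

Lemma mid_not_boundary (w : seq 'I_N) l j : l != j -> ~ boundary p (vtx p (rcons w l) j).
Proof.
move=> ne [i _]; rewrite (boundaryE (size w).+1 i) -[(size w).+1]addn1 nseqD cats1 => /esym e.
have [|_ ee] := vtx_mid ne _ e; first by rewrite size_nseq.
by move: ne; case: ee => -[<- <-]; rewrite eqxx.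
Qed.

(** Induction down to the level at which the vertex is created as a midpoint: subdivision does not
    change the number of its addresses. *)
Lemma count_interior m x : vertices p m x -> ~ boundary p x -> sum_at p m x (fun _ _ => 1) = 2.
Proof.
move=> /verticesP [w [i [hw ->]]]; elim: m w i hw => [|m IH] w i hw hb.
  by exfalso; apply: hb; exists i => //; rewrite (size0nil hw).
case/lastP: w hw hb => // w l; rewrite size_rcons => -[hw] hb.
case: (eqVneq l i) hb => [->|ne] hb; last by rewrite sum_at_mid.
by rewrite vtx_rcons_diag sum_at_old // IH //; move: hb; rewrite vtx_rcons_diag.
Qed.

Definition indic (i k : 'I_N) : R := (i == k)%:R.

Lemma cell_lap_refine u (w : seq 'I_N) i :
  cell_lap p u w i = (N%:R + 2) / N%:R *
   \sum_(l < N) \sum_(j < N) hext (indic i) l j * cell_lap p u (rcons w l) j.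
Proof.
have := @lap_hext R N hN (indic i) (fun l i => u (vtx p (rcons w l) i)).
move=> /(_ (fun l i => congr1 u (vtx_rcons_sym _ _ _ _))) <-.
rewrite (bigD1 i) //= /indic eqxx mul1r [X in _ + X]big1 ?addr0.
  by apply: eq_bigr => j _; rewrite !vtx_rcons_diag.
by move=> k /negbTE; rewrite eq_sym => ->; rewrite mul0r.
Qed.

Lemma sum_indic i : \sum_(k < N) indic i k = 1.
Proof.
rewrite (bigD1 i) //= /indic eqxx big1 ?addr0 // => k /negbTE.
by rewrite eq_sym => ->.
Qed.

Lemma sum_hext_off i : \sum_(l < N) \sum_(j < N | l != j) hext (indic i) l j = N%:R - 1.
Proof.
have e : \sum_(l < N) \sum_(j < N) hext (indic i) l j = N%:R.
  under eq_bigr => l _ do rewrite sum_hext // sum_indic.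
  rewrite -mulr_suml -mulr_sumr big_split /= -mulr_sumr sum_indic sum_ord_const.
  by field.
rewrite -{}e -[X in _ - X](sum_indic i) -sumrB; apply: eq_bigr => l _.
rewrite [in RHS](bigD1 l) //= hext_diag // addrAC subrr add0r.
by apply: eq_bigl => j; rewrite eq_sym.
Qed.

(** Apply lap_hext to the indicator of the corner x in each cell around x.  At a midpoint the
    two subcells have the same weight by symmetry, and together they form its whole Laplacian: this is the
    origin of the factor 2^-1. *)
Lemma laplacian_refine m u x : vertices p m x ->
  laplacian_at p m u x = N%:R^-1 * (laplacian_at p m.+1 u x +
    2^-1 * sum_at p m x (fun w i => \sum_(l < N) \sum_(j < N | l != j)
       hext (indic i) l j * laplacian_at p m.+1 u (vtx p (rcons w l) j))).
Proof.
move=> /[dup] hx /verticesP [w0 [i0 [hw0 x0]]].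
rewrite !(laplacian_atE hN hp) {2}x0 sum_at_old // -x0 /=.
have -> : sum_at p m x (cell_lap p u) = (N%:R + 2) / N%:R *
  (sum_at p m x (fun w i => cell_lap p u (rcons w i) i) +
   2^-1 * sum_at p m x (fun w i => \sum_(l < N) \sum_(j < N | l != j)
       hext (indic i) l j * sum_at p m.+1 (vtx p (rcons w l) j) (cell_lap p u))).
  rewrite /sum_at mulrDr !mulr_sumr -big_split /= -/(sum_at _ _ _).
  rewrite big_seq [RHS]big_seq; apply: eq_bigr => w; rewrite wordsP => /eqP hw.
  rewrite !mulr_sumr -big_split /=; apply: eq_bigr => i _.
  rewrite cell_lap_refine -mulrDr; congr (_ * _).
  pose T := \sum_(l < N) \sum_(j < N | l != j) hext (indic i) l j * cell_lap p u (rcons w l) j.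
  have eT : T = \sum_(l < N) \sum_(j < N | l != j) hext (indic i) l j * cell_lap p u (rcons w j) l.
    rewrite /T; under eq_bigr => l _ do rewrite big_mkcond.
    rewrite exchange_big; apply: eq_bigr => j _; rewrite [RHS]big_mkcond; apply: eq_bigr => l _.
    by rewrite eq_sym hext_sym.
  have -> : \sum_(l < N) \sum_(j < N) hext (indic i) l j * cell_lap p u (rcons w l) j =
      cell_lap p u (rcons w i) i + T.
    have -> : cell_lap p u (rcons w i) i = \sum_(l < N) indic i l * cell_lap p u (rcons w l) l.
      rewrite (bigD1 i) //= /indic eqxx mul1r big1 ?addr0 // => k /negbTE.
      by rewrite eq_sym => ->; rewrite mul0r.
    rewrite -big_split; apply: eq_bigr => l _ /=.
    rewrite [LHS](bigD1 l) //= hext_diag //; congr (_ + _).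
    by apply: eq_bigl => j; rewrite eq_sym.
  congr (_ + _).
  rewrite (_ : \sum_(l < N) _ = T + T); first by field.
  rewrite {2}eT -big_split; apply: eq_bigr => l _ /=.
  rewrite -big_split; apply: eq_bigr => j ne /=.
  by rewrite [X in _ * X = _](sum_at_mid _ ne hw) mulrDr.
have -> : sum_at p m x (fun w i => \sum_(l < N) \sum_(j < N | l != j) hext (indic i) l j *
      laplacian_at p m.+1 u (vtx p (rcons w l) j)) =
  N%:R * (N%:R + 2) ^+ m.+1 * sum_at p m x (fun w i => \sum_(l < N) \sum_(j < N | l != j)
       hext (indic i) l j * sum_at p m.+1 (vtx p (rcons w l) j) (cell_lap p u)).
  rewrite /sum_at mulr_sumr; apply: eq_bigr => w _.
  rewrite mulr_sumr; apply: eq_bigr => i _.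
  rewrite mulr_sumr; apply: eq_bigr => l _.
  rewrite mulr_sumr; apply: eq_bigr => j _.
  by rewrite (laplacian_atE hN hp) /sum_at; ring.
by rewrite exprS; field.
Qed.

Lemma simil_wordB (w : seq 'I_N) x y :
  simil_word p w x - simil_word p w y = 2^-1 ^+ size w *: (x - y).
Proof. by rewrite !simil_wordE -scalerBr opprD addrACA subrr addr0. Qed.

Lemma norm_le_enorm x : `|x| <= enorm x.
Proof.
rewrite [leLHS]/Num.norm /= mx_normrE; apply/bigmax_leP; split; first exact: sqrtr_ge0.
move=> [i j] _ /=; rewrite -sqrtr_sqr /enorm ler_sqrt; last first.
  by apply: sumr_ge0 => k _; exact: sqr_ge0.
rewrite (bigD1 j) //= [i]ord1 lerDl.
by apply: sumr_ge0 => k _; exact: sqr_ge0.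
Qed.

Lemma norm_pp i j : `|p i - p j| <= 1.
Proof.
case: (eqVneq i j) => [->|/eqP/hp ne]; first by rewrite subrr normr0.
by apply: le_trans (norm_le_enorm _) _; rewrite ne.
Qed.

Lemma norm_vtx_rcons (w : seq 'I_N) i l j :
  `|vtx p (rcons w l) j - vtx p w i| <= 2^-1 ^+ size w.
Proof.
rewrite /vtx simil_word_rcons simil_wordB normrZ normrX ger0_norm //.
rewrite -[leRHS]mulr1 ler_wpM2l // /simil.
have -> : 2^-1 *: p j + 2^-1 *: p l - p i = 2^-1 *: (p j - p i) + 2^-1 *: (p l - p i).
  by apply/rowP => k; rewrite !mxE; field.
apply: le_trans (ler_normD _ _) _; rewrite !normrZ !ger0_norm //.
by have := norm_pp j i; have := norm_pp l i; lra.
Qed.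

(** The weights in laplacian_refine are nonnegative and sum to 1, so the coarse Laplacian is a
    convex combination of fine ones at points within 2^-1 ^+ k. *)
Lemma laplacian_coarsen k u x (c B : R) : vertices p k x -> ~ boundary p x ->
  (forall z, vertices p k.+1 z -> ~ boundary p z -> `|z - x| <= 2^-1 ^+ k ->
     `|laplacian_at p k.+1 u z - c| <= B) ->
  `|laplacian_at p k u x - c| <= B.
Proof.
move=> hx hb h; rewrite laplacian_refine //.
set A := laplacian_at p k.+1 u x.
pose T (g : 'I_N -> 'I_N -> seq 'I_N -> R) := sum_at p k x (fun w i =>
  \sum_(l < N) \sum_(j < N | l != j) hext (indic i) l j * g l j w).
set S := sum_at p k x _.
have T1 : T (fun _ _ _ => 1) = 2 * (N%:R - 1).
  rewrite -(count_interior hx hb) mulrC /T /sum_at mulr_sumr; apply: eq_bigr => w _.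
  rewrite mulr_sumr; apply: eq_bigr => i _; rewrite mulr1 -(sum_hext_off i).
  by apply: eq_bigr => l _; apply: eq_bigr => j _; rewrite mulr1.
have eS : S - c * (2 * (N%:R - 1)) =
    T (fun l j w => laplacian_at p k.+1 u (vtx p (rcons w l) j) - c).
  rewrite -T1 /T /S /sum_at mulr_sumr -sumrB; apply: eq_bigr => w _.
  rewrite mulr_sumr -sumrB; apply: eq_bigr => i _.
  rewrite mulr_sumr -sumrB; apply: eq_bigr => l _.
  rewrite mulr_sumr -sumrB; apply: eq_bigr => j _.
  by ring.
have bS : `|S - c * (2 * (N%:R - 1))| <= B * (2 * (N%:R - 1)).
  rewrite eS -T1 /T /sum_at mulr_sumr.
  apply: le_trans (ler_norm_sum _ _ _) _; rewrite big_seq [leRHS]big_seq.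
  apply: ler_sum => w; rewrite wordsP => /eqP hw.
  rewrite mulr_sumr; apply: le_trans (ler_norm_sum _ _ _) _; apply: ler_sum => i /eqP xi.
  rewrite mulr_sumr; apply: le_trans (ler_norm_sum _ _ _) _; apply: ler_sum => l _.
  rewrite mulr_sumr; apply: le_trans (ler_norm_sum _ _ _) _; apply: ler_sum => j ne.
  rewrite mulr1 normrM ger0_norm; last by apply: hext_ge0 => // q; rewrite /indic.
  rewrite [leRHS]mulrC ler_wpM2l //; first by apply: hext_ge0 => // q; rewrite /indic.
  apply: h; first by rewrite -hw -(size_rcons w l); exact: vertices_vtx.
    exact: mid_not_boundary.
  by rewrite -xi -hw; exact: norm_vtx_rcons.
have bA : `|A - c| <= B.
  by apply: h => //; [exact: verticesS | rewrite subrr normr0].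
have -> : N%:R^-1 * (A + 2^-1 * S) - c = N%:R^-1 * ((A - c) + 2^-1 * (S - c * (2 * (N%:R - 1)))).
  by field.
have N0p : 0 < N%:R :> R by rewrite ltr0n; lia.
rewrite normrM ger0_norm ?invr_ge0 ?ler0n // mulrC ler_pdivrMr //.
apply: le_trans (ler_normD _ _) _; rewrite normrM ger0_norm //.
by lra.
Qed.

(** Iterate laplacian_coarsen; the distances sum to at most 2 * 2^-1 ^+ k.  An estimate of the
    Laplacian at a fine level thus descends to every coarser level without loss, which is what lets a limit
    of discrete solutions have a pointwise Laplacian. *)
Lemma laplacian_average k m u x (c B : R) : (k <= m)%N ->
  vertices p k x -> ~ boundary p x ->
  (forall z, vertices p m z -> ~ boundary p z -> `|z - x| <= 2 * 2^-1 ^+ k ->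
     `|laplacian_at p m u z - c| <= B) ->
  `|laplacian_at p k u x - c| <= B.
Proof.
move/subnK; move: (m - k)%N => d <-; elim: d k x => [|d IH] k x hx hb h.
  by apply: h => //; rewrite subrr normr0 mulr_ge0 // exprn_ge0.
apply: laplacian_coarsen => // z hz hzb dz; apply: IH => // z' hz' hzb' dz'.
move: hz' h; rewrite -addSnnS => hz' h; apply: h => //.
rewrite (_ : z' - x = (z' - z) + (z - x)); last by rewrite addrA subrK.
apply: le_trans (ler_normD _ _) _; move: dz'; rewrite exprS mulrA divff // mul1r.
by lra.
Qed.

End Refinement.

(** * Oscillation of functions of finite energy *)

Section Oscillation.
Variables (R : realType) (n N : nat) (p : 'I_N -> 'rV[R]_n).
Implicit Types (u v : 'rV[R]_n -> R) (x y : 'rV[R]_n).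
Hypothesis hN : (2 <= N)%N.
Hypothesis hp : forall i j : 'I_N, i <> j -> enorm (p i - p j) = 1.

Let N0 : N%:R != 0 :> R. Proof. exact: N_neq0. Qed.
Let N2 : N%:R + 2 != 0 :> R. Proof. exact: N2_neq0. Qed.
Let Np : 0 < N%:R :> R. Proof. by rewrite ltr0n; lia. Qed.

(** By the renormalization of the energy, oscillations over cells decrease at least by this factor
    from one level to the next. *)
Definition holder_ratio : R := Num.sqrt (N%:R / (N%:R + 2)).

Lemma holder_ratio_sqr : holder_ratio ^+ 2 = N%:R / (N%:R + 2).
Proof. by rewrite sqr_sqrtr // divr_ge0 // ltW // ltr_wpDr. Qed.

Lemma holder_ratio_ge0 : 0 <= holder_ratio.
Proof. exact: sqrtr_ge0. Qed.

Lemma holder_ratio_lt1 : holder_ratio < 1.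
Proof.
rewrite -(@ltr_pXn2r _ 2) ?nnegrE ?holder_ratio_ge0 // holder_ratio_sqr expr1n.
by rewrite ltr_pdivrMr ?ltr_wpDr // mul1r; lra.
Qed.

(** The geometric series of ratio holder_ratio is at most N + 2. *)
Lemma holder_ratio_gap : 1 <= (N%:R + 2) * (1 - holder_ratio).
Proof.
have := holder_ratio_sqr; have := holder_ratio_ge0; have := holder_ratio_lt1.
set r := holder_ratio => r1 r0 e.
have {}e : r ^+ 2 * (N%:R + 2) = N%:R by rewrite e divfK.
have : (N%:R + 2) * (1 - r) * (1 + r) = 2 by rewrite -mulrA; nra.
have : 0 <= (N%:R + 2) * (1 - r) by rewrite mulr_ge0 // ?subr_ge0 ltW // ltr_wpDr.
by nra.
Qed.

(** A single edge contributes to the energy of its level, which is at most that of level m. *)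
Lemma step_le m (w : seq 'I_N) v i j : (size w <= m)%N ->
  `|v (vtx p w i) - v (vtx p w j)| <= Num.sqrt (energy_at p m v) * holder_ratio ^+ size w.
Proof.
move=> hw; set k := size w.
have h1 : (v (vtx p w i) - v (vtx p w j)) ^+ 2 <= edge_form p k v v.
  rewrite edge_formE (bigD1_seq w) ?uniq_words ?wordsP //=.
  rewrite ler_wpDr //; first by apply: sumr_ge0 => w' _; exact: cform_ge0.
  rewrite /cform (bigD1 i) //= ler_wpDr //.
    by apply: sumr_ge0 => a _; apply: sumr_ge0 => b _; rewrite -expr2 sqr_ge0.
  rewrite (bigD1 j) //= -expr2 ler_wpDr //.
  by apply: sumr_ge0 => a _; rewrite -expr2 sqr_ge0.
have h2 : edge_form p k v v = (holder_ratio ^+ k) ^+ 2 * energy_at p k v.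
  rewrite energy_atE // mulrA exprAC holder_ratio_sqr -exprMn.
  by rewrite (_ : _ / _ * (_ / _) = 1) ?expr1n ?mul1r //; field; rewrite N0 N2.
rewrite -(@ler_pXn2r _ 2) ?nnegrE ?mulr_ge0 ?sqrtr_ge0 ?exprn_ge0 ?holder_ratio_ge0 //.
rewrite exprMn sqr_sqrtr ?energy_at_ge0 // mulrC real_normK ?num_real //.
apply: le_trans h1 _; rewrite h2 ler_wpM2l ?sqr_ge0 //; exact: energy_at_leq.
Qed.

(** Join the two points through corners of the cells between w and w ++ w'; each step is bounded by
    step_le and the steps form a geometric series. *)
Lemma osc_le m (w w' : seq 'I_N) v i j : (size w + size w' = m)%N ->
  `|v (vtx p (w ++ w') i) - v (vtx p w j)| <=
    (N%:R + 2) * Num.sqrt (energy_at p m v) * holder_ratio ^+ size w.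
Proof.
have S0 : 0 <= Num.sqrt (energy_at p m v) by exact: sqrtr_ge0.
set S := Num.sqrt _ in S0 *.
elim: w' w j => [|l w' IH] w j hm; have wm : (size w <= m)%N by rewrite -hm leq_addr.
  rewrite cats0; apply: le_trans (step_le v i j wm) _.
  rewrite -/S -mulrA ler_peMl ?mulr_ge0 ?exprn_ge0 ?holder_ratio_ge0 //.
  by rewrite -natrD ler1n; lia.
rewrite -cat_rcons.
have h1 := IH (rcons w l) l; rewrite size_rcons vtx_rcons_diag in h1.
have {}h1 := h1 (etrans (addSnnS _ _) hm).
have h2 := step_le v l j wm.
rewrite -(subrK (v (vtx p w l)) (v (vtx p (rcons w l ++ w') i))) -addrA.
apply: le_trans (ler_normD _ _) _; apply: le_trans (lerD h1 h2) _.
rewrite -/S exprS; have := holder_ratio_gap.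
have : 0 <= S * holder_ratio ^+ size w by rewrite mulr_ge0 // exprn_ge0 // holder_ratio_ge0.
set q := holder_ratio ^+ size w; set r := holder_ratio => a b.
have -> : (N%:R + 2) * S * (r * q) + S * q = (S * q) * ((N%:R + 2) * r + 1) by ring.
have -> : (N%:R + 2) * S * q = (S * q) * (N%:R + 2) by ring.
by rewrite ler_wpM2l //; lra.
Qed.

(** This is osc_le from a boundary corner, at which v vanishes. *)
Lemma sobolev m v x : (forall i, v (p i) = 0) -> vertices p m x ->
  `|v x| <= (N%:R + 2) * Num.sqrt (energy_at p m v).
Proof.
move=> v0 /verticesP [w [i [hw ->]]].
have := @osc_le m [::] w v i i; rewrite /= expr0 mulr1 => /(_ hw).
by rewrite v0 subr0.
Qed.

End Oscillation.

(** * Averages and a test function of bounded energy *)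

Section TestFunction.
Variables (R : realType) (n N : nat) (p : 'I_N -> 'rV[R]_n).
Hypothesis hN : (2 <= N)%N.
Hypothesis hp : forall i j : 'I_N, i <> j -> enorm (p i - p j) = 1.

Definition avg (m : nat) (h : 'rV[R]_n -> R) : R :=
  N%:R^-1 ^+ m.+1 * \sum_(w <- words N m) \sum_(i < N) h (vtx p w i).

(** Values at the corners of the cell w of the function that is 0 on the boundary, 1 at the vertices
    of level 1 created by the first subdivision, and harmonic from level 1 on. *)
Definition corner_vals (w : seq 'I_N) : 'I_N -> R :=
  if w is l :: w' then foldl (@hext R N) (fun i => (i != l)%:R) w' else fun=> 0.

Lemma corner_vals_rcons (w : seq 'I_N) l : w != [::] ->
  corner_vals (rcons w l) = hext (corner_vals w) l.
Proof. by case: w => // a w _; rewrite rcons_cons /= foldl_rcons. Qed.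

(** Two addresses of one vertex arise from each other by the symmetry of the harmonic extension,
    so the corner values define a function of the point. *)
Lemma corner_vals_vtx (w w' : seq 'I_N) i i' : size w = size w' ->
  vtx p w i = vtx p w' i' -> corner_vals w i = corner_vals w' i'.
Proof.
elim/last_ind: w w' i i' => [|w l IH] w' i i'; first by case: w'.
case/lastP: w' => [|w' l']; rewrite !size_rcons // => -[hs] e.
case: (eqVneq l i) e => [->|ne] e.
  have hs' : size (rcons w i) = size (rcons w' l') by rewrite !size_rcons hs.
  have [ee] := same_vertex_diag (vtx_eq hN hp hs' e); subst i' => /(same_vertexP p hs) e'.
  case: (eqVneq w [::]) => [w0|w0].
    by move: hs; rewrite w0 => /esym/size0nil -> /=; rewrite !eqxx.
  have w0' : w' != [::] by rewrite -size_eq0 -hs size_eq0.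
  by rewrite !corner_vals_rcons // !hext_diag //; exact: IH.
have [-> ee] := vtx_mid hN hp ne hs e.
case: (eqVneq w [::]) => [->|w0] /=; first by case: ee => -[-> ->] //; rewrite eq_sym.
by rewrite !corner_vals_rcons //; case: ee => -[-> ->] //; rewrite hext_sym.
Qed.

Lemma corner_vals_bnd (w : seq 'I_N) i : 0 <= corner_vals w i <= 1.
Proof.
elim/last_ind: w i => [|w l IH] i; first by rewrite /= lexx ler01.
case: (eqVneq w [::]) => [->|w0] /=; first by case: (_ != _); rewrite /= lexx ler01.
rewrite corner_vals_rcons // hext_ge0 ?hext_le1 // => k; by case/andP: (IH k).
Qed.

Lemma sum_neq (l : 'I_N) : \sum_(i < N) (i != l)%:R = N%:R - 1 :> R.
Proof.
rewrite (bigD1 l) //= eqxx add0r (eq_bigr (fun=> 1)); last by move=> i ->.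
have := sum_ord_const N (1 : R); rewrite (bigD1 l) //= => h.
by rewrite -[N%:R]mulr1 -h addrAC subrr add0r.
Qed.

Lemma sum_corner_vals m : \sum_(w <- words N m.+1) \sum_(i < N) corner_vals w i =
  N%:R ^+ m.+1 * (N%:R - 1).
Proof.
have N2 := N2_neq0 R hN.
elim: m => [|m IH].
  rewrite big_wordsS big_seq1 /= (eq_bigr (fun=> N%:R - 1)); first by rewrite sum_ord_const expr1.
  by move=> l _; exact: sum_neq.
rewrite big_wordsS exprS -mulrA -IH mulr_sumr big_seq [RHS]big_seq; apply: eq_bigr => w.
rewrite wordsP => hw.
have w0 : w != [::] by rewrite -size_eq0 (eqP hw).
under eq_bigr => l _ do rewrite corner_vals_rcons // sum_hext //.
rewrite -mulr_suml -mulr_sumr big_split /= -mulr_sumr sum_ord_const.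
by field.
Qed.

Definition testf (i0 : 'I_N) (m : nat) (x : 'rV[R]_n) : R :=
  let a := xget ([::], i0) [set a | size a.1 = m /\ vtx p a.1 a.2 = x] in
  corner_vals a.1 a.2.

Variable i0 : 'I_N.

Lemma testf_vtx (w : seq 'I_N) i : testf i0 (size w) (vtx p w i) = corner_vals w i.
Proof.
rewrite /testf; case: xgetP => [[w' i'] _ [/= hw e]|/(_ (w, i)) []//].
exact: corner_vals_vtx.
Qed.

Lemma testf_bnd m x : 0 <= testf i0 m x <= 1.
Proof. exact: corner_vals_bnd. Qed.

Lemma testf_boundary m i : testf i0 m (p i) = 0.
Proof.
rewrite (boundaryE p m i) -{1}(size_nseq m i) testf_vtx.
elim: m => // m IH; rewrite -addn1 nseqD cats1.
case: (eqVneq (nseq m i) [::]) => [->|h] /=; first by rewrite eqxx.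
by rewrite corner_vals_rcons // hext_diag.
Qed.

Lemma testf_avg m : avg m.+1 (testf i0 m.+1) = (N%:R - 1) / N%:R.
Proof.
have N0 := N_neq0 R hN.
rewrite /avg (_ : \sum_(w <- _) _ = N%:R ^+ m.+1 * (N%:R - 1)).
  by rewrite exprSr exprVn; field; rewrite N0 expf_neq0.
rewrite -sum_corner_vals big_seq [RHS]big_seq; apply: eq_bigr => w.
by rewrite wordsP => /eqP <-; apply: eq_bigr => i _; rewrite testf_vtx.
Qed.

(** Harmonic extension does not change the energy, so it is that of level 1. *)
Lemma testf_energy m : energy_at p m.+1 (testf i0 m.+1) = 2 * (N%:R + 2) * (N%:R - 1).
Proof.
have N0 := N_neq0 R hN; have N2 := N2_neq0 R hN.
rewrite energy_atE // (_ : edge_form _ _ _ _ =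
  \sum_(w <- words N m.+1) cform (corner_vals w) (corner_vals w)); last first.
  rewrite edge_formE big_seq [RHS]big_seq; apply: eq_bigr => w.
  by rewrite wordsP => /eqP <-; under eq_fun do rewrite testf_vtx.
elim: m => [|m IH].
  rewrite big_wordsS big_seq1 /= (eq_bigr (fun=> 2 * (N%:R - 1))).
    by rewrite sum_ord_const expr1; field.
  move=> l _; rewrite cformE.
  have -> : \sum_(i < N) (i != l)%:R * (i != l)%:R = \sum_(i < N) (i != l)%:R :> R.
    by apply: eq_bigr => i _; case: (_ != _); rewrite ?mul1r ?mul0r.
  by rewrite sum_neq; ring.
rewrite exprSr -mulrA -[RHS]IH; congr (_ * _).
rewrite [in LHS]big_wordsS mulr_sumr big_seq [RHS]big_seq; apply: eq_bigr => w.
rewrite wordsP => hw.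
have w0 : w != [::] by rewrite -size_eq0 (eqP hw).
under eq_bigr => l _ do rewrite corner_vals_rcons //.
rewrite (@cform_hext R N hN (corner_vals w) (hext (corner_vals w))); last by move=> *; exact: hext_sym.
under [X in cform _ X]eq_fun do rewrite hext_diag //.
by field; rewrite N0 N2.
Qed.

End TestFunction.

(** * A mountain pass theorem in finite dimension *)

Lemma cvg_big_sum (R : realType) {T : Type} {F : set_system T} {FF : Filter F} (I : Type) (r : seq I)
    (P : pred I) (f : I -> T -> R) (l : I -> R) :
  (forall i, P i -> f i @ F --> l i) ->
  (fun t => \sum_(i <- r | P i) f i t) @ F --> \sum_(i <- r | P i) l i.
Proof.
move=> h; elim: r => [|i r IH].
  rewrite big_nil; under eq_fun do rewrite big_nil; exact: cvg_cst.
rewrite big_cons; under eq_fun do rewrite big_cons.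
by case: ifP => // Pi; apply: cvgD => //; exact: h.
Qed.

Section Continuity.
Variables (R : realType) (T : topologicalType) (t : T).
Implicit Types f g : T -> R.

Lemma cont_cst (U : topologicalType) (a : U) : continuous_at t (fun _ : T => a).
Proof. exact: cvg_cst. Qed.

Lemma cont_mul f g : continuous_at t f -> continuous_at t g ->
  continuous_at t (fun s => f s * g s).
Proof. by move=> cf cg; exact: (@cvgM R T (nbhs t) _ f g _ _ cf cg). Qed.

Lemma cont_add f g : continuous_at t f -> continuous_at t g ->
  continuous_at t (fun s => f s + g s).
Proof. by move=> cf cg; exact: (@cvgD R R T (nbhs t) _ f g _ _ cf cg). Qed.

Lemma cont_opp f : continuous_at t f -> continuous_at t (fun s => - f s).
Proof. by move=> cf; exact: (@cvgN R R T (nbhs t) _ f _ cf). Qed.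

Lemma cont_sub f g : continuous_at t f -> continuous_at t g ->
  continuous_at t (fun s => f s - g s).
Proof. by move=> cf cg; apply: cont_add cf (cont_opp cg). Qed.

Lemma cont_norm f : continuous_at t f -> continuous_at t (fun s => `|f s|).
Proof. by move=> cf; exact: (@cvg_norm R R T (nbhs t) _ f _ cf). Qed.

Lemma cont_addV (V : normedModType R) (f g : T -> V) :
  continuous_at t f -> continuous_at t g -> continuous_at t (fun s => f s + g s).
Proof. by move=> cf cg; exact: (@cvgD R V T (nbhs t) _ f g _ _ cf cg). Qed.

Lemma cont_oppV (V : normedModType R) (f : T -> V) :
  continuous_at t f -> continuous_at t (fun s => - f s).
Proof. by move=> cf; exact: (@cvgN R V T (nbhs t) _ f _ cf). Qed.

Lemma cont_scale (V : normedModType R) f (g : T -> V) :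
  continuous_at t f -> continuous_at t g -> continuous_at t (fun s => f s *: g s).
Proof. by move=> cf cg; exact: (@cvgZ R V T (nbhs t) _ f g _ _ cf cg). Qed.

Lemma cont_sum (I : Type) (r : seq I) (P : pred I) (f : I -> T -> R) :
  (forall i, P i -> continuous_at t (f i)) ->
  continuous_at t (fun s => \sum_(i <- r | P i) f i s).
Proof.
by move=> h; exact: (@cvg_big_sum _ _ (nbhs t) _ _ r P f (fun i => f i t) h).
Qed.

Lemma cont_comp (U V : topologicalType) (f : T -> U) (h : U -> V) :
  continuous h -> continuous_at t f -> continuous_at t (fun s => h (f s)).
Proof. by move=> ch cf; apply: continuous_comp cf _; exact: ch. Qed.

End Continuity.

Lemma mean_value (R : realType) (phi dphi : R -> R) (a b : R) : a <= b ->
  (forall u : R, is_derive u 1 phi (dphi u)) ->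
  exists2 u, a <= u <= b & phi b - phi a = dphi u * (b - a).
Proof.
move=> ab d.
have c : {within `[a, b], continuous phi}.
  by apply: derivable_within_continuous => u _; have := d u.
by have [u uI e] := MVT_segment ab (fun u _ => d u) c; exists u.
Qed.

Section MountainPass.
Variables (R : realType) (k : nat).
Implicit Types (x y h : 'rV[R]_k).

Lemma cvg_cont {T : Type} {V U : topologicalType} {F : set_system T} {FF : Filter F}
    (f : T -> V) (h : V -> U) (a : V) :
  continuous h -> f @ F --> a -> (fun t => h (f t)) @ F --> h a.
Proof. by move=> ch hf; apply: continuous_cvg hf; exact: ch. Qed.

Lemma cvg_dotp {T : Type} {F : set_system T} {FF : Filter F} (f g : T -> 'rV[R]_k) a b :
  f @ F --> a -> g @ F --> b -> (fun t => dotp (f t) (g t)) @ F --> dotp a b.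
Proof.
move=> hf hg; apply: cvg_big_sum => i _; apply: cvgM.
  exact: (cvg_cont (@coord_continuous _ _ _ 0 i) hf).
exact: (cvg_cont (@coord_continuous _ _ _ 0 i) hg).
Qed.

Lemma continuous_dotp (T : topologicalType) (f g : T -> 'rV[R]_k) (t : T) :
  continuous_at t f -> continuous_at t g ->
  continuous_at t (fun t => dotp (f t) (g t)).
Proof. by move=> cf cg; exact: (@cvg_dotp T (nbhs t) _ f g _ _ cf cg). Qed.

Lemma dotp_ge0 x : 0 <= dotp x x.
Proof. by apply: sumr_ge0 => i _; rewrite -expr2 sqr_ge0. Qed.

Lemma dotp_eq0 x : (dotp x x == 0) = (x == 0).
Proof.
apply/eqP/eqP => [/eqP|->]; last by rewrite -(scale0r 0) dotpZl mul0r.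
rewrite psumr_eq0 => [/allP h|i _]; last by rewrite -expr2 sqr_ge0.
apply/rowP => i; have := h i; rewrite mem_index_enum => /(_ isT) /=.
by rewrite mulf_eq0 orbb mxE => /eqP.
Qed.

Lemma coord_sqr_le x i : x 0 i ^+ 2 <= dotp x x.
Proof.
rewrite /dotp (bigD1 i) //= -expr2 lerDl.
by apply: sumr_ge0 => j _; rewrite -expr2 sqr_ge0.
Qed.

Lemma compact_sublevel K (Q : set 'rV[R]_k) : closed Q ->
  compact ([set x | dotp x x <= K] `&` Q).
Proof.
move=> clQ; apply: bounded_closed_compact; last first.
  apply: closedI => //; apply: (@closed_comp _ _ (fun x => dotp x x) [set r | r <= K]).
    by move=> x _; apply: (@continuous_dotp _ id id); exact: cvg_id.
  exact: closed_le.
exists (Num.sqrt K); split; first exact: num_real.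
move=> M KM x [/= xK _].
rewrite [leLHS]/Num.norm /= mx_normrE; apply/bigmax_leP; split.
  by apply: le_trans (ltW KM); exact: sqrtr_ge0.
move=> [i j] _ /=; rewrite [i]ord1; apply: le_trans (ltW KM).
rewrite -sqrtr_sqr ler_sqrt; last by apply: le_trans xK; exact: dotp_ge0.
by apply: le_trans xK; exact: coord_sqr_le.
Qed.

Variables (J : 'rV[R]_k -> R) (G : 'rV[R]_k -> 'rV[R]_k).
Hypothesis cJ : continuous J.
Hypothesis cG : continuous G.
Hypothesis dJ : forall x h (t : R),
  is_derive t 1 (fun s : R => J (x + s *: h)) (dotp (G (x + t *: h)) h).

(** Near each point of the compact set Z the slope of J along its own gradient is bounded below on a
    step of positive length; compactness makes both uniform. *)
Lemma uniform_descent (Z : set 'rV[R]_k) : compact Z -> (forall x, Z x -> G x != 0) ->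
  exists2 s : R, 0 < s & forall x (t : R), Z x -> 0 <= t <= s -> J (x - t *: G x) <= J x - t * s.
Proof.
move=> cZ G0.
pose P (s : R) x := forall t : R, 0 <= t <= s -> s <= dotp (G (x - t *: G x)) (G x).
have : \forall s \near (0 : R)^'+, Z `<=` P s.
  apply: (iffLR (compact_near_coveringP Z) cZ) => x Zx.
  set c := dotp (G x) (G x).
  have c0 : 0 < c by rewrite lt_neqAle eq_sym dotp_eq0 G0 //= dotp_ge0.
  have ch : (fun z : 'rV[R]_k * R => dotp (G (z.1 - z.2 *: G z.1)) (G z.1)) @ (x, 0 : R) --> c.
    have c1 : (fun z : 'rV[R]_k * R => G z.1) @ (x, 0 : R) --> G x.
      by apply: (cvg_cont cG); exact: cvg_fst.
    apply: (cvg_dotp (f := fun z : 'rV[R]_k * R => G (z.1 - z.2 *: G z.1))) (c1).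
    apply: (cvg_cont (f := fun z : 'rV[R]_k * R => z.1 - z.2 *: G z.1) cG).
    rewrite -[in X in _ --> X](subr0 x) -(scale0r (G x)).
    apply: cvgB; first exact: cvg_fst.
    by apply: cvgZ; [exact: cvg_snd | exact: c1].
  have : \forall z \near ((x, 0 : R) : 'rV[R]_k * R), c / 2 < dotp (G (z.1 - z.2 *: G z.1)) (G z.1).
    by apply: (cvgr_gt c ch); lra.
  move=> [[U1 U2] /= [h1 [e /= e0 h2]] sub].
  near=> y s => /= t /andP[t0 ts].
  have s0 : 0 < s by near: s; exact: nbhs_right_gt.
  apply: le_trans (_ : c / 2 <= _).
    by near: s; apply: nbhs_right_le; lra.
  apply: ltW; apply: (sub (y, t)); split => /=; first by near: y.
  apply: h2; rewrite /= sub0r normrN ger0_norm //; apply: le_lt_trans ts _.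
  by near: s; exact: nbhs_right_lt.
move=> h.
have : \forall s \near (0 : R)^'+, 0 < s /\ Z `<=` P s.
  by near=> s; split; near: s => //; exact: nbhs_right_gt.
move=> /filter_ex [s [s0 hs]]; exists s => // x t Zx /andP[t0 ts].
pose phi u := J (x - u *: G x).
have dphi (u : R) : is_derive u 1 phi (- dotp (G (x - u *: G x)) (G x)).
  have := dJ x (- G x) u; rewrite dotpNr !scalerN.
  by rewrite (_ : (fun s0 : R => _) = phi) //; apply/funext => a; rewrite /phi scalerN.
have [u /andP[u0 ut]] := mean_value t0 dphi.
rewrite {1 2}/phi scale0r !subr0 => e.
have := hs x Zx u; rewrite u0 (le_trans ut ts) => /(_ isT) => hh.
have : t * s <= t * dotp (G (x - u *: G x)) (G x) by rewrite ler_wpM2l.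
by lra.
Unshelve. all: by end_near. Qed.

(** Cutting a path at its first arrival at the sphere keeps it inside the ball. *)
Lemma first_exit (K : R) (gam : R -> 'rV[R]_k) : 0 < K -> continuous gam -> gam 0 = 0 ->
  K <= dotp (gam 1) (gam 1) ->
  exists t1 : R, [/\ 0 <= t1 <= 1, dotp (gam t1) (gam t1) = K &
    forall t : R, 0 <= t <= t1 -> dotp (gam t) (gam t) <= K].
Proof.
move=> K0 cg g0 g1; pose d t := dotp (gam t) (gam t).
have cd : continuous d by move=> t; apply: (@continuous_dotp _ gam gam); exact: cg.
pose A : set R := `[0, 1 : R]%classic `&` [set t | K <= d t].
have cA : compact A.
  apply: (subclosed_compact _ (@segment_compact R 0 1)); last by move=> t [].
  apply: closedI; first exact: itv_closed.
  apply: (@closed_comp _ _ d [set r | K <= r]); first by move=> x _; exact: cd.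
  exact: closed_ge.
have A0 : A !=set0 by exists 1; split => //=; rewrite in_itv /= lexx ler01.
have cid0 : {within A, continuous (id : R -> R)}.
  by apply: continuous_subspaceT => t; exact: cvg_id.
have [c cinA cmin] := compact_EVT_min A0 cA cid0.
move: cinA; rewrite inE => -[/=]; rewrite in_itv /= => /andP[c0 c1] Kc.
have below t : 0 <= t -> t < c -> d t < K.
  move=> t0 tc; rewrite ltNge; apply/negP => Kt.
  have : t \in A by rewrite inE; split => //=; rewrite in_itv /= t0 (le_trans (ltW tc)).
  by move/cmin; rewrite leNgt tc.
have d0 : d 0 = 0 by rewrite /d g0; apply/eqP; rewrite dotp_eq0.
have cd0 : {within `[0, c], continuous d} by apply: continuous_subspaceT.
have Kd : Num.min (d 0) (d c) <= K <= Num.max (d 0) (d c).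
  by rewrite d0 ge_min le_max (ltW K0) Kc /= orbT.
have [u] := IVT c0 cd0 Kd.
rewrite in_itv /= => /andP[u0 uc] du.
have {}uc : u = c.
  apply/eqP; rewrite eq_le uc /= leNgt; apply/negP => /(below _ u0).
  by rewrite du ltxx.
exists c; split; [by rewrite c0 c1 | by rewrite -uc | move=> t /andP[t0]].
rewrite le_eqVlt => /orP[/eqP ->|tc]; first by rewrite -/(d c) -uc du.
exact: ltW (below _ t0 tc).
Qed.

Variables (K c0 c1 : R).
Hypotheses (K0 : 0 < K) (c00 : 0 < c0) (J0 : J 0 <= 0).
Hypothesis ridge : forall gam : R -> 'rV[R]_k, continuous gam -> gam 0 = 0 ->
  K <= dotp (gam 1) (gam 1) -> exists2 t : R, 0 <= t <= 1 & c0 <= J (gam t).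
Hypothesis over : exists2 e, K <= dotp e e & forall t : R, 0 <= t <= 1 -> J (t *: e) <= c1.
Hypothesis outer : forall x, dotp x x = K -> c0 / 2 <= J x <= c1 -> dotp (G x) x <= 0.

(** If G had no zero in the compact set Z of points of the ball with c0 / 2 <= J <= c1, then the
    gradient step x |-> x - (s * chi x) *: G x, switched off by chi where J <= c0 / 2, would lower the
    maximum of J along every path from 0 to the sphere by the fixed amount s * s.  By the hypothesis outer
    the end point does not move back into the ball, so the new path can be cut at the sphere again and the
    step repeated, until the maximum falls below c0, against ridge. *)
Lemma mountain_pass : exists2 x, c0 / 2 <= J x <= c1 & G x = 0.
Proof.
have c0p : 0 < c0 := c00; have J0' : J 0 <= 0 := J0.
pose Z := [set x | dotp x x <= K] `&` [set x | c0 / 2 <= J x <= c1].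
apply: contrapT => noc.
have GZ x : Z x -> G x != 0.
  by move=> [_ /= hx]; apply/eqP => Gx; apply: noc; exists x.
have cZ : compact Z.
  apply: compact_sublevel.
  rewrite (_ : [set x | _] = [set x | c0 / 2 <= J x] `&` [set x | J x <= c1]); last first.
    by apply/seteqP; split => x /=; [move=> /andP[] | move=> [-> ->]].
  apply: closedI.
    by apply: (@closed_comp _ _ J [set r | _ <= r]); [move=> x _; exact: cJ | exact: closed_ge].
  by apply: (@closed_comp _ _ J [set r | r <= _]); [move=> x _; exact: cJ | exact: closed_le].
have [s s0 hs] := uniform_descent cZ GZ.
(* chi truncates to the interval from 0 to 1 the affine function of J that is 0 at c0 / 2 and 1 at 3 / 4 * c0 *)
pose y x : R := (J x - c0 / 2) * (4 / c0).
pose chi x : R := (`|y x| - `|y x - 1| + 1) / 2.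
have chi01 x : 0 <= chi x <= 1.
  by rewrite /chi; case: (ger0P (y x)); case: (ger0P (y x - 1)) => *; apply/andP; split; lra.
have chi0 x : J x <= c0 / 2 -> chi x = 0.
  move=> h; have : y x <= 0 by apply: mulr_le0_ge0; [rewrite subr_le0 | rewrite divr_ge0 // ltW].
  by move=> h1; rewrite /chi ler0_norm // ler0_norm; lra.
have chi1 x : 3 / 4 * c0 <= J x -> chi x = 1.
  move=> h; have : 1 <= y x by rewrite /y mulrA ler_pdivlMr //; lra.
  by move=> h1; rewrite /chi ger0_norm ?ger0_norm; lra.
have cchi : continuous chi.
  have cy : continuous y.
    by move=> x; apply: cont_mul; [apply: cont_sub; [exact: cJ | exact: cont_cst] | exact: cont_cst].
  move=> x; apply: cont_mul; last exact: cont_cst.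
  apply: cont_add; last exact: cont_cst.
  apply: cont_sub; apply: cont_norm; first exact: cy.
  by apply: cont_sub; [exact: cy | exact: cont_cst].
pose T x := x - (s * chi x) *: G x.
have cT : continuous T.
  move=> x; apply: cont_addV; first exact: cvg_id.
  apply: cont_oppV; apply: cont_scale; last exact: cG.
  by apply: cont_mul; [exact: cont_cst | exact: cchi].
have schi x : 0 <= s * chi x <= s.
  have /andP[a b] := chi01 x.
  by rewrite mulr_ge0 ?(ltW s0) //= ger_pMr.
have descent x a : dotp x x <= K -> J x <= a -> a <= c1 ->
    J (T x) <= Num.max (3 / 4 * c0) (a - s * s).
  move=> xK xa ac; rewrite le_max /T.
  case: (leP (J x) (c0 / 2)) => [h|h].
    by rewrite chi0 // mulr0 scale0r subr0; apply/orP; left; lra.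
  have Zx : Z x by split=> //=; rewrite (ltW h) (le_trans xa ac).
  have h1 := hs x _ Zx (schi x).
  case: (leP (3 / 4 * c0) (J x)) => [/chi1 e|h2].
    by apply/orP; right; apply: le_trans h1 _; rewrite e mulr1; lra.
  have /andP[sx _] := schi x.
  have : 0 <= s * chi x * s by apply: mulr_ge0 sx (ltW s0).
  by move=> ?; apply/orP; left; lra.
pose Q a := exists gam : R -> 'rV[R]_k, [/\ continuous gam, gam 0 = 0,
  dotp (gam 1) (gam 1) = K & forall t : R, 0 <= t <= 1 -> dotp (gam t) (gam t) <= K /\ J (gam t) <= a].
have trunc a (gam : R -> 'rV[R]_k) : continuous gam -> gam 0 = 0 -> K <= dotp (gam 1) (gam 1) ->
    (forall t : R, 0 <= t <= 1 -> dotp (gam t) (gam t) <= K -> J (gam t) <= a) -> Q a.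
  move=> cg g0 g1 ga; have [t1 [/andP[t10 t11] e b]] := first_exit K0 cg g0 g1.
  exists (fun t => gam (t * t1)); split; [|by rewrite mul0r|by rewrite mul1r|].
    move=> t; apply: (@cont_comp _ t _ _ (fun t : R => t * t1) gam) => //.
    by apply: cont_mul; [exact: cvg_id | exact: cont_cst].
  move=> t /andP[tp tl].
  have h1 : 0 <= t * t1 <= t1 by rewrite mulr_ge0 //= -[leRHS]mul1r ler_wpM2r.
  have h2 := b _ h1.
  by split => //; apply: ga => //; case/andP: h1 => -> /= /le_trans ->.
have Qle a : Q a -> c0 <= a.
  case=> gam [cg g0 g1 ga].
  have [|t t01 ht] := ridge cg g0; first by rewrite g1.
  by apply: le_trans ht _; case: (ga t t01).
have Qstep a : a <= c1 -> Q a -> Q (a - s * s).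
  move=> ac [gam [cg g0 g1 ga]].
  suff /[dup] /Qle : Q (Num.max (3 / 4 * c0) (a - s * s)).
    by case: (leP (3 / 4 * c0) (a - s * s)) => // _ hc _; exfalso; lra.
  apply: (trunc _ (T \o gam)).
  - by move=> t; apply: (@cont_comp _ t _ _ gam T) => //; exact: cg.
  - by rewrite /= g0 /T chi0 ?mulr0 ?scale0r ?subr0 //; lra.
  - rewrite /= /T; case: (leP (J (gam 1)) (c0 / 2)) => [h|h].
      by rewrite chi0 // mulr0 scale0r subr0 g1.
    have J1 : J (gam 1) <= c1 by apply: le_trans ac; case: (ga 1); rewrite ?ler01 ?lexx.
    have := outer g1; rewrite (ltW h) J1 => /(_ isT) ho.
    rewrite dotpDl !dotpDr !dotpNr !dotpNl !dotpZl !dotpZr (dotpC (gam 1)) g1.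
    have /andP[a1 a2] := schi (gam 1); move: a1; set q := s * chi _ => a1.
    have b1 := dotp_ge0 (G (gam 1)).
    have b2 : q * dotp (G (gam 1)) (gam 1) <= 0 by rewrite mulr_ge0_le0.
    have b3 : 0 <= q * (q * dotp (G (gam 1)) (G (gam 1))) := mulr_ge0 a1 (mulr_ge0 a1 b1).
    by lra.
  - by move=> t t01 _; have [h1 h2] := ga t t01; exact: descent.
have Q1 : Q c1.
  case: over => e eK he; apply: (trunc _ (fun t => t *: e)); rewrite ?scale0r ?scale1r //.
    by move=> t; apply: cont_scale; [exact: cvg_id | exact: cont_cst].
  by move=> t t01 _; exact: he.
have Qn m : Q (c1 - m%:R * (s * s)).
  elim: m => [|m IH]; first by rewrite mul0r subr0.
  rewrite (_ : _ - _ = c1 - m%:R * (s * s) - s * s); last by rewrite -natr1; ring.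
  apply: Qstep => //; rewrite lerBlDr lerDl !mulr_ge0 ?(ltW s0) //.
have ss : 0 < s * s by rewrite mulr_gt0.
have c10 : 0 <= c1 / (s * s) by rewrite divr_ge0 ?(ltW ss) // (le_trans (ltW c00)) // Qle.
have /Qle := Qn (Num.bound (c1 / (s * s))).
have := archi_boundP c10; rewrite ltr_pdivrMr // => ? ?.
by lra.
Qed.

End MountainPass.

(** * Derivatives in one variable, and averages over vertices *)

Section DerivativeTools.
Variable R : realType.

Lemma is_derive_bigsum (I : Type) (r : seq I) (f : I -> R -> R) (d : I -> R) (t : R) :
  (forall i, is_derive t 1 (f i) (d i)) ->
  is_derive t 1 (fun s => \sum_(i <- r) f i s) (\sum_(i <- r) d i).
Proof.
move=> h; elim: r => [|i r IH].
  rewrite big_nil (_ : (fun s => _) = cst 0); first exact: is_derive_cst.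
  by apply/funext => s; rewrite big_nil.
rewrite big_cons (_ : (fun s => _) = f i + (fun s => \sum_(j <- r) f j s)).
  exact: is_deriveD.
by apply/funext => s; rewrite big_cons.
Qed.

Lemma is_derive_affine (a b t : R) : is_derive t 1 (fun s : R => a + s * b) b.
Proof.
have h1 : is_derive t 1 (cst a : R -> R) 0 by exact: is_derive_cst.
have h2 : is_derive t 1 (id : R -> R) 1 by exact: is_derive_id.
have h3 := @is_deriveD _ _ _ (cst a) (b *: (id : R -> R)) t 1 0 (b *: 1) h1 (@is_deriveZ _ _ _ id b t 1 1 h2).
have -> : (fun s : R => a + s * b) = cst a + b *: (id : R -> R).
  by apply/funext => s; rewrite /= /GRing.scale /= mulrC.
by apply: is_derive_eq h3 _; rewrite add0r /GRing.scale /= mulr1.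
Qed.

Lemma is_derive_cmul (c : R) (f : R -> R) (d t : R) : is_derive t 1 f d ->
  is_derive t 1 (fun s => c * f s) (c * d).
Proof. by move=> h; exact: (@is_deriveZ _ _ _ f c t 1 d h). Qed.

Lemma is_derive_add (f g : R -> R) (df dg t : R) : is_derive t 1 f df -> is_derive t 1 g dg ->
  is_derive t 1 (fun s => f s + g s) (df + dg).
Proof. by move=> h k; exact: (@is_deriveD _ _ _ f g t 1 df dg h k). Qed.

Lemma is_derive_comp_affine (g : R -> R) (a b t d : R) :
  is_derive (a + t * b) 1 g d -> is_derive t 1 (fun s : R => g (a + s * b)) (d * b).
Proof.
move=> h; have hb := is_derive_affine a b t.
exact: (@is_derive1_comp R g (fun s : R => a + s * b) t d b h hb).
Qed.

Lemma is_derive_sqr_affine (a b t : R) :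
  is_derive t 1 (fun s : R => (a + s * b) ^+ 2) (2 * (a + t * b) * b).
Proof.
apply: (@is_derive_comp_affine (fun y : R => y ^+ 2) a b t).
have h := @is_deriveX R R id 2 (a + t * b) 1 1 (is_derive_id _ _).
have e : (id : R -> R) ^+ 2 = (fun y : R => y ^+ 2) by apply/funext => y; rewrite fctE.
by rewrite -e; apply: is_derive_eq h _; rewrite /GRing.scale /= expr1 mulr1.
Qed.

End DerivativeTools.

Section Average.
Variables (R : realType) (n N : nat) (p : 'I_N -> 'rV[R]_n).
Hypothesis hN : (2 <= N)%N.
Implicit Types (g h : 'rV[R]_n -> R).

Lemma size_words m : size (words N m) = (N ^ m)%N.
Proof.
elim: m => //= m IH; rewrite size_allpairs IH size_enum_ord expnSr //.
Qed.

Lemma avg_eq m g h : (forall x, vertices p m x -> g x = h x) -> avg p m g = avg p m h.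
Proof.
move=> e; rewrite /avg; congr (_ * _).
rewrite big_seq [RHS]big_seq; apply: eq_bigr => w; rewrite wordsP => /eqP hw.
by apply: eq_bigr => i _; apply: e; rewrite -hw; exact: vertices_vtx.
Qed.

Lemma avg_le m g h : (forall x, vertices p m x -> g x <= h x) -> avg p m g <= avg p m h.
Proof.
move=> e; rewrite /avg ler_wpM2l ?exprn_ge0 ?invr_ge0 //.
rewrite big_seq [leRHS]big_seq; apply: ler_sum => w; rewrite wordsP => /eqP hw.
by apply: ler_sum => i _; apply: e; rewrite -hw; exact: vertices_vtx.
Qed.

Lemma avgD m g h : avg p m (fun x => g x + h x) = avg p m g + avg p m h.
Proof.
rewrite /avg -mulrDr -big_split; congr (_ * _); apply: eq_bigr => w _.
by rewrite -big_split.
Qed.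

Lemma avgZ m c g : avg p m (fun x => c * g x) = c * avg p m g.
Proof.
rewrite /avg mulrCA; congr (_ * _); rewrite mulr_sumr; apply: eq_bigr => w _.
by rewrite mulr_sumr.
Qed.

Lemma avgN m g : avg p m (fun x => - g x) = - avg p m g.
Proof. by rewrite -mulN1r -avgZ; apply: avg_eq => x _; rewrite mulN1r. Qed.

Lemma avgB m g h : avg p m (fun x => g x - h x) = avg p m g - avg p m h.
Proof. by rewrite avgD avgN. Qed.

Lemma avg_cst m c : avg p m (fun=> c) = c.
Proof.
have N0 := N_neq0 R hN.
rewrite /avg (eq_bigr (fun=> N%:R * c)); last by move=> w _; rewrite sum_ord_const.
rewrite big_const_seq count_predT size_words iter_addr_0 -[_ *+ (N ^ m)%N]mulr_natl natrX exprSr exprVn.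
by field; rewrite N0 expf_neq0.
Qed.

Lemma avg_ge0 m g : (forall x, vertices p m x -> 0 <= g x) -> 0 <= avg p m g.
Proof. by move=> h; rewrite -(avg_cst m 0); exact: avg_le. Qed.

Lemma avg_norm m g : `|avg p m g| <= avg p m (fun x => `|g x|).
Proof.
rewrite ler_norml -avgN; apply/andP; split; apply: avg_le => x _.
  by rewrite lerNl -normrN ler_norm.
exact: ler_norm.
Qed.

End Average.

(** * The discrete functional *)

Section Functional.
Variables (R : realType) (n N : nat) (p : 'I_N -> 'rV[R]_n).
Variables (V : set 'rV[R]_n) (alpha : 'rV[R]_n -> R) (f F : 'rV[R]_n -> R -> R).
Implicit Types (g h v : 'rV[R]_n -> R).
Hypothesis hN : (2 <= N)%N.
Hypothesis hp : forall i j : 'I_N, i <> j -> enorm (p i - p j) = 1.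
Hypothesis hV : forall m x, vertices p m x -> V x.
Hypothesis alpha_le0 : forall x, V x -> alpha x <= 0.
Hypothesis dF : forall x (t : R), V x -> is_derive t 1 (F x) (f x t).

(** The square of the norm with the potential alpha, at level m. *)
Definition qform (m : nat) v : R :=
  energy_at p m v - avg p m (fun x => alpha x * v x ^+ 2).

Definition Jfun (m : nat) v : R := qform m v / 2 + avg p m (fun x => F x (v x)).

Definition dJfun (m : nat) v h : R :=
  ((N%:R + 2) / N%:R) ^+ m * edge_form p m v h
  + avg p m (fun x => (f x (v x) - alpha x * v x) * h x).

Lemma energy_le_qform m v : energy_at p m v <= qform m v.
Proof.
rewrite /qform lerDl -avgN; apply: avg_ge0 => // x /hV /alpha_le0 ax.
by rewrite -mulNr mulr_ge0 ?sqr_ge0 // oppr_ge0.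
Qed.

Lemma dJfun_self m v : dJfun m v v = qform m v + avg p m (fun x => f x (v x) * v x).
Proof.
rewrite /dJfun /qform energy_atE // -addrA; congr (_ + _).
by rewrite -avgN -avgD; apply: avg_eq => x _; ring.
Qed.

Lemma edge_formC m g h : edge_form p m g h = edge_form p m h g.
Proof.
by do 3 (apply: eq_bigr => ? _); rewrite mulrC.
Qed.

Lemma is_derive_Jfun m v h (t : R) :
  is_derive t 1 (fun s => Jfun m (fun x => v x + s * h x)) (dJfun m (fun x => v x + t * h x) h).
Proof.
pose c : R := ((N%:R + 2) / N%:R) ^+ m; pose k : R := N%:R^-1 ^+ m.+1.
have -> : (fun s => Jfun m (fun x => v x + s * h x)) = (fun s : R =>
   c / 2 * \sum_(w <- words N m) \sum_(i < N) \sum_(j < N)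
     ((v (vtx p w i) - v (vtx p w j)) + s * (h (vtx p w i) - h (vtx p w j))) ^+ 2
   + k * \sum_(w <- words N m) \sum_(i < N)
      (F (vtx p w i) (v (vtx p w i) + s * h (vtx p w i))
       + (- alpha (vtx p w i) / 2) * (v (vtx p w i) + s * h (vtx p w i)) ^+ 2)).
  apply/funext => s; rewrite /Jfun /qform energy_atE // -/c mulrDl -addrA; congr (_ + _).
    rewrite mulrAC; congr (_ * _); do 3 (apply: eq_bigr => ? _); ring.
  rewrite -avgN mulrC -avgZ -avgD /avg -/k; congr (_ * _).
  by do 2 (apply: eq_bigr => ? _); field.
have -> : dJfun m (fun x => v x + t * h x) h =
   c / 2 * \sum_(w <- words N m) \sum_(i < N) \sum_(j < N)
     (2 * ((v (vtx p w i) - v (vtx p w j)) + t * (h (vtx p w i) - h (vtx p w j)))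
       * (h (vtx p w i) - h (vtx p w j)))
   + k * \sum_(w <- words N m) \sum_(i < N)
      (f (vtx p w i) (v (vtx p w i) + t * h (vtx p w i)) * h (vtx p w i)
       + (- alpha (vtx p w i) / 2) * (2 * (v (vtx p w i) + t * h (vtx p w i)) * h (vtx p w i))).
  rewrite /dJfun -/c; congr (_ + _).
    rewrite -mulrA; congr (_ * _); rewrite !mulr_sumr; apply: eq_bigr => w _.
    rewrite !mulr_sumr; apply: eq_bigr => i _; rewrite !mulr_sumr; apply: eq_bigr => j _.
    by field.
  by rewrite /avg -/k; congr (_ * _); do 2 (apply: eq_bigr => ? _); field.
apply: is_derive_add; apply: is_derive_cmul.
  do 3 (apply: is_derive_bigsum => ?); exact: is_derive_sqr_affine.
apply: is_derive_bigsum => w; apply: is_derive_bigsum => i.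
apply: is_derive_add; first by apply: is_derive_comp_affine; apply: dF; apply: (hV (vertices_vtx p w i)).
by apply: is_derive_cmul; exact: is_derive_sqr_affine.
Qed.

(** Summation by parts; the factor 2 is the number of addresses of an interior vertex. *)
Lemma dJfun_delta m v x : vertices p m x -> ~ boundary p x ->
  dJfun m v (fun y => (y == x)%:R) = 2 * N%:R^-1 ^+ m.+1 *
    (f x (v x) - alpha x * v x - laplacian_at p m v x).
Proof.
move=> hx hb; have N0 := N_neq0 R hN.
rewrite /dJfun edge_formC edge_form_lap.
have e (Phi : seq 'I_N -> 'I_N -> R) :
    \sum_(w <- words N m) \sum_(i < N) (vtx p w i == x)%:R * Phi w i = sum_at p m x Phi.
  apply: eq_bigr => w _; rewrite [RHS]big_mkcond; apply: eq_bigr => i _.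
  by case: (_ == _); rewrite ?mul1r ?mul0r.
rewrite e (laplacian_atE hN hp) /avg.
have -> : \sum_(w <- words N m) \sum_(i < N)
    (f (vtx p w i) (v (vtx p w i)) - alpha (vtx p w i) * v (vtx p w i)) * (vtx p w i == x)%:R
  = (f x (v x) - alpha x * v x) * 2.
  rewrite -(count_interior hN hp hx hb) -e mulr_sumr; apply: eq_bigr => w _.
  rewrite mulr_sumr; apply: eq_bigr => i _; case: eqP => [->|_]; by rewrite ?mul1r ?mulr1 ?mul0r ?mulr0.
rewrite expr_div_n exprSr exprVn; field.
by rewrite N0 expf_neq0.
Qed.

Lemma dJfunZDr m v (I : Type) (r : seq I) (c : I -> R) (h : I -> 'rV[R]_n -> R) :
  dJfun m v (fun x => \sum_(i <- r) c i * h i x) = \sum_(i <- r) c i * dJfun m v (h i).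
Proof.
elim: r => [|i r IH].
  rewrite big_nil /dJfun (_ : edge_form _ _ _ _ = 0); last first.
    by rewrite /edge_form; do 3 (apply: big1 => ? _); rewrite !big_nil subrr mulr0.
  rewrite mulr0 add0r -[RHS](avg_cst p hN m); apply: avg_eq => x _.
  by rewrite big_nil mulr0.
rewrite big_cons -IH /dJfun mulrDr addrACA; congr (_ + _).
  rewrite mulrCA -mulrDr; congr (_ * _); rewrite /edge_form mulr_sumr -big_split.
  apply: eq_bigr => w _ /=; rewrite mulr_sumr -big_split; apply: eq_bigr => j _ /=.
  rewrite mulr_sumr -big_split; apply: eq_bigr => l _ /=; rewrite !big_cons; ring.
rewrite -avgZ -avgD; apply: avg_eq => x _; rewrite big_cons; ring.
Qed.

End Functional.

(** * Interior minima, and coordinates on the interior vertices *)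

Lemma cont_sumV (R : realType) (T : topologicalType) (t : T) (W : normedModType R)
    (I : Type) (r : seq I) (g : I -> T -> W) :
  (forall i, continuous_at t (g i)) -> continuous_at t (fun s => \sum_(i <- r) g i s).
Proof.
move=> h; elim: r => [|i r IH].
  rewrite (_ : (fun s => _) = (fun=> 0)); first exact: cont_cst.
  by apply/funext => s; rewrite big_nil.
rewrite (_ : (fun s => _) = (fun s => g i s + \sum_(j <- r) g j s)).
  exact: cont_addV.
by apply/funext => s; rewrite big_cons.
Qed.

Lemma cont_row (R : realType) (T : topologicalType) (t : T) k (g : T -> 'I_k -> R) :
  (forall j, continuous_at t (fun s => g s j)) ->
  continuous_at t (fun s => (\row_j g s j : 'rV[R]_k)).
Proof.
move=> h.
rewrite (_ : (fun s => _) = (fun s => \sum_(j < k) g s j *: (delta_mx 0 j : 'rV[R]_k))).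
  by apply: cont_sumV => j; apply: cont_scale; [exact: h | exact: cont_cst].
apply/funext => s; rewrite {1}[LHS]row_sum_delta; apply: eq_bigr => j _; by rewrite mxE.
Qed.

(** The minimum of J over the compact set q <= r is at most J 0 <= 0, while J is positive where
    q = r; so it lies in the open set q < r, where a small gradient step would lower J further. *)
Lemma constrained_min (R : realType) (k : nat) (J : 'rV[R]_k -> R) (G : 'rV[R]_k -> 'rV[R]_k)
    (q : 'rV[R]_k -> R) (r K : R) :
  continuous J -> continuous G -> continuous q ->
  (forall (x h : 'rV[R]_k) (t : R), is_derive t 1 (fun s : R => J (x + s *: h)) (dotp (G (x + t *: h)) h)) ->
  (forall x, q x <= r -> dotp x x <= K) -> q 0 <= r -> J 0 <= 0 ->
  (forall x, q x = r -> 0 < J x) ->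
  exists x, [/\ q x <= r, J x <= 0 & G x = 0].
Proof.
move=> cJ cG cq dJ qK q0 J0 qr.
pose Z := [set x | dotp x x <= K] `&` [set x | q x <= r].
have cZ : compact Z.
  apply: compact_sublevel; apply: (@closed_comp _ _ q [set s | s <= r]).
    by move=> x _; exact: cq.
  exact: closed_le.
have Z0 : Z !=set0 by exists 0; split => //=; exact: qK.
have [c cZ' cmin] := compact_EVT_min Z0 cZ (continuous_subspaceT cJ).
move: cZ'; rewrite inE => -[_ /= qc].
have Jc : J c <= 0 by apply: le_trans J0; apply: cmin; rewrite inE; split => //=; exact: qK.
have {}qc : q c < r.
  by rewrite lt_neqAle qc andbT; apply/eqP => /qr; rewrite ltNge Jc.
exists c; split => //; first exact: ltW.
apply/eqP/negPn/negP => Gc.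
have [|s s0 hs] := uniform_descent cG dJ (@compact_set1 _ c); first by move=> x ->.
have ch : continuous_at (0 : R) (fun t : R => q (c - t *: G c)).
  apply: (@cont_comp _ (0 : R) _ _ (fun t : R => c - t *: G c) q) => //.
  apply: cont_addV; first exact: cont_cst.
  by apply: cont_oppV; apply: cont_scale; [exact: cvg_id | exact: cont_cst].
have near_q : \forall t \near (0 : R)^'+, q (c - t *: G c) < r.
  apply: cvg_within; move: ch; rewrite /continuous_at scale0r subr0 => ch.
  exact: (cvgr_lt (q c) ch _ qc).
have : \forall t \near (0 : R)^'+, [/\ 0 < t, t <= s & q (c - t *: G c) < r].
  near=> t; split.
  - by near: t; exact: nbhs_right_gt.
  - by near: t; exact: nbhs_right_le.
  - by near: t.
move=> /filter_ex [t [t0 ts qt]].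
have tI : 0 <= t <= s by rewrite (ltW t0).
have := hs c t erefl tI; have : J c <= J (c - t *: G c).
  by apply: cmin; rewrite inE; split => /=; [apply: qK; exact: ltW | exact: ltW].
by have := mulr_gt0 t0 s0; lra.
Unshelve. all: by end_near. Qed.

Section Coordinates.
Variables (R : realType) (n N : nat) (p : 'I_N -> 'rV[R]_n) (m : nat).

Definition interior_vertices : seq 'rV[R]_n :=
  [seq x <- undup [seq vtx p w i | w <- words N m, i <- enum 'I_N]
     | x \notin [seq p i | i <- enum 'I_N]].

Lemma mem_interior x : x \in interior_vertices <-> vertices p m x /\ ~ boundary p x.
Proof.
rewrite mem_filter mem_undup; split.
  move=> /andP[h1 /allpairsP [[w i] /= [hw _ e0]]]; rewrite e0 in h1 *; split.
    by move: hw; rewrite wordsP => /eqP hw; rewrite -hw; exact: vertices_vtx.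
  case=> j _ e; move/negP: h1; apply; apply/mapP; by exists j; rewrite ?mem_enum.
case=> /verticesP [w [i [hw ->]]] hb; apply/andP; split.
  by apply/negP => /mapP [j _ e]; apply: hb; exists j.
by apply/allpairsP; exists (w, i); rewrite /= wordsP hw mem_enum.
Qed.

Local Notation k := (size interior_vertices).
Definition coord_pt (j : 'I_k) : 'rV[R]_n := nth 0 interior_vertices j.

Lemma coord_ptP (j : 'I_k) : vertices p m (coord_pt j) /\ ~ boundary p (coord_pt j).
Proof. by apply/mem_interior; apply: mem_nth. Qed.

Lemma coord_pt_inj : injective coord_pt.
Proof.
move=> i j /eqP; rewrite nth_uniq ?filter_uniq ?undup_uniq // => /eqP h.
exact: val_inj.
Qed.

Lemma coord_pt_surj x : vertices p m x -> ~ boundary p x -> exists j, x = coord_pt j.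
Proof.
move=> h1 h2; have /(nthP 0) [j jk <-] : x \in interior_vertices by apply/mem_interior.
by exists (Ordinal jk).
Qed.

Definition of_coords (a : 'rV[R]_k) (x : 'rV[R]_n) : R :=
  \sum_(j < k) a 0 j * (x == coord_pt j)%:R.

Lemma of_coords_pt a j : of_coords a (coord_pt j) = a 0 j.
Proof.
rewrite /of_coords (bigD1 j) //= eqxx mulr1 big1 ?addr0 // => i ij.
by rewrite (inj_eq coord_pt_inj) eq_sym (negbTE ij) mulr0.
Qed.

Lemma of_coords_boundary a i : of_coords a (p i) = 0.
Proof.
rewrite /of_coords big1 // => j _; case: eqP => [e|]; last by rewrite mulr0.
by have [_ []] := coord_ptP j; exists i.
Qed.

Lemma of_coordsD a b t x : of_coords (a + t *: b) x = of_coords a x + t * of_coords b x.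
Proof.
rewrite /of_coords mulr_sumr -big_split; apply: eq_bigr => j _ /=.
by rewrite !mxE mulrDl mulrA.
Qed.

Lemma of_coords0 x : of_coords 0 x = 0.
Proof. by rewrite /of_coords big1 // => j _; rewrite mxE mul0r. Qed.

Lemma of_coordsK v x : (forall i, v (p i) = 0) -> vertices p m x ->
  of_coords (\row_j v (coord_pt j)) x = v x.
Proof.
move=> v0 hx; case: (pselect (boundary p x)) => [[i _ <-]|hb].
  by rewrite of_coords_boundary v0.
by have [j ->] := coord_pt_surj hx hb; rewrite of_coords_pt mxE.
Qed.

Lemma continuous_of_coords x : continuous (fun a => of_coords a x).
Proof.
move=> a; apply: cont_sum => j _; apply: cont_mul; last exact: cont_cst.
exact: coord_continuous.
Qed.

(** Compares the Euclidean norm of the coordinates with the sup norm of the function; only the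
    existence of a bound at fixed level matters. *)
Lemma dotp_of_coords_le a (B : R) : 0 <= B ->
  (forall x, vertices p m x -> `|of_coords a x| <= B) -> dotp a a <= k%:R * B ^+ 2.
Proof.
move=> B0 h; rewrite /dotp -sum_ord_const; apply: ler_sum => j _.
have := h _ (proj1 (coord_ptP j)); rewrite of_coords_pt => hj.
by rewrite -expr2 -real_normK ?num_real // ler_pXn2r ?nnegrE.
Qed.

End Coordinates.

(** * The discrete problem *)

Section DiscreteProblem.
Variables (R : realType) (n N : nat) (p : 'I_N -> 'rV[R]_n).
Variables (V : set 'rV[R]_n) (alpha : 'rV[R]_n -> R) (f F : 'rV[R]_n -> R -> R).
Hypothesis hN : (2 <= N)%N.
Hypothesis hp : forall i j : 'I_N, i <> j -> enorm (p i - p j) = 1.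
Hypothesis hV : forall m x, vertices p m x -> V x.
Hypothesis alpha_le0 : forall x, V x -> alpha x <= 0.
Hypothesis dF : forall x (t : R), V x -> is_derive t 1 (F x) (f x t).
Hypothesis cf : forall x, V x -> continuous (f x).
Hypothesis F0 : forall x, V x -> F x 0 = 0.

(** The last clause is the equation tested against v itself; it removes the energy from the value of
    the functional. *)
Definition discrete_solution (m : nat) (v : 'rV[R]_n -> R) : Prop :=
  [/\ forall i, v (p i) = 0,
      forall x, vertices p m x -> ~ boundary p x ->
        laplacian_at p m v x = f x (v x) - alpha x * v x &
      qform p alpha m v = - avg p m (fun x => f x (v x) * v x)].

Section Coordinate_functional.
Variable m : nat.
Local Notation k := (size (interior_vertices p m)).
Local Notation ev := (@of_coords R n N p m).

Definition coordJ (a : 'rV[R]_k) : R := Jfun p alpha F m (ev a).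
Definition coordG (a : 'rV[R]_k) : 'rV[R]_k :=
  \row_j dJfun p alpha f m (ev a) (fun y => (y == coord_pt j)%:R).

Lemma dotp_coordG a b : dotp (coordG a) b = dJfun p alpha f m (ev a) (ev b).
Proof.
have -> : dJfun p alpha f m (ev a) (ev b) =
    \sum_(j < k) b 0 j * dJfun p alpha f m (ev a) (fun y => (y == coord_pt j)%:R).
  exact: dJfunZDr.
by apply: eq_bigr => j _; rewrite mxE mulrC.
Qed.

Lemma is_derive_coordJ (x h : 'rV[R]_k) (t : R) :
  is_derive t 1 (fun s : R => coordJ (x + s *: h)) (dotp (coordG (x + t *: h)) h).
Proof.
have e (s : R) : ev (x + s *: h) = (fun y => ev x y + s * ev h y).
  by apply/funext => y; rewrite of_coordsD.
rewrite dotp_coordG e /coordJ (_ : (fun s : R => _) =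
  (fun s => Jfun p alpha F m (fun y => ev x y + s * ev h y))); last first.
  by apply/funext => s; rewrite e.
exact: is_derive_Jfun.
Qed.

Lemma continuous_avg (T : topologicalType) (t : T) (g : T -> 'rV[R]_n -> R) :
  (forall x, V x -> continuous_at t (fun s => g s x)) ->
  continuous_at t (fun s => avg p m (g s)).
Proof.
move=> h; apply: cont_mul; first exact: cont_cst.
apply: cont_sum => w _; apply: cont_sum => i _; apply: h.
exact: (hV (vertices_vtx p w i)).
Qed.

Lemma continuous_coord_qform : continuous (fun a : 'rV[R]_k => qform p alpha m (ev a)).
Proof.
move=> a; rewrite /qform (_ : (fun a => _) = fun a : 'rV[R]_k =>
   ((N%:R + 2) / N%:R) ^+ m * edge_form p m (ev a) (ev a)
   - avg p m (fun x => alpha x * (ev a x * ev a x))).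
  apply: cont_sub.
    apply: cont_mul; first exact: cont_cst.
    apply: cont_sum => w _; apply: cont_sum => i _; apply: cont_sum => j _.
    by apply: cont_mul; apply: cont_sub; exact: continuous_of_coords.
  apply: continuous_avg => x _; apply: cont_mul; first exact: cont_cst.
  by apply: cont_mul; exact: continuous_of_coords.
by apply/funext => b; rewrite energy_atE.
Qed.

Lemma continuous_F x : V x -> continuous (F x).
Proof.
move=> Vx t; apply: differentiable_continuous; apply/derivable1_diffP.
by have := dF t Vx.
Qed.

Lemma continuous_coordJ : continuous coordJ.
Proof.
move=> a; apply: cont_add.
  by apply: cont_mul; [exact: continuous_coord_qform | exact: cont_cst].
apply: continuous_avg => x Vx.
apply: (@cont_comp _ a _ _ (fun b => ev b x) (F x)); first exact: continuous_F.
exact: continuous_of_coords.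
Qed.

Lemma continuous_coordG : continuous coordG.
Proof.
move=> a; apply: cont_row => j; apply: cont_add.
  apply: cont_mul; first exact: cont_cst.
  apply: cont_sum => w _; apply: cont_sum => i _; apply: cont_sum => l _.
  apply: cont_mul; last exact: cont_cst.
  by apply: cont_sub; exact: continuous_of_coords.
apply: continuous_avg => x Vx; apply: cont_mul; last exact: cont_cst.
apply: cont_sub.
  apply: (@cont_comp _ a _ _ (fun b => ev b x) (f x)); first exact: cf.
  exact: continuous_of_coords.
by apply: cont_mul; [exact: cont_cst | exact: continuous_of_coords].
Qed.

Lemma critical_discrete_solution a : coordG a = 0 -> discrete_solution m (ev a).
Proof.
move=> Ga; split; first exact: of_coords_boundary.
  move=> x hx hb; have [j xj] := coord_pt_surj hx hb.
  have := congr1 (fun g : 'rV[R]_k => g 0 j) Ga.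
  rewrite !mxE -xj (dJfun_delta alpha f hN hp) // => /eqP.
  rewrite mulf_eq0 (negbTE (_ : _ != 0)) /=; last first.
    by rewrite mulf_neq0 ?pnatr_eq0 // expf_neq0 // invr_eq0; exact: N_neq0.
  by rewrite subr_eq0 => /eqP.
have : dotp (coordG a) a = 0 by rewrite Ga -(scale0r 0) dotpZl mul0r.
by rewrite dotp_coordG dJfun_self // => /eqP; rewrite addr_eq0 => /eqP.
Qed.

End Coordinate_functional.

Lemma sobolev_qform m v (r : R) x : (forall i, v (p i) = 0) -> vertices p m x ->
  0 <= r -> qform p alpha m v <= r ^+ 2 -> `|v x| <= (N%:R + 2) * r.
Proof.
move=> v0 hx r0 q; apply: le_trans (sobolev hN hp v0 hx) _.
rewrite ler_wpM2l //.
rewrite -[leRHS]ger0_norm // -sqrtr_sqr ler_sqrt ?sqr_ge0 //.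
by apply: le_trans q; apply: (@energy_le_qform _ _ _ _ V).
Qed.

End DiscreteProblem.

(** * Two discrete solutions at every level *)

Section TwoDiscreteSolutions.
Variables (R : realType) (n N : nat) (p : 'I_N -> 'rV[R]_n).
Variables (V : set 'rV[R]_n) (alpha : 'rV[R]_n -> R) (f F : 'rV[R]_n -> R -> R).
Hypothesis hN : (2 <= N)%N.
Hypothesis hp : forall i j : 'I_N, i <> j -> enorm (p i - p j) = 1.
Hypothesis hV : forall m x, vertices p m x -> V x.
Hypothesis alpha_le0 : forall x, V x -> alpha x <= 0.
Hypothesis dF : forall x (t : R), V x -> is_derive t 1 (F x) (f x t).
Hypothesis cf : forall x, V x -> continuous (f x).
Hypothesis F0 : forall x, V x -> F x 0 = 0.

Variables (M0 beta : R).
Hypothesis hM0 : 0 < M0.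
Hypothesis hbeta : 0 < beta.
Hypothesis hfM0 : forall x s, V x -> - M0 <= s <= M0 ->
  `|f x s| <= M0 / (2 * (beta + 1) * (2 * N%:R + 3) ^+ 2).

Definition radius : R := M0 / (2 * N%:R + 3).
Definition ridge_height : R := radius ^+ 2 / 2 * (beta / (beta + 1)).

Let Np : 0 < N%:R :> R. Proof. by rewrite ltr0n; lia. Qed.
Let Sp : 0 < 2 * N%:R + 3 :> R. Proof. by rewrite ltr_wpDl // mulr_ge0. Qed.
Let bp : 0 < beta + 1. Proof. by rewrite ltr_wpDl // ltW. Qed.

Lemma radius_gt0 : 0 < radius. Proof. by rewrite divr_gt0. Qed.

Lemma ridge_height_gt0 : 0 < ridge_height.
Proof. by rewrite !mulr_gt0 ?invr_gt0 ?exprn_gt0 ?radius_gt0. Qed.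

(** The constant N + 2 of the sup estimate is smaller than the constant 2 * N + 3 in the radius. *)
Lemma ball_sup_le m v x : (forall i, v (p i) = 0) -> vertices p m x ->
  qform p alpha m v <= radius ^+ 2 -> `|v x| <= M0.
Proof.
move=> v0 hx q; have N0 := Np; have S0 := Sp; have M00 := hM0.
apply: le_trans (sobolev_qform hN hp hV alpha_le0 v0 hx (ltW radius_gt0) q) _.
by rewrite /radius mulrA ler_pdivrMr // mulrC ler_wpM2l ?(ltW hM0) //; lra.
Qed.

Lemma ball_sup_le2 m v x : (forall i, v (p i) = 0) -> vertices p m x ->
  qform p alpha m v <= radius ^+ 2 -> `|v x| <= (2 * N%:R + 3) * radius.
Proof.
move=> v0 hx q; have N0 := Np.
apply: le_trans (sobolev_qform hN hp hV alpha_le0 v0 hx (ltW radius_gt0) q) _.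
by rewrite ler_wpM2r ?(ltW radius_gt0) //; lra.
Qed.

Lemma F_le_small x t : V x -> `|t| <= M0 ->
  `|F x t| <= M0 / (2 * (beta + 1) * (2 * N%:R + 3) ^+ 2) * `|t|.
Proof.
move=> Vx tM; move: (tM); rewrite ler_norml => /andP[t1 t2].
case: (lerP 0 t) => t0.
  have [u /andP[u0 ut]] := mean_value t0 (fun s => dF s Vx).
  rewrite F0 // !subr0 => ->; rewrite normrM ler_wpM2r // hfM0 //.
  by apply/andP; split; [apply: le_trans u0; rewrite lerNl oppr0 ltW | exact: le_trans t2].
have [u /andP[u0 ut]] := mean_value (ltW t0) (fun s => dF s Vx).
rewrite F0 // => e; have -> : F x t = f x u * t by lra.
rewrite normrM ler_wpM2r // hfM0 //.
by apply/andP; split; [exact: le_trans u0 | apply: le_trans ut (ltW hM0)].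
Qed.

Lemma avgF_le_small m v : (forall i, v (p i) = 0) -> qform p alpha m v <= radius ^+ 2 ->
  `|avg p m (fun x => F x (v x))| <= radius ^+ 2 / (2 * (beta + 1)).
Proof.
move=> v0 q; have S0 := Sp; have b0 := bp.
apply: le_trans (avg_norm _ _ _) _; rewrite -[leRHS](avg_cst p hN m); apply: avg_le => // x hx.
have Vx := hV hx; have vM := ball_sup_le v0 hx q.
apply: le_trans (F_le_small Vx vM) _.
have -> : radius ^+ 2 / (2 * (beta + 1)) =
  M0 / (2 * (beta + 1) * (2 * N%:R + 3) ^+ 2) * ((2 * N%:R + 3) * radius).
  by rewrite /radius; field; rewrite !lt0r_neq0.
rewrite ler_wpM2l ?(ball_sup_le2 v0 hx q) //.
by rewrite divr_ge0 ?(ltW hM0) // ltW // !mulr_gt0 // exprn_gt0.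
Qed.

(** On the sphere the quadratic part of the functional is radius ^+ 2 / 2, and the bound on f for
    arguments up to M0 allows the other part to be at most a fraction 1 / (beta + 1) of it. *)
Lemma ridge_le m v : (forall i, v (p i) = 0) -> qform p alpha m v = radius ^+ 2 ->
  ridge_height <= Jfun p alpha F m v.
Proof.
move=> v0 q; have b0 := bp.
have q' : qform p alpha m v <= radius ^+ 2 by rewrite q.
have := avgF_le_small v0 q'; rewrite ler_norml => /andP[h _].
rewrite /Jfun q; apply: le_trans (lerD (lexx _) h).
rewrite /ridge_height le_eqVlt; apply/orP; left; apply/eqP; field.
by rewrite lt0r_neq0.
Qed.

Lemma qformZ m c v : qform p alpha m (fun x => c * v x) = c ^+ 2 * qform p alpha m v.
Proof.
rewrite /qform !energy_atE // mulrBr -avgZ; congr (_ - _).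
  rewrite mulrCA; congr (_ * _); rewrite /edge_form mulr_sumr; apply: eq_bigr => w _.
  by rewrite mulr_sumr; apply: eq_bigr => i _; rewrite mulr_sumr; apply: eq_bigr => j _; ring.
by apply: avg_eq => x _; ring.
Qed.

Lemma Jfun_ext m v v' : (forall x, vertices p m x -> v x = v' x) ->
  Jfun p alpha F m v = Jfun p alpha F m v'.
Proof.
move=> e; rewrite /Jfun /qform !energy_atE //.
have -> : edge_form p m v v = edge_form p m v' v'.
  rewrite /edge_form big_seq [RHS]big_seq; apply: eq_bigr => w; rewrite wordsP => /eqP hw.
  by apply: eq_bigr => i _; apply: eq_bigr => j _; rewrite !e // -hw; exact: vertices_vtx.
by congr ((_ - _) / _ + _); apply: avg_eq => x hx; rewrite e.
Qed.

Lemma qform0 m v : (forall x, v x = 0) -> qform p alpha m v = 0.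
Proof.
move=> v0; rewrite (_ : v = fun x => 0 * v x); first by rewrite qformZ expr0n mul0r.
by apply/funext => x; rewrite mul0r v0.
Qed.

Lemma Jfun0 m v : (forall x, v x = 0) -> Jfun p alpha F m v = 0.
Proof.
move=> v0; rewrite /Jfun qform0 // mul0r add0r -[RHS](avg_cst p hN m).
by apply: avg_eq => x /hV Vx; rewrite v0 F0.
Qed.

(** The functional vanishes at 0 and is positive on the sphere qform = radius ^+ 2 (ridge_le), so its
    minimum over the ball is interior. *)
Lemma first_discrete_solution m : exists v,
  [/\ discrete_solution p alpha f m v, qform p alpha m v <= radius ^+ 2
    & Jfun p alpha F m v <= 0].
Proof.
pose ev := @of_coords R n N p m.
have bd a i : ev a (p i) = 0 by exact: of_coords_boundary.
have ev0 x : ev 0 x = 0 by exact: of_coords0.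
have hK a : qform p alpha m (ev a) <= radius ^+ 2 ->
    dotp a a <= (size (interior_vertices p m))%:R * M0 ^+ 2.
  move=> qa; apply: dotp_of_coords_le (ltW hM0) _ => x hx.
  exact: (ball_sup_le (bd a) hx qa).
have h0 : qform p alpha m (ev 0) <= radius ^+ 2 by rewrite qform0 ?sqr_ge0.
have J0 : coordJ alpha F (0 : 'rV[R]_(size (interior_vertices p m))) <= 0 by rewrite /coordJ Jfun0.
have hr a : qform p alpha m (ev a) = radius ^+ 2 -> 0 < coordJ alpha F a.
  by move=> qa; apply: lt_le_trans ridge_height_gt0 (ridge_le (bd a) qa).
have [a [qa Ja Ga]] := constrained_min
  (@continuous_coordJ R n N p V alpha f F hN hp hV dF m)
  (@continuous_coordG R n N p V alpha f hV cf m)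
  (@continuous_coord_qform R n N p V alpha hN hp hV m)
  (@is_derive_coordJ R n N p V alpha f F hN hp hV dF m) hK h0 J0 hr.
exists (ev a); split => //.
by apply: (@critical_discrete_solution R n N p alpha f hN hp m a Ga).
Qed.

Variables (nu C1 Al : R).
Hypotheses (hnu : 2 < nu) (C10 : 0 <= C1) (Al0 : 0 <= Al).
Hypothesis har : forall x t, V x -> t * f x t <= nu * F x t + C1.
Hypothesis hAl : forall x, V x -> - alpha x <= Al.

(** An upper bound of the quadratic form of the test function at all levels. *)
Definition test_energy : R := 2 * (N%:R + 2) * (N%:R - 1) + Al.

Variable Cg : R.
Hypothesis Cg0 : 0 <= Cg.
Hypothesis hgrow : forall x t, V x -> F x t <= Cg - 2 * test_energy * t ^+ 2.

(** The square of the test function has average at least 1 / 4, so F <= Cg - 2 * test_energy * t ^+ 2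
    absorbs the quadratic part t ^+ 2 / 2 * test_energy.  The bound does not depend on the level. *)
Lemma Jfun_test_le m i0 t : Jfun p alpha F m.+1 (fun x => t * testf p i0 m.+1 x) <= Cg.
Proof.
pose e := testf p i0 m.+1.
have e01 x : 0 <= e x <= 1 by exact: testf_bnd.
have qe : qform p alpha m.+1 e <= test_energy.
  rewrite /qform testf_energy // /test_energy lerD2l -avgN -[leRHS](avg_cst p hN m.+1).
  apply: avg_le => x /hV /[dup] /hAl h /alpha_le0 a0; have /andP[e0 e1] := e01 x.
  rewrite -mulNr; apply: le_trans h; rewrite -[leRHS]mulr1 ler_wpM2l ?oppr_ge0 //.
  by rewrite expr_le1.
have te0 : 0 <= test_energy.
  have N1 : 0 <= N%:R - 1 :> R by rewrite subr_ge0 ler1n ltnW.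
  have N2 : 0 <= N%:R + 2 :> R by rewrite addr_ge0.
  exact: (addr_ge0 (mulr_ge0 (mulr_ge0 (ler0n _ 2) N2) N1) Al0).
(* e ^ 2 >= e - 1 / 4, and the average of e is (N - 1) / N >= 1 / 2 *)
have e2 : 1 / 4 <= avg p m.+1 (fun x => e x ^+ 2).
  apply: le_trans (_ : avg p m.+1 (fun x => e x - 1 / 4) <= _); last first.
    apply: avg_le => x _; have := sqr_ge0 (e x - 1 / 2).
    by rewrite !expr2; lra.
  rewrite avgB avg_cst // testf_avg // -lerBlDr opprK.
  have N2 : 2 <= N%:R :> R by rewrite (ler_nat R 2).
  by rewrite ler_pdivlMr ?Np //; lra.
rewrite /Jfun qformZ.
have h1 : avg p m.+1 (fun x => F x (t * e x)) <=
    Cg - 2 * test_energy * t ^+ 2 * avg p m.+1 (fun x => e x ^+ 2).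
  rewrite -avgZ -[X in X - _](avg_cst p hN m.+1) -avgB; apply: avg_le => x /hV Vx.
  by apply: le_trans (hgrow _ Vx) _; rewrite exprMn mulrA.
have h2 : t ^+ 2 * qform p alpha m.+1 e <= t ^+ 2 * test_energy by rewrite ler_wpM2l ?sqr_ge0.
have h3 : 2 * test_energy * t ^+ 2 * (1 / 4) <=
    2 * test_energy * t ^+ 2 * avg p m.+1 (fun x => e x ^+ 2).
  by rewrite ler_wpM2l // mulr_ge0 ?sqr_ge0 // mulr_ge0.
by move: h1 h2 h3; rewrite -/e; lra.
Qed.

Definition energy_bound : R := (nu * Cg + C1) / (nu / 2 - 1).

Let nu2 : 0 < nu / 2 - 1. Proof. have := hnu; lra. Qed.

(** In nu * Jfun m v - dJfun m v v the nonlinear terms have a sign up to the constant C1 (the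
    condition of Ambrosetti and Rabinowitz), and what remains of the quadratic part is nu / 2 - 1 times qform. *)
Lemma ar_estimate m v : Jfun p alpha F m v <= Cg ->
  dJfun p alpha f m v v <= (nu / 2 - 1) * (energy_bound - qform p alpha m v).
Proof.
move=> Jv; rewrite dJfun_self // mulrBr mulrC /energy_bound divfK ?lt0r_neq0 //.
have : avg p m (fun x => f x (v x) * v x) <= nu * avg p m (fun x => F x (v x)) + C1.
  rewrite -avgZ -[X in _ + X](avg_cst p hN m) -avgD; apply: avg_le => x /hV Vx.
  by rewrite mulrC har.
have : nu * Jfun p alpha F m v <= nu * Cg by rewrite ler_wpM2l //; have := hnu; lra.
by rewrite /Jfun; lra.
Qed.

(** Mountain pass between 0 and a large multiple of the test function, over the ridge
    qform = radius ^+ 2.  By ar_estimate the derivative in the radial direction is nonpositive where J <= Cg and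
    qform is at least energy_bound, which gives both the hypothesis on the outer sphere and the bound on the solution. *)
Lemma second_discrete_solution m : exists v,
  [/\ discrete_solution p alpha f m.+1 v, qform p alpha m.+1 v <= energy_bound
    & ridge_height / 2 <= Jfun p alpha F m.+1 v].
Proof.
pose ev := @of_coords R n N p m.+1; pose k := size (interior_vertices p m.+1).
have bd a i : ev a (p i) = 0 by exact: of_coords_boundary.
have ev0 x : ev 0 x = 0 by exact: of_coords0.
have r0 := radius_gt0; have N0 := Np.
have eb0 : 0 <= energy_bound.
  rewrite /energy_bound divr_ge0 ?(ltW nu2) // addr_ge0 // mulr_ge0 //.
  by have := hnu; lra.
(* by the sup estimate, dotp a a >= K forces the quadratic form to be at least r *)
pose r := energy_bound + radius ^+ 2 + 1.
have N2p : 0 < N%:R + 2 :> R by rewrite addr_gt0.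
have rp : 0 < r by rewrite /r ltr_wpDl // addr_ge0 // sqr_ge0.
pose K := (k%:R + 1) * ((N%:R + 2) ^+ 2 * r).
have K0 : 0 < K by rewrite !mulr_gt0 ?exprn_gt0 // ltr_wpDl.
have big a : K <= dotp a a -> r <= qform p alpha m.+1 (ev a).
  move=> Ka; rewrite leNgt; apply/negP => qa.
  have : dotp a a <= k%:R * ((N%:R + 2) * Num.sqrt r) ^+ 2.
    apply: dotp_of_coords_le; first by rewrite mulr_ge0 ?sqrtr_ge0 // addr_ge0.
    move=> x hx; apply: (sobolev_qform hN hp hV alpha_le0 (bd a) hx (sqrtr_ge0 _)).
    by rewrite sqr_sqrtr ltW.
  move=> /(le_trans Ka); rewrite exprMn sqr_sqrtr ?(ltW rp) // /K.
  have := mulr_gt0 (exprn_gt0 2 N2p) rp.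
  by set z := _ * r; lra.
pose i0 : 'I_N := Ordinal (leq_trans (ltnSn 0) (ltnW hN)).
pose e : 'rV[R]_k := \row_j testf p i0 m.+1 (coord_pt j).
have eve x : vertices p m.+1 x -> ev e x = testf p i0 m.+1 x.
  by apply: of_coordsK => i; exact: testf_boundary.
have Je t : coordJ alpha F (t *: e) <= Cg.
  have ext x : vertices p m.+1 x -> ev (t *: e) x = t * testf p i0 m.+1 x.
    by move=> hx; rewrite -[t *: e]add0r /ev of_coordsD of_coords0 add0r -eve.
  by rewrite /coordJ (@Jfun_ext m.+1 _ (fun x => t * testf p i0 m.+1 x)) //; exact: Jfun_test_le.
have e0 : 0 < dotp e e.
  rewrite lt_neqAle dotp_ge0 andbT eq_sym dotp_eq0; apply/eqP => e0.
  have : avg p m.+1 (testf p i0 m.+1) = 0.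
    rewrite -[RHS](avg_cst p hN m.+1); apply: avg_eq => x hx.
    by rewrite -eve // e0 ev0.
  rewrite testf_avg // => /eqP; rewrite mulf_eq0 invr_eq0 (negbTE (lt0r_neq0 N0)) orbF.
  by rewrite subr_eq0 (eqr_nat R N 1) => /eqP N1; have := hN; rewrite {1}N1.
have over : exists2 a : 'rV[R]_k, K <= dotp a a &
    forall t : R, 0 <= t <= 1 -> coordJ alpha F (t *: a) <= Cg.
  exists ((1 + K / dotp e e) *: e); last by move=> t _; rewrite scalerA.
  rewrite dotpZl dotpZr mulrA -ler_pdivrMr //.
  have : 0 <= K / dotp e e by rewrite divr_ge0 // ltW.
  by set z := K / _ => z0; nra.
have J0 : coordJ alpha F (0 : 'rV[R]_k) <= 0 by rewrite /coordJ Jfun0.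
have cq := @continuous_coord_qform R n N p V alpha hN hp hV m.+1.
have ridge (gam : R -> 'rV[R]_k) : continuous gam -> gam 0 = 0 ->
    K <= dotp (gam 1) (gam 1) -> exists2 t : R, 0 <= t <= 1 & ridge_height <= coordJ alpha F (gam t).
  move=> cg g0 /big g1; pose d t := qform p alpha m.+1 (ev (gam t)).
  have cd : continuous d.
    by move=> t; apply: (@cont_comp _ t _ _ gam (fun a => qform p alpha m.+1 (ev a))) => //; exact: cg.
  have d0 : d 0 = 0 by rewrite /d g0 qform0.
  have dm : Num.min (d 0) (d 1) <= radius ^+ 2 <= Num.max (d 0) (d 1).
    rewrite d0 ge_min le_max sqr_ge0 /=; apply/orP; right; apply: le_trans g1.
    by rewrite /r; lra.
  have [t tI dt] := IVT ler01 (continuous_subspaceT cd) dm.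
  exists t; first by move: tI; rewrite in_itv.
  exact: (ridge_le (bd _) dt).
have outer (a : 'rV[R]_k) : dotp a a = K -> ridge_height / 2 <= coordJ alpha F a <= Cg ->
    dotp (coordG alpha f a) a <= 0.
  move=> aK /andP[_ Ja]; rewrite (dotp_coordG _ _ hN).
  apply: le_trans (ar_estimate Ja) _; apply: mulr_ge0_le0; first exact: ltW nu2.
  have := big a; rewrite aK lexx => /(_ isT); rewrite /r -/ev.
  by have := sqr_ge0 radius; lra.
have [a /andP[Ja1 Ja2] Ga] := mountain_pass
  (@continuous_coordJ R n N p V alpha f F hN hp hV dF m.+1)
  (@continuous_coordG R n N p V alpha f hV cf m.+1)
  (@is_derive_coordJ R n N p V alpha f F hN hp hV dF m.+1)
  K0 ridge_height_gt0 J0 ridge over outer.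
exists (ev a); split => //.
  by apply: (@critical_discrete_solution R n N p alpha f hN hp m.+1 a Ga).
have := ar_estimate Ja2; rewrite -(dotp_coordG _ _ hN) Ga -(scale0r 0) dotpZl mul0r.
by rewrite pmulr_rge0 // subr_ge0.
Qed.

End TwoDiscreteSolutions.

(** * Compactness, and the topology of the gasket *)

(** Compactness of a segment: along an ultrafilter every cluster point is a limit. *)
Lemma ultra_limit (R : realType) (U : set_system nat) (UU : UltraFilter U) (a : nat -> R) (B : R) :
  (forall m, `|a m| <= B) -> exists l : R, a @ U --> l.
Proof.
move=> aB.
have PU := @ultra_proper _ U UU.
have aI : (a @ U) `[- B, B]%classic.
  apply: (@filterS nat U _ setT); last exact: filterT.
  by move=> m _; rewrite /= in_itv /= -ler_norml.
have [l [_ lc]] := @segment_compact R (- B) B (a @ U) _ aI.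
exists l; apply/cvgrPdist_lt => e e0.
case: (in_ultra_setVsetC [set m | `|l - a m| < e] UU) => // UC.
have [|_ [[m] hm <-] hb] := lc (a @` (~` [set m | `|l - a m| < e])) (ball l e) _ (nbhsx_ballx l e e0).
  by rewrite /fmap /=; apply: filterS UC => m hm; exists m.
by exfalso; apply: hm.
Qed.

(** Heine and Cantor, for continuity relative to K. *)
Lemma uniform_continuity (R : realType) (T : pseudoMetricType R) (K : set T) (g : T -> R) :
  compact K -> {within K, continuous g} ->
  forall e, 0 < e -> exists2 d : R, 0 < d &
    forall x y, K x -> K y -> ball x d y -> `|g x - g y| < e.
Proof.
move=> cK /subspace_continuousP cg e e0.
pose P (d : R) x := forall y, K y -> ball x d y -> `|g x - g y| < e.
have : \forall d \near (0 : R)^'+, K `<=` P d.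
  apply: (iffRL (near_covering_withinP K) (iffLR (compact_near_coveringP K) cK)) => x Kx.
  have /cvgrPdist_lt /(_ _ (divr_gt0 e0 (ltr0n _ 2))) := cg x Kx.
  rewrite near_withinE => /nbhs_ballP [r /= r0 hr].
  have r0' : (0 : R) < r := r0.
  have r20 : 0 < r / 2 by rewrite divr_gt0.
  have r2 : r / 2 <= r by lra.
  have hr' t : ball x r t -> K t -> `|g x - g t| < e / 2 := hr t.
  near=> y d => /= Ky z Kz byz.
  have bxy : ball x (r / 2) y by near: y; exact: (nbhsx_ballx x _ r20).
  have dr : d <= r / 2 by near: d; exact: nbhs_right_le.
  have h1 := hr' y (le_ball r2 bxy) Ky.
  have h2 : `|g x - g z| < e / 2.
    by apply: hr' Kz; rewrite (splitr r); apply: ball_triangle bxy (le_ball dr byz).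
  rewrite (_ : g y - g z = (g x - g z) - (g x - g y)); last by ring.
  by apply: le_lt_trans (ler_normB _ _) _; rewrite (splitr e); apply: ltrD.
move=> h; have : \forall d \near (0 : R)^'+, 0 < d /\ K `<=` P d.
  by near=> d; split; near: d => //; exact: nbhs_right_gt.
by move=> /filter_ex [d [d0 hd]]; exists d => // x y Kx Ky; exact: hd.
Unshelve. all: by end_near. Qed.

Lemma compact_bound (R : realType) (T : topologicalType) (K : set T) (g : T -> R) :
  compact K -> {within K, continuous g} -> exists2 B, 0 <= B & forall x, K x -> `|g x| <= B.
Proof.
move=> cK cg; have [B [Br hB]] := compact_bounded (continuous_compact cg cK).
exists (`|B| + 1); first by rewrite addr_ge0.
move=> x Kx; apply: hB; last by exists x.
by rewrite (le_lt_trans (ler_norm B)) // ltrDl.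
Qed.

Section GasketTopology.
Variables (R : realType) (n N : nat) (p : 'I_N -> 'rV[R]_n) (V : set 'rV[R]_n).
Hypothesis hN : (2 <= N)%N.
Hypothesis hp : forall i j : 'I_N, i <> j -> enorm (p i - p j) = 1.
Hypothesis gV : is_gasket p V.

Let cV : compact V. Proof. by case: gV. Qed.
Let V0 : V !=set0. Proof. by case: gV. Qed.

Definition cell (w : seq 'I_N) : set 'rV[R]_n := simil_word p w @` V.

Lemma simil_in l x : V x -> V (simil p l x).
Proof. by case: gV => _ _ e Vx; rewrite -e; exists l => //; exists x. Qed.

Lemma simil_out x : V x -> exists l y, V y /\ x = simil p l y.
Proof. by case: gV => _ _ e; rewrite -{1}e => -[l _ [y Vy <-]]; exists l, y. Qed.

Lemma simil_word_in (w : seq 'I_N) x : V x -> V (simil_word p w x).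
Proof. by elim: w => //= l w IH Vx; apply: simil_in; exact: IH. Qed.

Lemma cell_sub w : cell w `<=` V.
Proof. by move=> _ [x Vx <-]; exact: simil_word_in. Qed.

Lemma cell_cover m x : V x -> exists w, size w = m /\ cell w x.
Proof.
elim: m x => [|m IH] x Vx; first by exists [::]; split => //; exists x.
have [l [y [Vy ->]]] := simil_out Vx; have [w [hw [z Vz <-]]] := IH y Vy.
by exists (l :: w); split; [rewrite /= hw | exists z].
Qed.

Lemma cell_cat w w' : cell (w ++ w') `<=` cell w.
Proof.
by move=> _ [x Vx <-]; rewrite simil_word_cat; exists (simil_word p w' x) => //; exact: simil_word_in.
Qed.

Lemma closed_V : closed V.
Proof. exact: (compact_closed (@norm_hausdorff _ _) cV). Qed.

(** Iterating one map contracts towards its fixed point; so the p i belong to the closed set V. *)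
Lemma simil_word_nseq m i x :
  simil_word p (nseq m i) x = p i + 2^-1 ^+ m *: (x - p i).
Proof.
rewrite addrC -[LHS](subrK (p i)); congr (_ + _).
by rewrite {1}(boundaryE p m i) simil_wordB size_nseq.
Qed.

Lemma p_in i : V (p i).
Proof.
have [y Vy] := V0.
have h0 : (fun m => (2^-1 : R) ^+ m) @ \oo --> (0 : R).
  by apply: cvg_expr; rewrite ger0_norm //; lra.
have h1 : (fun m => (2^-1 : R) ^+ m *: (y - p i)) @ \oo --> (0 : R) *: (y - p i).
  by apply: cvgZ h0 _; exact: cvg_cst.
have h : (fun m => p i + (2^-1 : R) ^+ m *: (y - p i)) @ \oo --> p i + (0 : R) *: (y - p i).
  by apply: cvgD h1; exact: cvg_cst.
rewrite scale0r addr0 in h.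
apply: (closed_cvg _ closed_V _ _ h).
by apply: nearW => m; rewrite -simil_word_nseq; exact: simil_word_in.
Qed.

Lemma vtx_in_cell (w : seq 'I_N) i : cell w (vtx p w i).
Proof. by exists (p i) => //; exact: p_in. Qed.

Lemma vertices_in m x : vertices p m x -> V x.
Proof. by move=> /verticesP [w [i [_ ->]]]; apply: cell_sub; exact: vtx_in_cell. Qed.

Lemma simil_word_continuous (w : seq 'I_N) : continuous (simil_word p w).
Proof.
move=> x; rewrite (_ : simil_word p w = fun x => 2^-1 ^+ size w *: x +
   2^-1 ^+ size w *: \sum_(j < N) (code w j)%:R *: p j).
  apply: cont_addV; last exact: cont_cst.
  by apply: cont_scale; [exact: cont_cst | exact: cvg_id].
by apply/funext => y; rewrite simil_wordE scalerDr.
Qed.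

Lemma closed_cell w : closed (cell w).
Proof.
apply: (compact_closed (@norm_hausdorff _ _)); apply: continuous_compact cV.
exact: (continuous_subspaceT (@simil_word_continuous w)).
Qed.

(** At a point c of V where lam j is minimal, c = simil l y with y in V gives
    lam j c >= lam j y / 2 >= lam j c / 2. *)
Lemma lam_ge0 j x : V x -> 0 <= lam p j x.
Proof.
have cl : continuous (lam p j).
  move=> y; apply: cont_add; first exact: cont_cst.
  apply: cont_mul; first exact: cont_cst.
  apply: continuous_dotp; last exact: cont_cst.
  by apply: cont_addV; [exact: cvg_id | exact: cont_cst].
have [c] := compact_EVT_min V0 cV (continuous_subspaceT cl).
rewrite inE => Vc cmin; have [l [y [Vy e]]] := simil_out Vc.
have c0 : 0 <= lam p j c.
  have := cmin y (mem_set Vy); rewrite {2}e lam_simil //.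
  have : 0 <= (l == j)%:R :> R by [].
  have -> : lam p j c = (lam p j y + (l == j)%:R) / 2 by rewrite {1}e lam_simil.
  by lra.
by move=> Vx; apply: le_trans c0 (cmin x (mem_set Vx)).
Qed.

(** If y and y' in V have the same image, lam p j y - lam p j y' is an integer for all j.  These
    numbers have sum 0 and lie between -1 and 1, so either the codes agree, or some lam p i y and some
    lam p j y' equal 1: then y = p i and y' = p j. *)
Lemma cells_meet (w w' : seq 'I_N) x : size w = size w' -> cell w x -> cell w' x ->
  exists i j, vtx p w i = vtx p w' j.
Proof.
move=> hs [y Vy <-] [y' Vy' e].
have ey j : (code w j)%:R + lam p j y = (code w' j)%:R + lam p j y'.
  have h2 : (2^-1 : R) ^+ size w != 0 by rewrite expf_neq0 // invr_eq0 pnatr_eq0.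
  by have := congr1 (lam p j) e; rewrite !lam_simil_word // -hs => /(mulfI h2) ->.
have y0 j := lam_ge0 j Vy; have y'0 j := lam_ge0 j Vy'.
have le1 z j : V z -> lam p j z <= 1.
  move=> Vz; rewrite -(sum_lam p hN z) (bigD1 j) //= lerDl.
  by apply: sumr_ge0 => k _; exact: lam_ge0.
case: (pselect (code w =1 code w')) => [ec|nc].
  pose i0 : 'I_N := Ordinal (leq_trans (ltnSn 0) (ltnW hN)).
  by exists i0, i0; rewrite (code_inj hs ec).
(* the difference of the barycentric coordinates is a nonzero integer vector of sum zero *)
have unit_of z j : V z -> lam p j z = 1 -> forall k, lam p k z = (j == k)%:R.
  move=> Vz e1 k; case: (eqVneq j k) => [<-//|jk].
  have := sum_lam p hN z; rewrite (bigD1 j) //= (bigD1 k) 1?eq_sym //= e1.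
  have := lam_ge0 k Vz; have : 0 <= \sum_(i < N | (i != j) && (i != k)) lam p i z.
    by apply: sumr_ge0 => i _; exact: lam_ge0.
  by move=> a b c; lra.
have sum_eq : \sum_(j < N) (code w j)%:R = \sum_(j < N) (code w' j)%:R :> R.
  have : \sum_(j < N) ((code w j)%:R + lam p j y) = \sum_(j < N) ((code w' j)%:R + lam p j y').
    by apply: eq_bigr => j _.
  by rewrite big_split [X in _ = X -> _]big_split /= (sum_lam p hN y) (sum_lam p hN y') => /addIr.
have [i hi] : exists i, (code w i < code w' i)%N.
  apply: contrapT => h; apply: nc => i; apply/eqP; rewrite eqn_leq andbC.
  have ge j : (code w' j <= code w j)%N by rewrite leqNgt; apply/negP => lt; apply: h; exists j.
  rewrite ge /= leqNgt; apply/negP => lt.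
  move: sum_eq; rewrite -!natr_sum => /eqP; rewrite eqr_nat => /eqP s.
  have : (\sum_(j < N) code w' j < \sum_(j < N) code w j)%N.
    rewrite (bigD1 i) //= [X in (_ < X)%N](bigD1 i) //= -addSn leq_add //.
    by apply: leq_sum => j _; exact: ge.
  by rewrite s ltnn.
have [j hj] : exists j, (code w' j < code w j)%N.
  apply: contrapT => h.
  have ge j : (code w j <= code w' j)%N by rewrite leqNgt; apply/negP => lt; apply: h; exists j.
  move: sum_eq; rewrite -!natr_sum => /eqP; rewrite eqr_nat => /eqP s.
  have : (\sum_(j < N) code w j < \sum_(j < N) code w' j)%N.
    rewrite (bigD1 i) //= [X in (_ < X)%N](bigD1 i) //= -addSn leq_add //.
    by apply: leq_sum => j _; exact: ge.
  by rewrite s ltnn.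
have yi : lam p i y = 1.
  have := ey i; have := y'0 i; have := le1 y i Vy.
  have : (code w i)%:R + 1 <= (code w' i)%:R :> R by rewrite natr1 ler_nat.
  by move=> *; lra.
have yj : lam p j y' = 1.
  have := ey j; have := y0 j; have := le1 y' j Vy'.
  have : (code w' j)%:R + 1 <= (code w j)%:R :> R by rewrite natr1 ler_nat.
  by move=> *; lra.
exists i, j; apply: same_vertexP => // k.
apply/eqP; rewrite -(eqr_nat R) !natrD -(unit_of y i) // -(unit_of y' j) //.
by rewrite ey.
Qed.

End GasketTopology.

(** * Limits of functions on the vertex sets *)

Section Limit.
Variables (R : realType) (n N : nat) (p : 'I_N -> 'rV[R]_n) (V : set 'rV[R]_n).
Hypothesis hN : (2 <= N)%N.
Hypothesis hp : forall i j : 'I_N, i <> j -> enorm (p i - p j) = 1.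
Hypothesis gV : is_gasket p V.
Variables (U : set_system nat) (UU : UltraFilter U).
Hypothesis Uoo : \oo `<=` U.
Variables (v : nat -> 'rV[R]_n -> R) (E : R).
Hypothesis v0 : forall m i, v m (p i) = 0.
Hypothesis vE : forall m, energy_at p m.+1 (v m) <= E.

Local Notation r := (@holder_ratio R N).
Let A : R := (N%:R + 2) * Num.sqrt E.
Let i0 : 'I_N := Ordinal (leq_trans (ltnSn 0) (ltnW hN)).
Let PU : ProperFilter U := @ultra_proper _ U UU.
Local Existing Instance PU.

Lemma A_ge0 : 0 <= A.
Proof. by rewrite mulr_ge0 ?sqrtr_ge0 // addr_ge0. Qed.

Lemma U_geq k : \forall m \near U, (k <= m)%N.
Proof. by apply: Uoo; exact: nbhs_infty_ge. Qed.

Lemma v_osc m (w w' : seq 'I_N) i j : (size w + size w' = m.+1)%N ->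
  `|v m (vtx p (w ++ w') i) - v m (vtx p w j)| <= A * r ^+ size w.
Proof.
move=> hs; apply: le_trans (osc_le hN hp (v m) i j hs) _.
rewrite ler_wpM2r ?exprn_ge0 ?holder_ratio_ge0 // ler_wpM2l ?addr_ge0 //.
by rewrite ler_wsqrtr.
Qed.

Lemma v_osc_corner m (w : seq 'I_N) i j : (size w <= m.+1)%N ->
  `|v m (vtx p w i) - v m (vtx p w j)| <= A * r ^+ size w.
Proof.
move=> hs; apply: le_trans (step_le hN hp (v m) i j hs) _.
rewrite ler_wpM2r ?exprn_ge0 ?holder_ratio_ge0 //.
apply: le_trans (ler_wsqrtr (vE m)) _; rewrite ler_peMl ?sqrtr_ge0 //.
by rewrite -natrD ler1n addn2.
Qed.

Definition word_at (m : nat) (x : 'rV[R]_n) : seq 'I_N :=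
  xget [::] [set w | size w = m /\ cell p V w x].
Definition near_vertex (m : nat) (x : 'rV[R]_n) : 'rV[R]_n := vtx p (word_at m x) i0.

Lemma word_atP m x : V x -> size (word_at m x) = m /\ cell p V (word_at m x) x.
Proof.
move=> Vx; rewrite /word_at; case: xgetP => // h.
by have [w hw] := cell_cover gV m Vx; case: (h w).
Qed.

(** The cell chosen for x and the cell w may differ, but by cells_meet they have a corner in common,
    through which the values are compared. *)
Lemma near_vertex_close m (w : seq 'I_N) x : (size w <= m.+1)%N -> cell p V w x ->
  `|v m (near_vertex m.+1 x) - v m (vtx p w i0)| <= 3 * (A * r ^+ size w).
Proof.
move=> hw cx; have Vx := cell_sub gV cx.
have [hs cx'] := word_atP m.+1 Vx; rewrite /near_vertex.
set w1 := word_at m.+1 x in hs cx' *.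
have h1 : size (take (size w) w1) = size w by rewrite size_takel // hs.
have c1 : cell p V (take (size w) w1) x.
  by apply: (cell_cat gV (w' := drop (size w) w1)); rewrite cat_take_drop.
have [i [j e]] := cells_meet hN hp gV h1 c1 cx.
have := @v_osc m (take (size w) w1) (drop (size w) w1) i0 i.
rewrite cat_take_drop h1 size_drop hs subnKC // => /(_ erefl) a.
have b := v_osc_corner j i0 hw; rewrite e in a.
rewrite -(subrK (v m (vtx p w j)) (v m (vtx p w1 i0))) -addrA.
apply: le_trans (ler_normD _ _) _.
have := A_ge0; have := exprn_ge0 (size w) (holder_ratio_ge0 R N) => q0 A0.
by have := mulr_ge0 A0 q0; lra.
Qed.

(** The approximation v m is controlled only on the vertices of level m.+1, so its value near x is
    read at a corner of a cell containing x.  Away from V the default 0 is returned. *)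
Definition limit_fun (x : 'rV[R]_n) : R :=
  xget 0 [set l : R | (fun m => v m (near_vertex m.+1 x)) @ U --> l].
Local Notation u := limit_fun.

Lemma limit_fun_cvg x : V x -> (fun m => v m (near_vertex m.+1 x)) @ U --> u x.
Proof.
move=> Vx; rewrite /limit_fun; case: xgetP => // h.
have [|l hl] := @ultra_limit R U UU (fun m => v m (near_vertex m.+1 x)) A; last by case: (h l).
move=> m; apply: le_trans (sobolev hN hp (v0 m) (vertices_vtx p _ i0)) _.
rewrite (proj1 (word_atP _ Vx)) ler_wpM2l ?addr_ge0 //.
by rewrite ler_wsqrtr.
Qed.

Lemma cvgU_norm_le (a : nat -> R) (l b : R) : a @ U --> l ->
  (\forall m \near U, `|a m| <= b) -> `|l| <= b.
Proof.
move=> al h; have al' : (fun m => `|a m|) @ U --> `|l| by exact: cvg_norm.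
exact: (cvgr_to_le (f := fun m => `|a m|) al' h).
Qed.

Lemma limit_osc (w : seq 'I_N) x y : cell p V w x -> cell p V w y ->
  `|u x - u y| <= 6 * (A * r ^+ size w).
Proof.
move=> cx cy.
have cv : (fun m => v m (near_vertex m.+1 x) - v m (near_vertex m.+1 y)) @ U --> u x - u y.
  by apply: cvgB; apply: limit_fun_cvg; [exact: (cell_sub gV cx) | exact: (cell_sub gV cy)].
apply: (cvgU_norm_le cv); near=> m.
have hw : (size w <= m.+1)%N by apply: leqW; near: m; exact: U_geq.
have a := near_vertex_close hw cx; have b := near_vertex_close hw cy.
rewrite (_ : _ - _ = (v m (near_vertex m.+1 x) - v m (vtx p w i0))
  - (v m (near_vertex m.+1 y) - v m (vtx p w i0))); last by ring.
by apply: le_trans (ler_normB _ _) _; lra.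
Unshelve. all: by end_near. Qed.

Lemma r_cvg0 : (fun k => r ^+ k) @ \oo --> (0 : R).
Proof. by apply: cvg_expr; rewrite ger0_norm ?holder_ratio_lt1 // holder_ratio_ge0. Qed.

Lemma small_level (e : R) : 0 < e -> exists k, A * r ^+ k <= e.
Proof.
move=> e0; have [k _ hk] : \forall k \near \oo, A * r ^+ k <= e.
  have : (fun k => A * r ^+ k) @ \oo --> A * 0 by apply: cvgM r_cvg0; exact: cvg_cst.
  by rewrite mulr0 => h; exact: (cvgr_le 0 h).
by exists k; apply: hk => /=.
Qed.

Lemma limit_vertex m x : vertices p m.+1 x ->
  `|v m (near_vertex m.+1 x) - v m x| <= 4 * (A * r ^+ m.+1).
Proof.
move=> /verticesP [w [i [hw ->]]].
have hw' : (size w <= m.+1)%N by rewrite hw.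
have a := near_vertex_close hw' (vtx_in_cell gV w i).
have b := v_osc_corner i0 i hw'.
rewrite hw in a b.
rewrite -(subrK (v m (vtx p w i0)) (v m (near_vertex m.+1 (vtx p w i)))) -addrA.
by apply: le_trans (ler_normD _ _) _; lra.
Qed.

Lemma near_all (T : eqType) (s : seq T) (P : T -> nat -> Prop) :
  (forall x, x \in s -> \forall m \near U, P x m) ->
  \forall m \near U, forall x, x \in s -> P x m.
Proof.
elim: s => [|a s IH] h; first by apply: nearW.
have h1 := h a (mem_head _ _).
have h2 := IH (fun x xs => h x (mem_behead (s := a :: s) xs)).
near=> m => x; rewrite inE => /orP[/eqP ->|]; first by near: m.
by move: x; near: m.
Unshelve. all: by end_near. Qed.

(** Convergence at the finitely many corners of a fixed level k suffices, since all v m and the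
    limit oscillate by little on cells of level k, uniformly in m. *)
Lemma limit_uniform (e : R) : 0 < e ->
  \forall m \near U, forall z, vertices p m.+1 z -> `|v m z - u z| <= e.
Proof.
move=> e0; have e20 : 0 < e / 20 by rewrite divr_gt0.
have [k hk] := small_level e20.
have corners : \forall m \near U, forall w, w \in words N k ->
    `|v m (near_vertex m.+1 (vtx p w i0)) - u (vtx p w i0)| <= e / 20.
  apply: near_all => w hw.
  have Vw : V (vtx p w i0) by apply: (vertices_in gV (vertices_vtx p w i0)).
  by have /cvgrPdist_le /(_ _ e20) := limit_fun_cvg Vw; apply: filterS => m; rewrite distrC.
have small : \forall m \near U, A * r ^+ m.+1 <= e / 20.
  have [m0 hm0] := small_level e20.
  near=> m; apply: le_trans hm0; rewrite ler_wpM2l ?A_ge0 //.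
  rewrite ler_wiXn2l ?holder_ratio_ge0 ?ltW ?holder_ratio_lt1 //.
  by apply: leqW; near: m; exact: U_geq.
near=> m => z hz.
have km : (k <= m.+1)%N by apply: leqW; near: m; exact: U_geq.
have [w [i [hw zE]]] := (iffLR (verticesP p m.+1 z)) hz.
set w0 := take k w.
have hw0 : size w0 = k by rewrite size_takel // hw.
have cz : cell p V w0 z.
  apply: (cell_cat gV (w' := drop k w)); rewrite cat_take_drop zE; exact: vtx_in_cell.
have cc : cell p V w0 (vtx p w0 i0) by exact: vtx_in_cell.
have km' : (size w0 <= m.+1)%N by rewrite hw0.
have h1 := limit_vertex hz.
have h2 := near_vertex_close km' cz.
have h3 := near_vertex_close km' cc.
have h4 : `|v m (near_vertex m.+1 (vtx p w0 i0)) - u (vtx p w0 i0)| <= e / 20.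
  have : w0 \in words N k by rewrite wordsP hw0.
  by move: (w0); near: m.
have h5 := limit_osc cc cz.
have h6 : A * r ^+ m.+1 <= e / 20 by near: m.
rewrite hw0 in h2 h3 h5.
have -> : v m z - u z = - (v m (near_vertex m.+1 z) - v m z)
  + ((v m (near_vertex m.+1 z) - v m (vtx p w0 i0))
  - (v m (near_vertex m.+1 (vtx p w0 i0)) - v m (vtx p w0 i0)))
  + ((v m (near_vertex m.+1 (vtx p w0 i0)) - u (vtx p w0 i0))
  + (u (vtx p w0 i0) - u z)) by ring.
apply: le_trans (ler_normD _ _) _.
have := ler_normD (- (v m (near_vertex m.+1 z) - v m z))
  ((v m (near_vertex m.+1 z) - v m (vtx p w0 i0))
  - (v m (near_vertex m.+1 (vtx p w0 i0)) - v m (vtx p w0 i0))).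
have := ler_normB (v m (near_vertex m.+1 z) - v m (vtx p w0 i0))
  (v m (near_vertex m.+1 (vtx p w0 i0)) - v m (vtx p w0 i0)).
have := ler_normD (v m (near_vertex m.+1 (vtx p w0 i0)) - u (vtx p w0 i0)) (u (vtx p w0 i0) - u z).
by rewrite normrN; lra.
Unshelve. all: by end_near. Qed.

Lemma limit_vertex_cvg k z : vertices p k z -> (fun m => v m z) @ U --> u z.
Proof.
move=> hz; apply/cvgrPdist_le => e e0; near=> m; rewrite distrC.
have hzm : vertices p m.+1 z.
  by apply: (vertices_leq _ hz); apply: leqW; near: m; exact: U_geq.
by move: (z) hzm; near: m; exact: limit_uniform.
Unshelve. all: by end_near. Qed.

Lemma limit_boundary i : u (p i) = 0.
Proof.
have hv : vertices p 0 (p i) by exists i.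
have h := limit_vertex_cvg hv.
have h' : (fun m => v m (p i)) @ U --> (0 : R).
  by rewrite (_ : (fun m => _) = fun=> 0); [exact: cvg_cst | apply/funext => m].
by apply: (cvg_unique _ h h').
Qed.

(** The cells of level k that do not contain x form a closed set, so near x only cells
    containing x occur, and limit_osc applies. *)
Lemma limit_continuous : {within V, continuous u}.
Proof.
apply/subspace_continuousP => x Vx; apply/cvgrPdist_lt => e e0.
have [k hk] := @small_level (e / 7) (divr_gt0 e0 (ltr0n _ 7)).
rewrite near_withinE.
pose far := [seq w <- words N k | `[< ~ cell p V w x >]].
have clF : closed (\big[setU/set0]_(w <- far) cell p V w).
  by apply: closed_bigsetU => w _; exact: closed_cell.
have nx : (~` (\big[setU/set0]_(w <- far) cell p V w)) x.
  move=> h; have [w] : exists2 w, w \in far & cell p V w x.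
    move: h; rewrite -bigcup_seq => -[w wf wx]; by exists w.
  by rewrite mem_filter => /andP[/asboolP].
have : \forall y \near x, (~` (\big[setU/set0]_(w <- far) cell p V w)) y.
  by apply: open_nbhs_nbhs; split => //; exact: closed_openC.
apply: filterS => y ny Vy.
have [w [hw cy]] := cell_cover gV k Vy.
have cx : cell p V w x.
  apply: contrapT => ncx; apply: ny; rewrite -bigcup_seq; exists w => //.
  by rewrite /= mem_filter wordsP hw eqxx andbT; apply/asboolP.
by apply: le_lt_trans (limit_osc cx cy) _; rewrite hw; lra.
Qed.

(** The energy of level k involves finitely many values, and it is at most that of level m.+1. *)
Lemma limit_energy k (E' : R) : (\forall m \near U, energy_at p m.+1 (v m) <= E') ->
  energy_at p k u <= E'.
Proof.
move=> vE'.
have cv : (fun m => energy_at p k (v m)) @ U --> energy_at p k u.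
  rewrite energy_atE // (_ : (fun m => _) = fun m =>
    ((N%:R + 2) / N%:R) ^+ k * edge_form p k (v m) (v m)); last first.
    by apply/funext => m; rewrite energy_atE.
  apply: cvgM; first exact: cvg_cst.
  rewrite /edge_form big_seq (_ : (fun m => _) = fun m => \sum_(w <- words N k | w \in words N k)
     \sum_(i < N) \sum_(j < N) (v m (vtx p w i) - v m (vtx p w j)) *
      (v m (vtx p w i) - v m (vtx p w j))); last by apply/funext => m; rewrite big_seq.
  apply: cvg_big_sum => w; rewrite wordsP => /eqP hw.
  apply: cvg_big_sum => i _; apply: cvg_big_sum => j _.
  by apply: cvgM; apply: cvgB; apply: (@limit_vertex_cvg k); rewrite -hw; exact: vertices_vtx.
apply: (cvgr_to_le (f := fun m => energy_at p k (v m)) cv); near=> m.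
have vm : energy_at p m.+1 (v m) <= E' by near: m; exact: vE'.
apply: le_trans vm; apply: energy_at_leq => //.
by apply: leqW; near: m; exact: U_geq.
Unshelve. all: by end_near. Qed.

(** By laplacian_average the estimate of the Laplacian of v m descends from level m.+1 to level k
    before m tends to infinity, at the cost of the oscillation of g over a ball of radius 2 * 2^-1 ^+ k. *)
Lemma limit_laplacian (g : 'rV[R]_n -> R) : {within V, continuous g} ->
  (forall e, 0 < e -> \forall m \near U, forall z, vertices p m.+1 z -> ~ boundary p z ->
     `|laplacian_at p m.+1 (v m) z - g z| <= e) ->
  forall e, 0 < e -> \forall k \near \oo, forall x, vertices p k x -> ~ boundary p x ->
     `|laplacian_at p k u x - g x| <= e.
Proof.
move=> cg hv e e0; have e20 : 0 < e / 2 by rewrite divr_gt0.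
have [|d d0 hd] := @uniform_continuity R _ V g _ cg (e / 2) e20; first by case: gV.
near=> k => x hx hb.
have cv : (fun m => laplacian_at p k (v m) x - g x) @ U --> laplacian_at p k u x - g x.
  apply: cvgB; last exact: cvg_cst.
  rewrite laplacian_atE // (_ : (fun m => _) = fun m =>
    N%:R * (N%:R + 2) ^+ k * sum_at p k x (cell_lap p (v m))); last first.
    by apply/funext => m; rewrite laplacian_atE.
  apply: cvgM; first exact: cvg_cst.
  rewrite /sum_at big_seq (_ : (fun m => _) = fun m => \sum_(w <- words N k | w \in words N k)
     \sum_(i < N | vtx p w i == x) cell_lap p (v m) w i); last by apply/funext => m; rewrite big_seq.
  apply: cvg_big_sum => w; rewrite wordsP => /eqP hw.
  apply: cvg_big_sum => i _; apply: cvg_big_sum => j _.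
  by apply: cvgB; apply: (@limit_vertex_cvg k); rewrite -hw; exact: vertices_vtx.
apply: (cvgU_norm_le cv); near=> m.
apply: (@laplacian_average R n N p hN hp k m.+1) => //.
  by apply: leqW; near: m; exact: U_geq.
move=> z hz hzb zx.
have h1 : `|laplacian_at p m.+1 (v m) z - g z| <= e / 2.
  by move: (z) hz hzb {zx}; near: m; exact: hv.
have h2 : `|g z - g x| < e / 2.
  apply: hd; [exact: (vertices_in gV hz) | exact: (vertices_in gV hx) | ].
  rewrite -ball_normE /=; apply: le_lt_trans zx _.
  near: k; have : (fun k => 2 * (2^-1 : R) ^+ k) @ \oo --> 2 * (0 : R).
    by apply: cvgM; [exact: cvg_cst | apply: cvg_expr; rewrite ger0_norm //; lra].
  by rewrite mulr0 => h; exact: (cvgr_lt 0 h).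
rewrite -(subrK (g z) (laplacian_at p m.+1 (v m) z)) -addrA.
by apply: le_trans (ler_normD _ _) _; lra.
Unshelve. all: by end_near. Qed.

End Limit.

(** * The measure of the cells *)

Section HausdorffScaling.
Variables (R : realType) (n N : nat) (p : 'I_N -> 'rV[R]_n).
Hypothesis hN : (2 <= N)%N.
Local Notation d := (@gasket_dim R N).

Lemma enormZ (c : R) (x : 'rV[R]_n) : 0 <= c -> enorm (c *: x) = c * enorm x.
Proof.
move=> c0; rewrite /enorm (_ : \sum_(i < n) _ = c ^+ 2 * \sum_(i < n) x 0 i ^+ 2).
  by rewrite sqrtrM ?sqr_ge0 // sqrtr_sqr ger0_norm.
by rewrite mulr_sumr; apply: eq_bigr => i _; rewrite mxE exprMn.
Qed.

Lemma simil_enorm i (x y : 'rV[R]_n) :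
  enorm (simil p i x - simil p i y) = 2^-1 * enorm (x - y).
Proof. by rewrite /simil opprD addrACA subrr addr0 -scalerBr enormZ. Qed.

Lemma diam_ge0 (A : set 'rV[R]_n) : 0 <= diam A.
Proof.
case: (pselect (has_sup [set enorm (x - y) | x in A & y in A])) => hs; last by rewrite /diam sup_out.
have [z [x Ax [y Ay _]]] := hs.1.
apply: le_trans (sqrtr_ge0 _ : 0 <= enorm (x - y)) _.
by apply: sup_upper_bound => //; exists x => //; exists y.
Qed.

Lemma diam_simil i (A : set 'rV[R]_n) (D : R) : (forall x y, A x -> A y -> enorm (x - y) <= D) ->
  diam (simil p i @` A) <= 2^-1 * diam A.
Proof.
move=> hD; case: (pselect (A !=set0)) => [[a Aa]|A0].
  apply: ge_sup; first by exists (enorm (simil p i a - simil p i a)); exists (simil p i a);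
    [exists a | exists (simil p i a); [exists a|]].
  move=> _ [_ [x Ax <-] [_ [y Ay <-] <-]]; rewrite simil_enorm ler_wpM2l //.
  apply: sup_upper_bound; last by exists x => //; exists y.
  split; first by exists (enorm (x - y)); exists x => //; exists y.
  by exists D => _ [z Az [t At <-]]; exact: hD.
rewrite {1}/diam (_ : [set _ | _ in _ & _ in _] = set0) ?sup0 ?mulr_ge0 ?diam_ge0 //.
by apply/seteqP; split => // z [_ [x Ax _] _]; apply: A0; exists x.
Qed.

(** The dimension ln N / ln 2 is defined by this equation. *)
Lemma half_powR_dim : (2^-1 : R) `^ d = N%:R^-1.
Proof.
have N0 : 0 < N%:R :> R by rewrite ltr0n; lia.
have l2 : ln 2 != 0 :> R by rewrite gt_eqF // ln_gt0 // ltr1n.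
rewrite /powR gt_eqF ?invr_gt0 // lnV ?posrE // mulrN /gasket_dim divfK //.
by rewrite expRN lnK ?posrE.
Qed.

(** The image of a cover is a cover of the image with all diameters halved, hence all powers divided
    by N. *)
Lemma hausdorff_simil i (A : set 'rV[R]_n) :
  (hausdorff d (simil p i @` A) <= (N%:R^-1)%:E * hausdorff d A)%E.
Proof.
have N0 : 0 < N%:R :> R by rewrite ltr0n; lia.
apply: ge_ereal_sup => _ [e /= e0 <-].
apply: le_trans (_ : (N%:R^-1)%:E * hausdorff_delta d e A <= _)%E; last first.
  apply: lee_wpmul2l; first by rewrite lee_fin invr_ge0.
  by apply: ereal_sup_ubound; exists e.
rewrite lee_pdivlMl //; apply: le_ereal_inf_tmp => _ [Uk [cov small] <-].
rewrite muleC -lee_pdivlMr // muleC.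
apply: le_trans (_ : \sum_(k <oo) (diam (simil p i @` Uk k) `^ d)%:E <= _)%E.
  apply: ereal_inf_lbound; exists (fun k => simil p i @` Uk k) => //; split.
    by move=> _ [x /cov [k _ Ux] <-]; exists k => //; exists x.
  move=> k _ _ [x Ux <-] [y Uy <-]; rewrite simil_enorm; have := small k x y Ux Uy.
  have : 0 <= enorm (x - y) by exact: sqrtr_ge0.
  by move=> a b; lra.
rewrite -nneseriesZl; last by move=> k _; rewrite lee_fin powR_ge0.
apply: lee_nneseries => [k _ _|k _]; first by rewrite lee_fin powR_ge0.
rewrite -EFinM lee_fin -half_powR_dim -powRM // ?diam_ge0 //.
have d0 : 0 <= d.
  by rewrite /gasket_dim divr_ge0 // ln_ge0 ?ler1n // ltnW.
apply: (ge0_ler_powR d0); rewrite ?nnegrE ?diam_ge0 //.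
  by apply: mulr_ge0; rewrite ?diam_ge0.
exact: (diam_simil i (small k)).
Qed.

Lemma hausdorff_ge0 (A : set 'rV[R]_n) : (0 <= hausdorff d A)%E.
Proof.
apply: le_trans (_ : hausdorff_delta d 1 A <= _)%E; last first.
  by apply: ereal_sup_ubound; exists 1 => //=.
apply: le_ereal_inf_tmp => _ [Uk _ <-]; apply: nneseries_ge0 => k _ _.
by rewrite lee_fin powR_ge0.
Qed.

Lemma hausdorff_cell (w : seq 'I_N) (A : set 'rV[R]_n) :
  (hausdorff d (simil_word p w @` A) <= (N%:R^-1 ^+ size w)%:E * hausdorff d A)%E.
Proof.
elim: w => [|l w IH].
  by rewrite expr0 mul1e (_ : _ @` A = A) //; rewrite -[RHS]image_id.
have -> : simil_word p (l :: w) @` A = simil p l @` (simil_word p w @` A).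
  by rewrite -image_comp.
apply: le_trans (hausdorff_simil _ _) _; rewrite exprS EFinM -muleA.
by apply: lee_wpmul2l IH; rewrite lee_fin invr_ge0.
Qed.

End HausdorffScaling.

Lemma setU_measurable_le d' (T : ringOfSetsType d') (R : realFieldType)
    (mu : {content set T -> \bar R}) (I : Type) (s : seq I) (A : I -> set T) :
  (forall i, measurable (A i)) ->
  (mu (\big[setU/set0]_(i <- s) A i) <= \sum_(i <- s) mu (A i))%E.
Proof.
move=> mA; elim: s => [|i s IH]; first by rewrite !big_nil measure0.
rewrite !big_cons.
have mB : measurable (\big[setU/set0]_(j <- s) A j).
  by apply: bigsetU_measurable => *; exact: mA.
by apply: le_trans (measureU2 mu (mA i) mB) _; exact: leeD2l.
Qed.

Section GasketMeasure.
Variables (R : realType) (n N : nat) (p : 'I_N -> 'rV[R]_n) (V : set 'rV[R]_n).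
Hypothesis hN : (2 <= N)%N.
Hypothesis gV : is_gasket p V.
Variable mu : {measure set (borel R n) -> \bar R}.
Hypothesis hmu : is_gasket_measure N V mu.

Lemma borel_open (A : set 'rV[R]_n) : open A -> measurable (A : set (borel R n)).
Proof. by move=> oA; apply: sub_sigma_algebra. Qed.

Lemma borel_closed (A : set 'rV[R]_n) : closed A -> measurable (A : set (borel R n)).
Proof. by move/closed_openC/borel_open/measurableC; rewrite setCK. Qed.

Lemma measurable_V : measurable (V : set (borel R n)).
Proof. by apply: borel_closed; exact: (closed_V gV). Qed.

Lemma measurable_cell w : measurable (cell p V w : set (borel R n)).
Proof. by apply: borel_closed; exact: (closed_cell gV). Qed.

(** The measure is c times the Hausdorff measure h, where c * h = 1 on V excludes infinite and
    negative factors; the rest is scaling. *)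
Lemma cell_measure_le (w : seq 'I_N) : (mu (cell p V w) <= (N%:R^-1 ^+ size w)%:E)%E.
Proof.
case: hmu => [[c hc] mV].
have HV := hc V measurable_V; rewrite mV setIid in HV.
rewrite hc; last exact: measurable_cell.
have -> : cell p V w `&` V = cell p V w by apply/setIidPl; exact: (cell_sub gV).
have h0 := @hausdorff_ge0 R n N V; have hw := hausdorff_cell p hN w V.
case: (hausdorff _ V) HV h0 hw => [h| |] //=.
  rewrite -EFinM => -[ch] h0 hw; have c0 : 0 <= c.
    move: ch; case: (leP 0 c) => // c0 /esym ch.
    have : 0 <= h by rewrite -lee_fin.
    by nra.
  apply: le_trans (lee_wpmul2l _ hw) _; first by rewrite lee_fin.
  by rewrite -!EFinM lee_fin mulrCA -ch mulr1.
move=> e _ _; move: e; case: (ltgtP c 0) => [c0|c0|->].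
- by rewrite lt0_muley.
- by rewrite gt0_muley.
- by rewrite mul0e => -[] /eqP; rewrite oner_eq0.
Qed.

Definition cell_mass (w : seq 'I_N) : R := fine (mu (cell p V w)).

Lemma cell_massE w : mu (cell p V w) = (cell_mass w)%:E.
Proof.
rewrite /cell_mass fineK // fin_numElt (le_lt_trans (cell_measure_le w)) ?ltry // andbT.
by apply: lt_le_trans (measure_ge0 _ _).
Qed.

Lemma cell_mass_le w : cell_mass w <= N%:R^-1 ^+ size w.
Proof. by rewrite -lee_fin -cell_massE; exact: cell_measure_le. Qed.

Lemma sum_cell_mass m : 1 <= \sum_(w <- words N m) cell_mass w.
Proof.
case: hmu => _ mV; rewrite -lee_fin -mV -sumEFin.
under eq_bigr do rewrite -cell_massE.
apply: le_trans (setU_measurable_le mu (words N m) measurable_cell).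
apply: le_measure; rewrite ?inE; first exact: measurable_V.
  by apply: bigsetU_measurable => w _; exact: measurable_cell.
move=> x Vx; have [w [hw cx]] := cell_cover gV m Vx.
by rewrite -bigcup_seq; exists w => //=; rewrite wordsP hw.
Qed.

Lemma sum_words_cst m : \sum_(w <- words N m) N%:R^-1 ^+ m = 1 :> R.
Proof.
have N0 := N_neq0 R hN.
rewrite big_const_seq count_predT size_words iter_addr_0 -[_ *+ (N ^ m)%N]mulr_natl natrX.
by rewrite exprVn mulfV // expf_neq0.
Qed.

(** The N ^ m cells of level m cover V, of mass 1, and none has mass above N^-1 ^+ m; so each mass
    equals this bound. *)
Lemma cell_mass_gt0 w : 0 < cell_mass w.
Proof.
have q0 : 0 < N%:R^-1 ^+ size w :> R by rewrite exprn_gt0 // invr_gt0 ltr0n; lia.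
have ws : w \in words N (size w) by rewrite wordsP.
have := sum_cell_mass (size w); have := sum_words_cst (size w).
rewrite !(bigD1_seq w) ?uniq_words //= => e h.
have : \sum_(v <- words N (size w) | v != w) cell_mass v
    <= \sum_(v <- words N (size w) | v != w) N%:R^-1 ^+ size w.
  rewrite big_seq_cond [leRHS]big_seq_cond; apply: ler_sum => v /andP[].
  by rewrite wordsP => /eqP <- _; exact: cell_mass_le.
by move=> h2; move: e h h2 q0; set a := \sum_(_ <- _ | _) _; set b := \sum_(_ <- _ | _) _ => *; lra.
Qed.

Lemma cell_diameter : exists2 D : R, 0 <= D & forall w x y, cell p V w x -> cell p V w y ->
  `|x - y| <= 2^-1 ^+ size w * D.
Proof.
have cV : compact V by case: gV.
have [B [_ hB]] := compact_bounded cV.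
exists (2 * (`|B| + 1)); first by rewrite mulr_ge0 // addr_ge0.
move=> w _ _ [x Vx <-] [y Vy <-]; rewrite simil_wordB normrZ ger0_norm ?exprn_ge0 //.
rewrite ler_wpM2l ?exprn_ge0 //; apply: le_trans (ler_normB _ _) _.
have b : B < `|B| + 1 by rewrite (le_lt_trans (ler_norm B)) // ltrDl.
have /= := hB _ b x Vx; have /= := hB _ b y Vy.
by lra.
Qed.

Lemma cell_oscillation (g : 'rV[R]_n -> R) : {within V, continuous g} ->
  forall e, 0 < e -> \forall m \near \oo, forall w x y, size w = m ->
    cell p V w x -> cell p V w y -> `|g x - g y| <= e.
Proof.
move=> cg e e0; have [|dl d0 hd] := @uniform_continuity R _ V g _ cg e e0; first by case: gV.
have [D D0 hD] := cell_diameter.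
near=> m => w x y hw cx cy; apply: ltW; apply: hd; try exact: (cell_sub gV cx); try exact: (cell_sub gV cy).
rewrite -ball_normE /=; apply: le_lt_trans (hD w x y cx cy) _; rewrite hw.
near: m; have : (fun k => (2^-1 : R) ^+ k * D) @ \oo --> (0 : R) * D.
  by apply: cvgM; [apply: cvg_expr; rewrite ger0_norm //; lra | exact: cvg_cst].
by rewrite mul0r => h; exact: (cvgr_lt 0 h).
Unshelve. all: by end_near. Qed.

(** If g were positive at x, it would be positive on a small cell around x; cells have positive mass. *)
Lemma ae_le0_le0 (g : 'rV[R]_n -> R) : {within V, continuous g} ->
  {ae mu, forall x, V x -> g x <= 0} -> forall x, V x -> g x <= 0.
Proof.
move=> cg [B [mB B0 sub]] x Vx; rewrite leNgt; apply/negP => gx.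
have [m _ hm] := cell_oscillation cg (divr_gt0 gx (ltr0n _ 2)).
have [w [hw cx]] := cell_cover gV m Vx.
have : (mu (cell p V w) <= mu B)%E.
  apply: le_measure; rewrite ?inE //; first exact: measurable_cell.
  move=> y cy; apply: sub => /= /(_ (cell_sub gV cy)) gy.
  have := hm m (leqnn m) w x y hw cx cy.
  rewrite ler_norml => /andP[_ h].
  have : g x <= g x / 2 by apply: le_trans h; rewrite lerDl oppr_ge0.
  by rewrite leNgt ltr_pdivrMr // ltr_pMr // ltr1n.
by rewrite B0 cell_massE lee_fin leNgt cell_mass_gt0.
Qed.

Lemma measurable_continuous (g : 'rV[R]_n -> R) : {within V, continuous g} ->
  measurable_fun (V : set (borel R n)) (g : borel R n -> R).
Proof.
move=> /continuousP cg mV; apply: (measurability _ (RGenOpens.measurableE R)) => //.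
move=> _ [_ [a [b ->] <-]].
have oab : open (`]a, b[%classic : set R) by exact: interval_open.
have [W oW e] := (@open_subspaceP 'rV[R]_n V (g @^-1` `]a, b[%classic)).1 (cg _ oab).
by rewrite setIC -e setIC; apply: measurableI; [exact: measurable_V | exact: borel_open].
Qed.

(** On each cell of level m the function is at most its average over the corners plus its
    oscillation, and the cell has mass at most N^-1 ^+ m. *)
Lemma integral_le_avg (h : 'rV[R]_n -> R) : {within V, continuous h} ->
  (forall x, V x -> 0 <= h x) -> forall e, 0 < e ->
  \forall m \near \oo, (\int[mu]_(x in V) (h x)%:E <= (avg p m h + e)%:E)%E.
Proof.
move=> ch h0 e e0; have N0 := N_neq0 R hN.
near=> m.
have osc w x y : size w = m -> cell p V w x -> cell p V w y -> `|h x - h y| <= e.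
  by move: w x y; near: m; exact: cell_oscillation.
pose a (w : seq 'I_N) : R := N%:R^-1 * (\sum_(i < N) h (vtx p w i)) + e.
have a0 w : 0 <= a w.
  rewrite addr_ge0 ?(ltW e0) // mulr_ge0 ?invr_ge0 //; apply: sumr_ge0 => i _; apply: h0.
  exact: (cell_sub gV (vtx_in_cell gV w i)).
have ha w x : size w = m -> cell p V w x -> h x <= a w.
  move=> hw cx; rewrite /a.
  have -> : h x = N%:R^-1 * \sum_(i < N) h x by rewrite sum_ord_const mulKf.
  have -> : e = N%:R^-1 * \sum_(i < N) e by rewrite sum_ord_const mulKf.
  rewrite -mulrDr ler_wpM2l ?invr_ge0 // -big_split; apply: ler_sum => i _ /=.
  have := osc w x (vtx p w i) hw cx (vtx_in_cell gV w i).
  by rewrite ler_norml => /andP[_]; lra.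
pose step w : borel R n -> \bar R := fun x => ((a w)%:E * (\1_(cell p V w) x)%:E)%E.
have mind w : measurable_fun (V : set (borel R n)) (step w).
  apply: measurable_funeM; apply/measurable_EFinP; apply: measurable_indic; exact: measurable_cell.
have ind0 w (x : borel R n) : (0 <= step w x)%E.
  by rewrite /step mule_ge0 ?lee_fin.
apply: le_trans (_ : \int[mu]_(x in V)
    (\sum_(w <- words N m) step w x)%E <= _)%E.
  apply: ge0_le_integral.
  - exact: measurable_V.
  - by move=> x Vx; rewrite lee_fin h0.
  - by apply/measurable_EFinP; exact: measurable_continuous.
  - by apply: emeasurable_sum => w; exact: mind.
  - move=> x Vx; have [w [hw cx]] := cell_cover gV m Vx.
    rewrite (bigD1_seq w) ?uniq_words ?wordsP ?hw //= /step indicE mem_set // mule1.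
    rewrite -[leLHS]adde0; apply: leeD; first by rewrite lee_fin ha.
    by apply: sume_ge0 => v _; exact: ind0.
rewrite ge0_integral_sum //; last exact: measurable_V.
have iE w : (\int[mu]_(x in V) step w x = (a w * cell_mass w)%:E)%E.
  rewrite ge0_integralZl_EFin //; first last.
  - by apply/measurable_EFinP; apply: measurable_indic; exact: measurable_cell.
  - exact: measurable_V.
  rewrite integral_indic //; [|exact: measurable_V|exact: measurable_cell].
  rewrite (_ : cell p V w `&` V = cell p V w) ?cell_massE //.
  by apply/setIidPl; exact: (cell_sub gV).
under eq_bigr do rewrite iE.
rewrite sumEFin lee_fin.
apply: le_trans (_ : \sum_(w <- words N m) a w * N%:R^-1 ^+ m <= _).
  rewrite big_seq [leRHS]big_seq; apply: ler_sum => w; rewrite wordsP => /eqP hw.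
  by rewrite ler_wpM2l // -hw; exact: cell_mass_le.
rewrite /a; under eq_bigr do rewrite mulrDl.
rewrite big_split /= -mulr_sumr sum_words_cst mulr1 lerD2r /avg mulr_sumr le_eqVlt.
apply/orP; left; apply/eqP; apply: eq_bigr => w _; rewrite exprS; ring.
Unshelve. all: by end_near. Qed.

End GasketMeasure.

(** * The nonlinearity *)

Section Primitive.
Variable R : realType.

Lemma primitive0_0 (h : R -> R) : primitive0 h 0 = 0.
Proof. by rewrite /primitive0 lexx set_itv1 Rintegral_set1. Qed.

(** Near t both branches of the oriented integral are differences of two integrals from a common
    lower bound - b, to which the fundamental theorem of calculus applies. *)
Lemma is_derive_primitive0 (h : R -> R) (t : R) : continuous h ->
  is_derive t 1 (primitive0 h) (h t).
Proof.
move=> ch; pose mu := @lebesgue_measure R; pose b : R := `|t| + 1.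
have tb : `|t| < b by rewrite ltrDl.
have b0 : 0 < b by apply: le_lt_trans tb.
have ih c d : mu.-integrable [set` `[c, d]] (EFin \o h).
  apply: continuous_compact_integrable; first exact: segment_compact.
  by apply: continuous_subspaceT => s; exact: ch.
pose I s : R := \int[mu]_(y in [set` `[- b, s]]) h y.
have key s : - b < s < b -> I s + - I 0 = primitive0 h s.
  move=> /andP[bs sb]; rewrite /primitive0 /I.
  case: leP => s0.
    rewrite (@Rintegral_itvB R h (BLeft (- b)) (BRight s) 0) ?bnd_simp //.
      apply: Rintegral_itv_obnd_cbnd; apply: integrableS (ih 0 s) => //.
      exact: subset_itv_oc_cc.
    by rewrite ltW // oppr_lt0.
  rewrite -opprB (@Rintegral_itvB R h (BLeft (- b)) (BRight 0) s) ?bnd_simp //; last 2 first.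
  - exact: ltW.
  - exact: ltW.
  congr (- _); apply: Rintegral_itv_obnd_cbnd; apply: integrableS (ih s 0) => //.
  exact: subset_itv_oc_cc.
move: tb; rewrite ltr_norml => tb.
apply: (@near_eq_is_derive _ _ _ (fun s => I s + - I 0)).
  near=> s; apply: key; near: s.
  have : t \in `]- b, b[ by rewrite in_itv.
  by move/near_in_itvoo; apply: filterS => s; rewrite in_itv.
have /andP[bt tb'] := tb.
have [d1 d2] := @continuous_FTC1_closed R h (- b) t b tb' (ih _ _) bt (ch t).
have dI : is_derive t 1 I (h t) by apply: DeriveDef; [exact: d1 | rewrite -derive1E; exact: d2].
rewrite -[h t]addr0; apply: is_derive_add => //; exact: is_derive_cst.
Unshelve. all: by end_near. Qed.

End Primitive.

Section Slices.
Variables (R : realType) (T : topologicalType) (K : set T) (f : T -> R -> R).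
Hypothesis cf : {within K `*` [set: R], continuous (fun z : T * R => f z.1 z.2)}.

Lemma within_graph (u : T -> R) x : K x -> u @ within K (nbhs x) --> u x ->
  (fun y => f y (u y)) @ within K (nbhs x) --> f x (u x).
Proof.
move=> Kx cu; move/subspace_continuousP : cf => /(_ (x, u x)) c.
have {}c : (fun z : T * R => f z.1 z.2) @ within (K `*` [set: R]) (nbhs (x, u x)) --> f x (u x).
  by apply: c; split.
have cp : (fun y => (y, u y)) @ within K (nbhs x) --> (x, u x).
  have cx : (fun y => y) @ within K (nbhs x) --> x by exact: cvg_within.
  exact: (cvg_pair cx cu).
move=> W /c W1; have h : \forall y \near x, K y -> (K `*` [set: R]) (y, u y) -> W (f y (u y)) by exact: (cp _ W1).
change (\forall y \near x, K y -> W (f y (u y))).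
by apply: filterS h => y hy Ky; apply: hy.
Qed.

Lemma continuous_graph (u : T -> R) : {within K, continuous u} ->
  {within K, continuous (fun y => f y (u y))}.
Proof.
move=> /subspace_continuousP cu; apply/subspace_continuousP => x Kx.
by apply: within_graph => //; exact: cu.
Qed.

Lemma continuous_slice x : K x -> continuous (f x).
Proof.
move=> Kx t; move/subspace_continuousP : cf => /(_ (x, t)) c.
have {}c : (fun z : T * R => f z.1 z.2) @ within (K `*` [set: R]) (nbhs (x, t)) --> f x t.
  by apply: c; split.
have cp : (fun s : R => (x, s)) @ t --> (x, t).
  have cx : (fun s : R => x) @ t --> x by exact: cvg_cst.
  have ct : (fun s : R => s) @ t --> t by exact: cvg_id.
  exact: (cvg_pair cx ct).
move=> W /c W1; have h : \forall s \near t, (K `*` [set: R]) (x, s) -> W (f x s) by exact: (cp _ W1).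
by change (\forall s \near t, W (f x s)); apply: filterS h => s; apply; split.
Qed.

Lemma within_strip (B : R) :
  {within K `*` `[- B, B]%classic, continuous (fun z : T * R => f z.1 z.2)}.
Proof. by apply: continuous_subspaceW cf => z [? _]; split. Qed.

End Slices.

Section Strips.
Variables (R : realType) (T : pseudoMetricType R) (K : set T) (f : T -> R -> R).
Hypothesis cK : compact K.
Hypothesis cf : {within K `*` [set: R], continuous (fun z : T * R => f z.1 z.2)}.

Lemma strip_compact (a b : R) : compact (K `*` `[a, b]%classic).
Proof. by apply: compact_setX => //; exact: segment_compact. Qed.

Lemma strip_bound (B : R) : exists2 C : R, 0 <= C &
  forall x t, K x -> `|t| <= B -> `|f x t| <= C.
Proof.
have [C C0 hC] := compact_bound (@strip_compact (- B) B) (@within_strip _ _ _ _ cf B).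
exists C => // x t Kx tB; apply: (hC (x, t)); split => //=.
by rewrite in_itv /= -ler_norml.
Qed.

Lemma strip_uniform (B e : R) : 0 < e -> exists2 d : R, 0 < d &
  forall x s t, K x -> `|s| <= B -> `|t| <= B -> `|s - t| < d -> `|f x s - f x t| < e.
Proof.
move=> e0; have [d d0 hd] := uniform_continuity (@strip_compact (- B) B) (@within_strip _ _ _ _ cf B) e0.
exists d => // x s t Kx sB tB st.
apply: (hd (x, s) (x, t)).
- by split => //=; rewrite in_itv /= -ler_norml.
- by split => //=; rewrite in_itv /= -ler_norml.
- by split; [exact: ballxx | rewrite -ball_normE].
Qed.

(** The reciprocal of f is continuous on a compact set, hence bounded. *)
Lemma strip_negative (a b : R) : (forall x t, K x -> a <= t <= b -> f x t < 0) ->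
  exists2 c : R, 0 < c & forall x t, K x -> a <= t <= b -> f x t <= - c.
Proof.
move=> neg; have cg : {within K `*` `[a, b]%classic, continuous (fun z : T * R => (f z.1 z.2)^-1)}.
  have c : {within K `*` `[a, b]%classic, continuous (fun z : T * R => f z.1 z.2)}.
    by apply: continuous_subspaceW cf => z [? _]; split.
  apply/subspace_continuousP => -[x t] [/= Kx tab]; apply: cvgV.
    by rewrite lt_eqF //= neg //; move: tab; rewrite in_itv.
  by move/subspace_continuousP : c; apply.
have [C C0 hC] := compact_bound (@strip_compact a b) cg.
exists (C + 1)^-1; first by rewrite invr_gt0; lra.
move=> x t Kx tab; have ft := neg x t Kx tab.
have := hC (x, t) (conj Kx _) => /=; rewrite in_itv /= => /(_ tab).
rewrite normfV ltr0_norm // lerNr => h.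
have f0 : 0 < - f x t by rewrite oppr_gt0.
rewrite -[leRHS]invrK lef_pV2 ?posrE ?invr_gt0 //; last by rewrite ltr_wpDl.
by apply: le_trans h _; rewrite lerDl.
Qed.

End Strips.

Lemma continuous_reflect (R : realType) (T : topologicalType) (K : set T) (f : T -> R -> R) :
  {within K `*` [set: R], continuous (fun z : T * R => f z.1 z.2)} ->
  {within K `*` [set: R], continuous (fun z : T * R => - f z.1 (- z.2))}.
Proof.
move=> /subspace_continuousP cf; apply/subspace_continuousP => -[x t] [/= Kx _]; apply: cvgN.
have c := cf (x, - t) (conj Kx I).
have cx : (fun z : T * R => z.1) @ (x, t) --> x by exact: cvg_fst.
have ct : (fun z : T * R => - z.2) @ (x, t) --> - t by apply: cvgN; exact: cvg_snd.
move=> W /c W1.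
have h : \forall z \near (x, t), (K `*` [set: R]) (z.1, - z.2) -> W (f z.1 (- z.2)).
  exact: (cvg_pair cx ct W1).
change (\forall z \near (x, t), (K `*` [set: R]) z -> W (f z.1 (- z.2))).
by apply: filterS h => z hz [Kz _]; apply: hz.
Qed.

Section Growth.
Variable R : realType.

(** In the variable s = ln t the function Phi = F t / t ^+ 2 satisfies
    Phi' = (t * f t - 2 * F t) / t ^+ 2 <= (nu - 2) * Phi <= 0.  It is decreasing, so its slope stays below a
    fixed negative number and it decreases at least linearly in ln t. *)
Lemma superquadratic (F f : R -> R) (nu r eta t : R) :
  (forall s : R, is_derive s 1 F (f s)) -> 2 < nu -> 0 < r -> 0 <= eta ->
  (forall s, r <= s -> s * f s <= nu * F s) -> (forall s, r <= s -> F s <= 0) ->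
  F r <= - eta -> r <= t ->
  F t <= - (eta / r ^+ 2 * ((nu - 2) * (ln t - ln r))) * t ^+ 2.
Proof.
move=> dF nu2 r0 eta0 ar Fle Fr rt.
pose Phi (s : R) : R := F (expR s) * expR (- 2 * s).
pose dPhi (s : R) : R := expR (- 2 * s) * (expR s * f (expR s) - 2 * F (expR s)).
have dP (s : R) : is_derive s 1 Phi (dPhi s).
  have dexp : is_derive s 1 (@expR R) (expR s) by exact: is_derive_expR.
  have d1 : is_derive s 1 (F \o expR) (f (expR s) * expR s).
    have dFs := dF (expR s).
    exact: (@is_derive1_comp _ F expR s (f (expR s)) (expR s)).
  have d2 : is_derive s 1 (fun s : R => expR (0 + s * (- 2))) (expR (0 + s * (- 2)) * (- 2)).
    by apply: is_derive_comp_affine; exact: is_derive_expR.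
  have := @is_deriveM _ _ (F \o expR) _ s 1 _ _ d1 d2.
  rewrite /dPhi /Phi.
  have -> : (fun s : R => F (expR s) * expR (- 2 * s)) = ((F \o expR) * (fun s : R => expR (0 + s * (- 2)))).
    by apply/funext => y; rewrite -[RHS]/(F (expR y) * expR (0 + y * (- 2))) add0r [y * _]mulrC.
  move=> h; apply: is_derive_eq h _; rewrite add0r [s * _]mulrC /= /GRing.scale /=; ring.
have Pt (s : R) : 0 < s -> F s = Phi (ln s) * s ^+ 2.
  move=> s0; rewrite /Phi mulNr expRN expRM_natl lnK ?posrE // mulfVK //.
  by rewrite expf_neq0 // gt_eqF.
have lrt : ln r <= ln t by rewrite ler_ln ?posrE // (lt_le_trans r0 rt).
have dle (s : R) : ln r <= s -> dPhi s <= (nu - 2) * Phi s.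
  move=> rs; have re : r <= expR s by rewrite -[r]lnK ?posrE // ler_expR.
  have := ar _ re; rewrite /dPhi /Phi => h.
  have e0 := expR_gt0 (- 2 * s).
  by nra.
have Ple (s : R) : ln r <= s -> Phi s <= 0.
  move=> rs; have re : r <= expR s by rewrite -[r]lnK ?posrE // ler_expR.
  by rewrite /Phi mulr_le0_ge0 ?Fle // expR_ge0.
have step1 (s : R) : ln r <= s -> Phi s <= Phi (ln r).
  move=> rs; have [y /andP[ry ys] e] := mean_value rs dP.
  have d0 : dPhi y <= 0.
    apply: le_trans (dle y ry) _; rewrite mulr_ge0_le0 ?Ple // subr_ge0; exact: ltW.
  by rewrite -subr_le0 e mulr_le0_ge0 // subr_ge0.
have Pr : Phi (ln r) <= - (eta / r ^+ 2).
  rewrite -mulNr ler_pdivlMr ?exprn_gt0 // -Pt //.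
have [y /andP[ry yt] e] := mean_value lrt dP.
rewrite Pt ?(lt_le_trans r0 rt) //; apply: ler_wpM2r; first exact: sqr_ge0.
have := step1 y ry; have := dle y ry.
have := Ple (ln r) (lexx _).
move: e Pr lrt nu2; set a := Phi (ln t); set b := Phi (ln r); set c := Phi y; set d := dPhi y.
set k := eta / _ => e Pr lrt nu2 b0 dc cb.
have h : (nu - 2) * c <= - ((nu - 2) * k) by nra.
have : a - b <= - ((nu - 2) * k) * (ln t - ln r) by rewrite e; nra.
by lra.
Qed.

Variables (T : pseudoMetricType R) (K : set T).
Hypothesis cK : compact K.

(** On the strip r0 <= t <= r0 + 1 the function f is bounded away from 0 (strip_negative), so
    F x (r0 + 1) is negative uniformly in x and superquadratic applies from there. *)
Lemma growth_right (f F : T -> R -> R) (nu r0 A : R) :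
  {within K `*` [set: R], continuous (fun z : T * R => f z.1 z.2)} ->
  (forall x (t : R), K x -> is_derive t 1 (F x) (f x t)) ->
  2 < nu -> 0 < r0 ->
  (forall x t, K x -> r0 <= t -> t * f x t <= nu * F x t /\ nu * F x t < 0) ->
  exists2 B, 0 <= B & forall x t, K x -> B <= t -> F x t <= - A * t ^+ 2.
Proof.
move=> cf dF nu2 r00 ar.
have Fneg x t : K x -> r0 <= t -> F x t < 0.
  move=> Kx rt; have [_] := ar x t Kx rt; rewrite pmulr_rlt0 //; lra.
have [|c c0 hc] := @strip_negative R T K f cK cf r0 (r0 + 1).
  move=> x t Kx /andP[rt _]; have [h1 h2] := ar x t Kx rt.
  have : t * f x t < 0 by apply: le_lt_trans h1 h2.
  by rewrite pmulr_rlt0 // (lt_le_trans r00 rt).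
pose r := r0 + 1; have r1 : 0 < r by rewrite /r; lra.
have Fr x : K x -> F x r <= - c.
  move=> Kx; have rr : r0 <= r by rewrite /r; lra.
  have [y /andP[ry yr] e] := mean_value rr (fun t => dF x t Kx).
  have := hc x y Kx; rewrite ry yr => /(_ isT).
  have := Fneg x r0 Kx (lexx _); move: e; rewrite /r => e h1 h2; nra.
pose k : R := c / r ^+ 2 * (nu - 2).
have k0 : 0 < k by rewrite mulr_gt0 ?divr_gt0 ?exprn_gt0 //; lra.
pose B := Num.max r (expR (ln r + A / k)).
exists B; first by rewrite le_max ltW.
move=> x t Kx; rewrite /B ge_max => /andP[rt et].
have t0 : 0 < t by rewrite (lt_le_trans r1 rt).
have rr : r0 <= r by rewrite /r; lra.
apply: le_trans (@superquadratic (F x) (f x) nu r c t _ nu2 r1 (ltW c0) _ _ (Fr x Kx) rt) _.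
- by move=> s; exact: dF.
- by move=> s rs; have [] := ar x s Kx (le_trans rr rs).
- by move=> s rs; apply: ltW; apply: Fneg => //; apply: le_trans rr rs.
apply: ler_wpM2r; first exact: sqr_ge0.
rewrite lerN2 mulrA -/k -ler_pdivrMl // [_ * A]mulrC lerBrDl.
by rewrite -ler_expR lnK ?posrE.
Qed.

Variables (f F : T -> R -> R) (nu r0 : R).
Hypothesis cf : {within K `*` [set: R], continuous (fun z : T * R => f z.1 z.2)}.
Hypothesis dF : forall x (t : R), K x -> is_derive t 1 (F x) (f x t).
Hypothesis F0 : forall x, K x -> F x 0 = 0.
Hypothesis nu2 : 2 < nu.
Hypothesis r00 : 0 < r0.
Hypothesis ar : forall x t, K x -> r0 <= `|t| -> t * f x t <= nu * F x t /\ nu * F x t < 0.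

Lemma primitive_lipschitz (B : R) : exists2 C : R, 0 <= C &
  forall x s t, K x -> `|s| <= B -> `|t| <= B -> `|F x s - F x t| <= C * `|s - t|.
Proof.
have [C C0 hC] := @strip_bound R T K f cK cf B; exists C => // x.
have main s t : K x -> `|s| <= B -> `|t| <= B -> s <= t -> `|F x t - F x s| <= C * `|t - s|.
  move=> Kx + + st; rewrite 2!(ler_norml _ B) => /andP[Bs sB] /andP[Bt tB].
  have [y /andP[sy yt] ->] := mean_value st (fun t => dF t Kx).
  by rewrite normrM ler_wpM2r // hC // ler_norml (le_trans Bs) ?(le_trans yt).
move=> s t Kx sB tB; case: (leP s t) => st; last exact: (main t s Kx tB sB (ltW st)).
by rewrite distrC [`|s - t|]distrC; exact: main.
Qed.

Lemma primitive_growth A : 0 <= A -> exists2 C : R, 0 <= C &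
  forall x t, K x -> F x t <= C - A * t ^+ 2.
Proof.
move=> A0.
have [|B1 B10 h1] := @growth_right f F nu r0 A cf dF nu2 r00.
  by move=> x t Kx rt; apply: ar => //; rewrite (le_trans rt) // ler_norm.
have [|||B2 B20 h2] := @growth_right (fun x t => - f x (- t)) (fun x t => F x (- t)) nu r0 A _ _ nu2 r00.
- exact: continuous_reflect.
- move=> x t Kx; have := @is_derive_comp_affine R (F x) 0 (-1) t.
  rewrite add0r mulrN1 => /(_ _ (dF _ Kx)).
  rewrite mulrN1 (_ : (fun s => _) = (fun s => F x (- s))) //.
  by apply/funext => s; rewrite add0r mulrN1.
- move=> x t Kx rt; rewrite mulrN -mulNr; apply: ar => //.
  by rewrite normrN (le_trans rt) // ler_norm.
pose B := Num.max B1 B2.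
have B0 : 0 <= B by rewrite le_max B10.
have [C C0 hC] := primitive_lipschitz B.
exists (C * B + A * B ^+ 2); first by rewrite addr_ge0 ?mulr_ge0.
move=> x t Kx; have p0 : 0 <= C * B + A * B ^+ 2 by rewrite addr_ge0 ?mulr_ge0.
case: (leP `|t| B) => tB.
  have := hC x t 0 Kx tB; rewrite normr0 F0 // !subr0 => /(_ B0) h.
  have h3 : C * `|t| <= C * B by rewrite ler_wpM2l.
  have h4 : A * t ^+ 2 <= A * B ^+ 2.
    by rewrite ler_wpM2l // -[t ^+ 2]real_normK ?num_real // lerXn2r ?nnegrE.
  have := ler_norm (F x t); lra.
case: (leP 0 t) => t0.
  have : F x t <= - A * t ^+ 2.
    apply: h1 => //; move: tB; rewrite ger0_norm // => /ltW; rewrite /B ge_max => /andP[]//.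
  by rewrite mulNr; lra.
have : F x (- - t) <= - A * (- t) ^+ 2.
  apply: h2 => //; move: tB; rewrite ltr0_norm // => /ltW; rewrite /B ge_max => /andP[]//.
by rewrite opprK sqrrN mulNr; lra.
Qed.

Lemma superlinear_everywhere : exists2 C : R, 0 <= C &
  forall x t, K x -> t * f x t <= nu * F x t + C.
Proof.
have [C C0 hC] := @strip_bound R T K f cK cf r0.
have [D D0 hD] := primitive_lipschitz r0.
have nu0 : 0 <= nu by have := nu2; lra.
have r0' := ltW r00.
exists (r0 * C + nu * (D * r0)); first by rewrite addr_ge0 ?mulr_ge0.
move=> x t Kx; case: (leP r0 `|t|) => rt.
  have [h _] := ar Kx rt; apply: le_trans h _; rewrite lerDl.
  by rewrite addr_ge0 ?mulr_ge0.
have tr := ltW rt.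
have h1 : t * f x t <= r0 * C.
  apply: le_trans (ler_norm _) _; rewrite normrM ler_pM //; exact: hC.
have h2 : - F x t <= D * r0.
  have := hD x t 0 Kx tr; rewrite normr0 F0 // !subr0 => /(_ r0') h.
  have := ler_norm (- F x t); rewrite normrN => h3.
  by apply: le_trans h3 (le_trans h _); rewrite ler_wpM2l.
have : nu * - F x t <= nu * (D * r0) by rewrite ler_wpM2l.
by rewrite mulrN; lra.
Qed.

End Growth.

(** * Passage to the limit *)

Section Energy.
Variables (R : realType) (n N : nat) (p : 'I_N -> 'rV[R]_n).
Hypothesis hN : (2 <= N)%N.
Hypothesis hp : forall i j : 'I_N, i <> j -> enorm (p i - p j) = 1.

Lemma nondecreasing_energy_at (u : 'rV[R]_n -> R) :
  nondecreasing_seq (fun m => (energy_at p m u)%:E).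
Proof. by move=> k m km; rewrite lee_fin; exact: energy_at_leq. Qed.

Lemma energy_le (u : 'rV[R]_n -> R) (E : R) :
  (forall k, energy_at p k u <= E) -> (energy p u <= E%:E)%E.
Proof.
move=> h; apply: lime_le; first exact: ereal_nondecreasing_is_cvgn (nondecreasing_energy_at u).
by apply: nearW => k; rewrite lee_fin.
Qed.

Lemma energy_ge0 (u : 'rV[R]_n -> R) : (0 <= energy p u)%E.
Proof.
apply: lime_ge; first exact: ereal_nondecreasing_is_cvgn (nondecreasing_energy_at u).
by apply: nearW => k; rewrite lee_fin; exact: energy_at_ge0.
Qed.

End Energy.

Section BoundedEquicontinuity.
Variables (R : realType) (T : pseudoMetricType R) (K : set T).
Hypothesis cK : compact K.

(** This is weaker than joint continuity, and holds for the primitive F by its Lipschitz estimate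
    alone. *)
Definition equicontinuous_slices (Phi : T -> R -> R) := forall B e : R, 0 < e ->
  exists2 d : R, 0 < d & forall x s t, K x -> `|s| <= B -> `|t| <= B -> `|s - t| < d ->
    `|Phi x s - Phi x t| < e.

Lemma equicontinuous_joint (Phi : T -> R -> R) :
  {within K `*` [set: R], continuous (fun z : T * R => Phi z.1 z.2)} ->
  equicontinuous_slices Phi.
Proof. by move=> c B e e0; exact: strip_uniform. Qed.

Lemma equicontinuous_sub (Phi Psi : T -> R -> R) :
  equicontinuous_slices Phi -> equicontinuous_slices Psi ->
  equicontinuous_slices (fun x t => Phi x t - Psi x t).
Proof.
move=> h1 h2 B e e0; have e20 : 0 < e / 2 by rewrite divr_gt0.
have [d1 d10 H1] := h1 B _ e20; have [d2 d20 H2] := h2 B _ e20.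
exists (Num.min d1 d2); first by rewrite lt_min d10.
move=> x s t Kx sB tB; rewrite lt_min => /andP[st1 st2].
have -> : Phi x s - Psi x s - (Phi x t - Psi x t)
  = (Phi x s - Phi x t) - (Psi x s - Psi x t) by ring.
have a := H1 x s t Kx sB tB st1; have b := H2 x s t Kx sB tB st2.
by apply: le_lt_trans (ler_normB _ _) _; lra.
Qed.

Lemma equicontinuous_primitive (f F : T -> R -> R) :
  {within K `*` [set: R], continuous (fun z : T * R => f z.1 z.2)} ->
  (forall x (t : R), K x -> is_derive t 1 (F x) (f x t)) ->
  equicontinuous_slices F.
Proof.
move=> cf dF B e e0; have [C C0 hC] := primitive_lipschitz cK cf dF B.
exists (e / (C + 1)); first by rewrite divr_gt0 // ltr_wpDl.
move=> x s t Kx sB tB; rewrite ltr_pdivlMr ?ltr_wpDl // => st.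
apply: le_lt_trans (hC x s t Kx sB tB) _; apply: le_lt_trans st.
by rewrite mulrC ler_wpM2l // lerDl.
Qed.

Lemma within_fst (g : T -> R) : {within K, continuous g} ->
  {within K `*` [set: R], continuous (fun z : T * R => g z.1)}.
Proof.
move=> /subspace_continuousP cg; apply/subspace_continuousP => -[x t] [/= Kx _].
move=> W W1; have h : \forall y \near x, K y -> W (g y) by exact: (cg x Kx).
have cx : (fun z : T * R => z.1) @ (x, t) --> x by exact: cvg_fst.
change (\forall z \near (x, t), (K `*` [set: R]) z -> W (g z.1)).
have hfst : \forall z \near (x, t), K z.1 -> W (g z.1) by exact: (cx _ h).
by apply: filterS hfst => z hz [Kz _]; exact: hz.
Qed.

Lemma within_snd : {within K `*` [set: R], continuous (fun z : T * R => z.2)}.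
Proof. by apply: continuous_subspaceT => z; exact: cvg_snd. Qed.

End BoundedEquicontinuity.

Section Solution.
Variables (R : realType) (n N : nat) (p : 'I_N -> 'rV[R]_n) (V : set 'rV[R]_n).
Hypothesis hN : (2 <= N)%N.
Hypothesis hp : forall i j : 'I_N, i <> j -> enorm (p i - p j) = 1.
Hypothesis gV : is_gasket p V.
Variables (alpha : 'rV[R]_n -> R) (f : 'rV[R]_n -> R -> R).
Hypothesis calpha : {within V, continuous alpha}.
Hypothesis cf : {within V `*` [set: R], continuous (fun z : 'rV[R]_n * R => f z.1 z.2)}.

Let cV : compact V. Proof. by case: gV. Qed.

Variables (U : set_system nat) (UU : UltraFilter U).
Hypothesis Uoo : \oo `<=` U.
Variables (v : nat -> 'rV[R]_n -> R) (E : R).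
Hypothesis hv : forall m, discrete_solution p alpha f m.+1 (v m).
Hypothesis vE : forall m, energy_at p m.+1 (v m) <= E.

Let v0 m i : v m (p i) = 0. Proof. by case: (hv m). Qed.
Let PU : ProperFilter U := @ultra_proper _ U UU.
Local Existing Instance PU.
Local Notation u := (limit_fun p V hN U v).

Let cu : {within V, continuous u}. Proof. exact: (limit_continuous hp gV UU Uoo v0 vE). Qed.

Lemma limit_compose (Phi : 'rV[R]_n -> R -> R) (e : R) : equicontinuous_slices V Phi -> 0 < e ->
  \forall m \near U, forall z, vertices p m.+1 z -> `|Phi z (v m z) - Phi z (u z)| <= e.
Proof.
move=> hPhi e0; have [B1 B10 hB1] := compact_bound cV cu.
pose B2 : R := (N%:R + 2) * Num.sqrt E.
have B20 : 0 <= B2 by rewrite mulr_ge0 ?sqrtr_ge0 ?addr_ge0.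
have [d d0 hd] := hPhi (B1 + B2) e e0.
have d20 : 0 < d / 2 by rewrite divr_gt0.
near=> m => z hz; have Vz := vertices_in gV hz.
apply: ltW; apply: hd => //.
- apply: le_trans (sobolev hN hp (v0 m) hz) _; apply: le_trans (_ : B2 <= _); last by rewrite lerDr.
  by rewrite ler_wpM2l ?addr_ge0 // ler_wsqrtr.
- by apply: le_trans (hB1 z Vz) _; rewrite lerDl.
- apply: (@le_lt_trans _ _ (d / 2)); last by rewrite ltr_pdivrMr // ltr_pMr // ltr1n.
  by move: (z) hz {Vz}; near: m; exact: (limit_uniform hN hp gV UU Uoo v0 vE d20).
Unshelve. all: by end_near. Qed.

Let rhs (x : 'rV[R]_n) (t : R) : R := f x t - alpha x * t.

Let joint_rhs : {within V `*` [set: R], continuous (fun z : 'rV[R]_n * R => rhs z.1 z.2)}.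
Proof.
move=> z; apply: cont_sub; first exact: cf.
by apply: cont_mul; [exact: (within_fst calpha) | exact: within_snd].
Qed.

Lemma limit_laplacian_rhs (e : R) : 0 < e -> \forall k \near \oo, forall x, vertices p k x ->
  ~ boundary p x -> `|laplacian_at p k u x - rhs x (u x)| <= e.
Proof.
move=> e0; apply: (limit_laplacian hN hp gV UU Uoo v0 vE (continuous_graph joint_rhs cu)) => // e' e'0.
have := limit_compose (equicontinuous_joint cV joint_rhs) e'0.
by apply: filterS => m h z hz hb; have [_ eqv _] := hv m; rewrite eqv //; exact: h.
Qed.

Lemma limit_strong_solution : strong_solution p V alpha f u.
Proof.
have crhs := continuous_graph joint_rhs cu.
have energyE : (energy p u <= E%:E)%E.
  apply: (energy_le hN hp) => k; apply: (limit_energy hN hp gV UU Uoo v0 vE).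
  by apply: nearW.
split.
  split; first exact: cu.
    by move=> _ [i _ <-]; exact: (limit_boundary hN hp gV UU Uoo v0 vE).
  by apply: le_lt_trans energyE _; rewrite ltry.
exists (fun x => rhs x (u x)); split; last by move=> x _; rewrite /rhs subrK.
split => //; apply/cvgrPdist_le => e e0.
have := limit_laplacian_rhs e0.
apply: filterS => k hk; rewrite sub0r normrN.
case: (pselect ((vertices p k `\` boundary p) !=set0)) => [[x hx]|none].
  rewrite ger0_norm.
    apply: ge_sup; first by exists `|laplacian_at p k u x - rhs x (u x)|, x.
    by move=> _ [y [hy hb] <-]; exact: hk.
  apply: le_trans (normr_ge0 (laplacian_at p k u x - rhs x (u x))) _.
  apply: sup_upper_bound; last by exists x.
  split; first by exists `|laplacian_at p k u x - rhs x (u x)|, x.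
  by exists e => _ [y [hy hb] <-]; exact: hk.
rewrite (_ : [set _ | _ in _] = set0) ?sup0 ?normr0 ?ltW //.
by apply/seteqP; split => // z [y hy _]; apply: none; exists y.
Qed.

(** A solution vanishing on V would have zero Laplacian at a midpoint, where the equation then reads
    f x 0 = 0. *)
Lemma limit_nontrivial : (forall x, V x -> f x 0 <> 0) -> nontrivial_on V u.
Proof.
move=> f0; apply: contrapT => triv.
have u0 x : V x -> u x = 0 by move=> Vx; apply: contrapT => ux; apply: triv; exists x.
pose l : 'I_N := Ordinal (leq_trans (ltnSn 0) (ltnW hN)).
pose j : 'I_N := Ordinal hN.
pose x0 := vtx p (rcons [::] l) j.
have x0b : ~ boundary p x0 by apply: mid_not_boundary.
have x0v k : (1 <= k)%N -> vertices p k x0.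
  by move=> k1; apply: (vertices_leq k1); exact: (vertices_vtx p (rcons [::] l) j).
have Vx0 := vertices_in gV (x0v 1 (leqnn 1)).
have lap0 k : laplacian_at p k u x0 = 0.
  rewrite /laplacian_at fsbig1 ?mulr0 // => y [vy vx _ _].
  by rewrite (u0 _ (vertices_in gV vy)) (u0 _ Vx0) subrr.
apply: (f0 _ Vx0); apply/eqP; rewrite -normr_le0; apply/ler_addgt0Pr => e e0; rewrite add0r.
have [k _ hk] := limit_laplacian_rhs e0.
have := hk (maxn k 1) (leq_maxl _ _) x0 (x0v _ (leq_maxr _ _)) x0b.
by rewrite lap0 /rhs u0 // mulr0 subr0 sub0r normrN.
Qed.

Variable F : 'rV[R]_n -> R -> R.
Hypothesis dF : forall x (t : R), V x -> is_derive t 1 (F x) (f x t).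

(** Along discrete solutions the functional is the average of F - f * t / 2, which no longer
    contains the energy; it therefore passes to the limit under mere uniform convergence. *)
Lemma limit_action (e : R) : 0 < e -> \forall m \near U,
  `|Jfun p alpha F m.+1 (v m) - avg p m.+1 (fun x => F x (u x) - f x (u x) * u x / 2)| <= e.
Proof.
move=> e0; pose Psi (x : 'rV[R]_n) (t : R) : R := F x t - f x t * t / 2.
have eqPsi : equicontinuous_slices V Psi.
  apply: equicontinuous_sub; first exact: (equicontinuous_primitive cV cf dF).
  apply: equicontinuous_joint => // z; apply: cont_mul; last exact: cont_cst.
  by apply: cont_mul; [exact: cf | exact: within_snd].
have := limit_compose eqPsi e0; apply: filterS => m h.
have [_ _ q] := hv m.
have -> : Jfun p alpha F m.+1 (v m) = avg p m.+1 (fun x => Psi x (v m x)).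
  rewrite /Jfun q /Psi avgB addrC mulNr; congr (_ - _).
  rewrite mulrC -avgZ; apply: avg_eq => x _; exact: mulrC.
rewrite -avgB; apply: le_trans (avg_norm _ _ _) _.
by rewrite -[leRHS](avg_cst p hN m.+1); exact: avg_le.
Qed.

Variable mu : {measure set (borel R n) -> \bar R}.
Hypothesis hmu : is_gasket_measure N V mu.
Hypothesis alpha_le0 : forall x, V x -> alpha x <= 0.

(** The energy is lower semicontinuous and the integral of - alpha * u ^ 2 is at most the limit of
    its averages over vertices (integral_le_avg), so the sum is at most the limit of the quadratic forms. *)
Lemma limit_norm_alpha (Q : R) : (forall m, qform p alpha m.+1 (v m) <= Q) ->
  norm_alpha p V mu alpha u <= Num.sqrt Q.
Proof.
move=> vQ; pose w (x : 'rV[R]_n) (t : R) : R := - alpha x * t ^+ 2.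
have jw : {within V `*` [set: R], continuous (fun z : 'rV[R]_n * R => w z.1 z.2)}.
  move=> z; apply: cont_mul; first by apply: cont_opp; exact: (within_fst calpha).
  by apply: cont_mul; exact: within_snd.
pose h x := w x (u x).
have ch : {within V, continuous h} := continuous_graph jw cu.
have h0 x : V x -> 0 <= h x by move=> Vx; rewrite mulr_ge0 ?sqr_ge0 // oppr_ge0 alpha_le0.
set I := (\int[mu]_(x in V) (h x)%:E)%E.
have I0 : (0 <= I)%E by apply: integral_ge0 => x Vx; rewrite lee_fin h0.
have Ifin : I \is a fin_num.
  have [m _ hm] := integral_le_avg hN gV hmu ch h0 (@ltr01 R).
  by rewrite ge0_fin_numE // (le_lt_trans (hm m (leqnn m))) ?ltry.
have key e : 0 < e -> forall k, energy_at p k u <= Q - fine I + (e + e).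
  move=> e0 k; apply: (limit_energy hN hp gV UU Uoo v0 vE).
  have c1 := limit_compose (equicontinuous_joint cV jw) e0.
  have c2 : \forall m \near U, (I <= (avg p m.+1 h + e)%:E)%E.
    apply: Uoo; have [m0 _ hm] := integral_le_avg hN gV hmu ch h0 e0.
    by exists m0 => // m /= m0m; apply: hm; exact: leqW.
  near=> m.
  have a1 : fine I <= avg p m.+1 h + e by rewrite -lee_fin fineK //; near: m; exact: c2.
  have a2 : avg p m.+1 h <= avg p m.+1 (fun x => w x (v m x)) + e.
    rewrite -[X in _ + X](avg_cst p hN m.+1) -avgD; apply: avg_le => x hx.
    have : `|w x (v m x) - w x (u x)| <= e by move: (x) hx; near: m; exact: c1.
    by rewrite ler_norml /h => /andP[+ _]; lra.
  have a3 : energy_at p m.+1 (v m) = qform p alpha m.+1 (v m) - avg p m.+1 (fun x => w x (v m x)).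
    rewrite /qform /w -addrA; rewrite -opprD -avgD (@avg_eq _ _ _ _ _ _ (fun=> 0)) ?avg_cst ?subr0 //.
    by move=> x _; rewrite mulNr subrr.
  by have := vQ m; rewrite a3; lra.
have {}key k : energy_at p k u <= Q - fine I.
  apply/ler_addgt0Pr => e e0; have e20 : 0 < e / 2 by rewrite divr_gt0.
  by have := key _ e20 k; lra.
rewrite /norm_alpha; apply: ler_wsqrtr.
have -> : (\int[mu]_(x in V) (alpha x * `|u x| ^+ 2))%R = - fine I.
  rewrite /Rintegral -fineN /I -integral_ge0N; last by move=> x Vx; rewrite lee_fin h0.
  congr fine; apply: eq_integral => x _.
  by rewrite -EFinN /h /w mulNr opprK real_normK ?num_real.
rewrite opprK -lerBrDr -lee_fin; apply: le_trans (energy_le hN hp key).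
rewrite fineK // fin_numElt (lt_le_trans _ (energy_ge0 hN hp u)) ?ltNyr //=.
by apply: le_lt_trans (energy_le hN hp key) _; rewrite ltry.
Unshelve. all: by end_near. Qed.

End Solution.

(** * The two solutions *)

Theorem theorem1p2 (R : realType) (N : nat) (hN : (2 <= N)%N)
  (p : 'I_N -> 'rV[R]_(N.-1))
  (hp : forall i j : 'I_N, i <> j -> enorm (p i - p j) = 1)
  (V : set 'rV[R]_(N.-1)) (hV : is_gasket p V)
  (mu : {measure set (borel R N.-1) -> \bar R}) (hmu : is_gasket_measure N V mu)
  (alpha : 'rV[R]_(N.-1) -> R)
  (halpha : {within V, continuous alpha})
  (halpha_le0 : {ae mu, forall x, V x -> alpha x <= 0})
  (f : 'rV[R]_(N.-1) -> R -> R)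
  (hf : {within V `*` [set: R], continuous (fun z : 'rV[R]_(N.-1) * R => f z.1 z.2)})
  (hf0 : forall x, V x -> f x 0 <> 0)
  (hF : exists nu r0 : R, [/\ 2 < nu, 0 < r0 &
     forall (x : 'rV[R]_(N.-1)) (t : R), V x -> r0 <= `|t| ->
       t * f x t <= nu * primitive0 (f x) t /\ nu * primitive0 (f x) t < 0])
  (M0 beta : R) (hM0 : 0 < M0) (hbeta : 0 < beta)
  (hfM0 : forall (x : 'rV[R]_(N.-1)) (s : R), V x -> - M0 <= s <= M0 ->
     `|f x s| <= M0 / (2 * (beta + 1) * (2 * N%:R + 3) ^+ 2)) :
  exists u1 u2 : 'rV[R]_(N.-1) -> R,
    [/\ strong_solution p V alpha f u1 /\ nontrivial_on V u1,
        strong_solution p V alpha f u2 /\ nontrivial_on V u2,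
        exists2 x, V x & u1 x <> u2 x &
        norm_alpha p V mu alpha u1 < M0 / (2 * N%:R + 3)].
Proof.
have [nu [r0 [nu2 r00 ar]]] := hF.
have cV : compact V by case: hV.
have verts m x : vertices p m x -> V x by exact: vertices_in.
have alpha0 x : V x -> alpha x <= 0 by exact: (ae_le0_le0 hN hV hmu halpha halpha_le0).
pose F (x : 'rV[R]_(N.-1)) (t : R) : R := primitive0 (f x) t.
have slice x : V x -> continuous (f x) by exact: continuous_slice.
have dF x (t : R) : V x -> is_derive t 1 (F x) (f x t).
  by move=> Vx; apply: is_derive_primitive0; exact: slice.
have F0 x : V x -> F x 0 = 0 by move=> _; exact: primitive0_0.
have [Al Al0 hAl] := compact_bound cV halpha.
have {}hAl x : V x -> - alpha x <= Al.
  by move=> /hAl; apply: le_trans; rewrite -normrN ler_norm.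
have [C1 C10 hC1] := superlinear_everywhere cV hf dF F0 nu2 r00 ar.
have T0 : 0 <= 2 * test_energy N Al.
  have N1 : 1 <= N%:R :> R by rewrite ler1n ltnW.
  rewrite mulr_ge0 // addr_ge0 // mulr_ge0 ?subr_ge0 // mulr_ge0 // addr_ge0 //.
have [Cg Cg0 hCg] := primitive_growth cV hf dF F0 nu2 r00 ar T0.
have [v1 hv1] := choice (fun m =>
  first_discrete_solution hN hp verts alpha0 dF slice F0 hM0 hbeta hfM0 m.+1).
have [v2 hv2] := choice (second_discrete_solution hN hp verts alpha0 dF slice F0 hM0 hbeta hfM0
  nu2 C10 Al0 hC1 hAl Cg0 hCg).
have [U [UU Uoo]] := @ultraFilterLemma nat \oo _.
have PU : ProperFilter U := @ultra_proper _ U UU.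
have s1 m : discrete_solution p alpha f m.+1 (v1 m) by case: (hv1 m).
have s2 m : discrete_solution p alpha f m.+1 (v2 m) by case: (hv2 m).
have E1 m : energy_at p m.+1 (v1 m) <= radius N M0 ^+ 2.
  by case: (hv1 m) => _ q _; apply: le_trans (energy_le_qform hN verts alpha0 _ _) q.
have E2 m : energy_at p m.+1 (v2 m) <= energy_bound nu C1 Cg.
  by case: (hv2 m) => _ q _; apply: le_trans (energy_le_qform hN verts alpha0 _ _) q.
pose u1 := limit_fun p V hN U v1; pose u2 := limit_fun p V hN U v2.
have rho0 : 0 < radius N M0 by rewrite divr_gt0 // addr_gt0 // mulr_gt0 // ltr0n ltnW.
exists u1, u2; split.
- split; first exact: (limit_strong_solution hN hp hV halpha hf UU Uoo s1 E1).
  exact: (limit_nontrivial hN hp hV halpha hf UU Uoo s1 E1).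
- split; first exact: (limit_strong_solution hN hp hV halpha hf UU Uoo s2 E2).
  exact: (limit_nontrivial hN hp hV halpha hf UU Uoo s2 E2).
  (* equal limits would give equal limits of the functional, against J v1 <= 0 and J v2 >= ridge_height / 2 *)
- apply: contrapT => same.
  have u12 x : V x -> u1 x = u2 x by move=> Vx; apply: contrapT => ne; apply: same; exists x.
  have c0 : 0 < ridge_height N M0 beta.
    by rewrite mulr_gt0 ?divr_gt0 ?exprn_gt0 // ltr_wpDl // ltW.
  have e0 : 0 < ridge_height N M0 beta / 5 by rewrite divr_gt0.
  have a1 := limit_action hN hp hV hf UU Uoo s1 E1 dF e0.
  have a2 := limit_action hN hp hV hf UU Uoo s2 E2 dF e0.
  have [m [b1 b2]] := @filter_ex _ U _ _ (filterI a1 a2).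
  have [_ _ j1] := hv1 m; have [_ _ j2] := hv2 m.
  rewrite -/u1 in b1; rewrite -/u2 in b2.
  rewrite -(@avg_eq _ _ _ _ _ (fun x => F x (u1 x) - f x (u1 x) * u1 x / 2)) in b2; last first.
    by move=> x /verts Vx; rewrite u12.
  move: b1 b2 j1 j2 c0; rewrite !ler_norml => /andP[+ _] /andP[_ +]; lra.
- pose Q : R := radius N M0 ^+ 2 / 2.
  apply: le_lt_trans (limit_norm_alpha hN hp hV halpha UU Uoo s1 E1 hmu alpha0 (Q := Q) _) _.
    move=> m; have [[v0 _ eq_q] q _] := hv1 m; rewrite eq_q.
    (* tested against itself, the equation bounds the quadratic form by the maximum of |f| times M0 *)
    pose phi : R := M0 / (2 * (beta + 1) * (2 * N%:R + 3) ^+ 2).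
    have b1 : 1 <= beta + 1 by rewrite lerDr ltW.
    have phiQ : phi * M0 <= Q.
      have -> : phi * M0 = Q * (beta + 1)^-1.
        rewrite /phi /Q /radius; field.
        by rewrite !gt_eqF // ?(lt_le_trans ltr01 b1) // addr_gt0 // mulr_gt0 // ltr0n ltnW.
      apply: ler_piMr; first by rewrite divr_ge0 ?sqr_ge0.
      by rewrite invf_le1 // (lt_le_trans ltr01 b1).
    apply: le_trans phiQ; rewrite -avgN -[leRHS](avg_cst p hN m.+1); apply: avg_le => x hx.
    have vM := ball_sup_le hN hp verts alpha0 hM0 hbeta v0 hx q.
    apply: le_trans (ler_norm _) _; rewrite normrN normrM ler_pM //.
    by apply: hfM0; [exact: verts hx | rewrite -ler_norml].
  rewrite -[X in _ < X](ger0_norm (ltW rho0)) -sqrtr_sqr ltr_sqrt ?exprn_gt0 //.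
  by rewrite ltr_pdivrMr // ltr_pMr ?exprn_gt0 // ltr1n.
Qed.
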